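(* Let $D=\mathrm{Spec}\,\mathcal{O}_D$ with $\mathcal{O}_D$ a complete discrete valuation ring whose residue field $k$ is algebraically closed, and let $G$ be a finite group acting faithfully on $V=\mathbb{A}_D^d=\mathrm{Spec}\,\mathcal{O}_D[x_1,\dots,x_d]$ over $D$ by permutations of the coordinates. Let $f=\sum_{i=1}^d f_ix_i$ ($f_i\in\mathcal{O}_D$) be a $G$-invariant linear form with at least one coefficient $f_i$ a unit, and let $\mathsf{v}\cong\mathbb{A}_D^{d-1}$ be the hyperplane of $V$ defined by $f=0$, with the induced linear $G$-action. Let $E$ be a $G$-cover of $D$, $F$ a connected component of $E$ with stabilizer $H$, and suppose the coordinates are ordered so that the $H$-orbits in $\{x_1,\dots,x_d\}$ are $O_1,\dots,O_l$ with $x_j\in O_j$ for $1\le j\le l$. Let $C_j\to D$ $(1\le j\le l)$ be the associated connected covers. Then $$\mathbf{v}_{\mathsf{v}}(E)=\frac12\sum_{j=1}^{l}d_{C_j/D}-\min\left\{v_D(f_j)+\left\lfloor\frac{d_{C_j/D}}{[C_j:D]}\right\rfloor\;\middle|\;1\le j\le l\right\}.$$ In particular, if $f=x_1+x_2+\cdots+x_d$, then $$\mathbf{v}_{\mathsf{v}}(E)=\frac12\sum_{j=1}^{l}d_{C_j/D}-\min\left\{\left\lfloor\frac{d_{C_j/D}}{[C_j:D]}\right\rfloor\;\middle|\;1\le j\le l\right\}.$$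
   Context: Conventions: a left $G$-action on an affine scheme corresponds to a right $G$-action on its coordinate ring by pull-back of functions. $K(X)$ denotes the function field (total fraction ring) of $X$; $\mathfrak{m}_D$ is the maximal ideal of $\mathcal{O}_D$; $v_D$ is the normalized valuation of $K(D)$, with $v_D(0)=+\infty$. $\lfloor r\rfloor$ is the largest integer $\le r$. $G$-covers: a $G$-cover of $D$ is a $D$-scheme $E$ with a left $G$-action such that $E\otimes_{\mathcal{O}_D}K(D)$ is an étale $G$-torsor over $\mathrm{Spec}\,K(D)$ and $E$ is the normalization of $D$ in it. If $F$ is a connected component of $E$ with stabilizer $H\subset G$, then $F$ is a connected $H$-cover of $D$. The function $\mathbf{v}$: for a free $\mathcal{O}_D$-module $N$ of finite rank with a right $\mathcal{O}_D$-linear $G$-action, and $\mathsf{w}=\mathrm{Spec}\,S^\bullet_{\mathcal{O}_D}N$, put $\Xi_F=\mathrm{Hom}^H_{\mathcal{O}_D}(N,\mathcal{O}_F)$ ($H$-equivariant $\mathcal{O}_D$-linear maps) and $$\mathbf{v}_{\mathsf{w}}(E)=\frac{1}{\sharp H}\,\mathrm{length}\,\frac{\mathrm{Hom}_{\mathcal{O}_D}(N,\mathcal{O}_F)}{\mathcal{O}_F\cdot\Xi_F}.$$ This does not depend on the choice of $F$. For the hyperplane $\mathsf{v}$, $N=\big(\bigoplus_i\mathcal{O}_Dx_i\big)/\mathcal{O}_D f$. Covers: a cover $C\to D$ is the normalization of $D$ in a finite étale (not necessarily Galois) $K(D)$-algebra; its discriminant exponent $d_{C/D}$ is defined by: the discriminant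 of $K(C)/K(D)$ is $\mathfrak{m}_D^{d_{C/D}}$; $[C:D]$ is its degree. The covers $C_j$: for $1\le j\le l$ let $H_j\subset H$ be the stabilizer of $x_j$; then $C_j=\mathrm{Spec}\,(\mathcal{O}_F)^{H_j}$, a connected cover of $D$ of degree $[C_j:D]=\sharp O_j$. *)

(* Defs.v *)
From HB Require Import structures.
From mathcomp Require Import all_boot all_order all_algebra all_fingroup all_field.
From mathcomp Require Import ring_quotient.
From mathcomp Require Import boolp classical_sets functions.
From mathcomp Require Import constructive_ereal.

Set Implicit Arguments.
Unset Strict Implicit.
Unset Printing Implicit Defensive.

Import Order.TTheory GRing.Theory Num.Theory.
Local Open Scope ring_scope.
Local Open Scope classical_set_scope.

(* Submodules over a subset A of a ring R that is closed under the ring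
   operations of R and has its own identity e; in every use below A contains
   -e and e acts as the identity on S, so closure under opposites is implied. *)
Definition is_submod (R : nzRingType) (A : set R) (V : lmodType R)
    (S : set V) : Prop :=
  [/\ S 0,
      forall u v, S u -> S v -> S (u + v)
    & forall a u, A a -> S u -> S (a *: u)].

Definition submod_gen (R : nzRingType) (A : set R) (V : lmodType R)
    (X : set V) : set V :=
  smallest (is_submod A (V := V)) X.

(* n is the length of a composition series of X / Y. *)
Definition has_comp_series (R : nzRingType) (A : set R) (V : lmodType R)
    (X Y : set V) (n : nat) : Prop :=
  exists S : nat -> set V,
    [/\ S 0%N = Y, S n = X,
        forall i, (i <= n)%N -> is_submod A (S i)
      & forall i, (i < n)%N ->
          S i `<` S i.+1 /\
          (forall T : set V, is_submod A T ->
             S i `<=` T -> T `<=` S i.+1 -> T = S i \/ T = S i.+1)].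

(* Equal to +oo when X / Y has no composition series; otherwise the value
   does not depend on the series, by the Jordan-Hoelder theorem. *)
Definition quot_length (R : nzRingType) (A : set R) (V : lmodType R)
    (X Y : set V) : \bar rat :=
  xget +oo%E [set (n%:R)%:E | n in has_comp_series A X Y].

Section DVR.
Variable A : idomainType.

Definition is_ideal (I : set A) : Prop := is_submod [set: A] (I : set A^o).

Definition ideal_gen (X : set A) : set A := smallest is_ideal X.

Fixpoint ideal_pow (I : set A) (n : nat) : set A :=
  if n is n'.+1 then ideal_gen [set x * y | x in I & y in ideal_pow I n']
  else [set: A].

Definition max_ideal : set A := [set a | a \isn't a GRing.unit].

(* A local principal ideal domain that is not a field. *)
Definition is_dvr : Prop :=
  [/\ is_ideal max_ideal,
      exists a, max_ideal a /\ a != 0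
    & forall I, is_ideal I -> exists a, I = [set c * a | c in [set: A]]].

Definition m_adic_complete : Prop :=
  forall u : nat -> A,
    (forall n, ideal_pow max_ideal n (u n.+1 - u n)) ->
    exists! x, forall n, ideal_pow max_ideal n (u n - x).

Definition is_residue_field (k : fieldType) (res : {rmorphism A -> k}) : Prop :=
  (forall y, exists a, res a = y) /\ (forall a, res a = 0 <-> max_ideal a).

(* The restriction to A of the normalized valuation of the fraction field;
   the value at 0 is +oo, as 0 belongs to all the powers of the ideal. *)
Definition valD (a : A) : \bar rat :=
  xget +oo%E [set (n%:R)%:E | n in
    [set n | ideal_pow max_ideal n a /\ ~ ideal_pow max_ideal n.+1 a]].

End DVR.

Section LineQuotient.
Variables (A : nzRingType) (V : lmodType A).

Definition line (f : V) : {pred V} := fun u => `[< exists a : A, u = a *: f >].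

Lemma lineP (f u : V) : reflect (exists a : A, u = a *: f) (u \in line f).
Proof. exact: asboolP. Qed.

Lemma line_zmod_closed (f : V) : zmod_closed (line f).
Proof.
split=> [|u v /lineP[a ->] /lineP[b ->]]; apply/lineP.
  by exists 0; rewrite scale0r.
by exists (a - b); rewrite scalerBl.
Qed.

End LineQuotient.

HB.instance Definition _ (A : nzRingType) (V : lmodType A) (f : V) :=
  GRing.isZmodClosed.Build V (line f) (line_zmod_closed f).

Section LineQuotientModule.
Variables (A : comNzRingType) (V : lmodType A) (f : V).

Definition quot_line := Quotient.quot (line f).

HB.instance Definition _ := GRing.Zmodule.on quot_line.

Definition quot_line_proj (u : V) : quot_line := \pi_(Quotient.quot (line f))%qT u.

Definition quot_line_scale (a : A) (q : quot_line) : quot_line :=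
  quot_line_proj (a *: (generic_quotient.repr (q : Quotient.quot (line f)))).

Lemma quot_line_projP (u v : V) :
  quot_line_proj u = quot_line_proj v <-> u - v \in line f.
Proof.
rewrite Quotient.idealrBE; split=> [h|/eqP //].
by apply/eqP.
Qed.

Lemma quot_line_projD (u v : V) :
  quot_line_proj (u + v) = quot_line_proj u + quot_line_proj v.
Proof. exact: pi_addr. Qed.

Lemma quot_line_reprK (q : quot_line) :
  quot_line_proj (generic_quotient.repr (q : Quotient.quot (line f))) = q.
Proof. exact: reprK. Qed.

Lemma quot_line_scaleE (a : A) (u : V) :
  quot_line_scale a (quot_line_proj u) = quot_line_proj (a *: u).
Proof.
apply/quot_line_projP.
have /quot_line_projP/lineP[b hb] := quot_line_reprK (quot_line_proj u).
by apply/lineP; exists (a * b); rewrite -scalerBr hb scalerA.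
Qed.

Lemma quot_line_scaleA a b (q : quot_line) :
  quot_line_scale a (quot_line_scale b q) = quot_line_scale (a * b) q.
Proof. by rewrite -[q]quot_line_reprK !quot_line_scaleE scalerA. Qed.

Lemma quot_line_scale1 : left_id 1 quot_line_scale.
Proof. by move=> q; rewrite -[q]quot_line_reprK quot_line_scaleE scale1r. Qed.

Lemma quot_line_scaleDr : right_distributive quot_line_scale +%R.
Proof.
move=> a p q; rewrite -[p]quot_line_reprK -[q]quot_line_reprK.
by rewrite -quot_line_projD !quot_line_scaleE scalerDr quot_line_projD.
Qed.

Lemma quot_line_scaleDl (q : quot_line) :
  {morph (fun a => quot_line_scale a q) : a b / a + b}.
Proof.
move=> a b; rewrite -[q]quot_line_reprK !quot_line_scaleE.
by rewrite scalerDl quot_line_projD.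
Qed.

HB.instance Definition _ := GRing.Zmodule_isLmodule.Build A quot_line
  quot_line_scaleA quot_line_scale1 quot_line_scaleDr quot_line_scaleDl.

End LineQuotientModule.

Section Covers.
Variable OD : idomainType.
Local Notation K := {fraction OD}.
Variable M : falgType K.

Definition intclosure : set M :=
  [set x | integralOver (fun a : OD => (tofrac a)%:A : M) x].

Section Discriminant.
(* W is a K-subspace of M closed under multiplication, with an identity of its
   own; trace_on W x is the trace of multiplication by x on W. *)
Variable W : {vspace M}.

Definition trace_on (x : M) : K :=
  \sum_(i < \dim W) coord (vbasis W) i (x * (vbasis W)`_i).

Definition family_disc (b : 'I_(\dim W) -> M) : K :=
  \det (\matrix_(i, j) trace_on (b i * b j)).

(* The ideal generated by the discriminants of all families of integral
   elements; these discriminants lie in OD, as OD is integrally closed. *)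
Definition disc_ideal : set OD :=
  ideal_gen [set a | exists2 b : 'I_(\dim W) -> M,
    (forall i, b i \in W /\ intclosure (b i)) & family_disc b = tofrac a].

Definition disc_exp : nat :=
  xget 0%N [set n | disc_ideal = ideal_pow (@max_ideal OD) n].

End Discriminant.

Section GCover.
Variable gT : finGroupType.
Variable act : {action gT &-> M}.

(* The map M (x)_K M -> \prod_(g : gT) M sending x (x) y to (x * y.g)_g, where
   M (x)_K M is the free left M-module on the 1 (x) b_i, for (b_i) a K-basis
   of M. *)
Definition torsor_map (c : {ffun 'I_(\dim {:M}) -> M}) : {ffun gT -> M} :=
  [ffun g => \sum_i c i * act (vbasis {:M})`_i g].

(* A G-cover E of Spec OD, presented by the coordinate ring M of the torsor
   E (x) K with the right action of G by pull-back; E itself is the spectrum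
   of intclosure. *)
Definition is_Gcover : Prop :=
  [/\ commutative (@GRing.mul M),
      forall g, linear (act^~ g),
      forall g, monoid_morphism (act^~ g)
    & bijective torsor_map].

(* The open and closed subscheme defined by an idempotent e (e is its
   indicator function) is connected and nonempty. Idempotents of M are
   integral, hence are functions on E. *)
Definition is_component (e : M) : Prop :=
  [/\ e * e = e, e != 0
    & forall e', e' * e' = e' -> e' * e = e' -> e' = 0 \/ e' = e].

Definition comp_stab (e : M) : {set gT} := [set g | act e g == e]%SET.

(* The coordinate ring of the component of e, realized as the factor
   e * intclosure, whose identity is e. *)
Definition OF (e : M) : set M := [set x | intclosure x /\ x * e = x].

(* The function field of Spec (OF e)^A. *)
Definition KC (e : M) (A : {set gT}) : {vspace M} :=
  (<[e]> * {:M} :&: \bigcap_(h in A) fixedSpace (linfun (act^~ h)))%VS.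

(* Here N stands for a free OD-module of finite rank with a right G-action. *)
Section V.
Variables (N : lmodType OD) (actN : N -> gT -> N) (e : M).

Definition HomOF : set (N -> M^o) :=
  [set phi | (forall a u v, phi (a *: u + v) = tofrac a *: (phi u : M) + phi v)
             /\ (forall u, OF e (phi u))].

Definition Xi : set (N -> M^o) :=
  [set phi | HomOF phi /\
     (forall h u, h \in comp_stab e -> phi (actN u h) = act (phi u) h)].

Definition vfun : \bar rat :=
  ((#|comp_stab e|%:R^-1)%:E
     * quot_length (OF e) HomOF (submod_gen (OF e) Xi))%E.

End V.
End GCover.
End Covers.

Section Hyperplane.
Variables (OD : idomainType) (gT : finGroupType) (d : nat).
Variable to : {action gT &-> 'I_d}.

(* A row vector u stands for the linear form \sum_i u_i x_i, and x_i for the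
   i-th basis vector. The action of G on V from the left becomes the right
   action x_i.g = x_(i.g) on linear forms. *)
Definition lform_act (u : 'rV[OD]_d) (g : gT) : 'rV[OD]_d :=
  \sum_i u 0 i *: delta_mx 0 (to i g).

(* The action induced on the quotient by the line of f, for G-invariant f. *)
Definition quot_line_act (f : 'rV[OD]_d) (q : quot_line f) (g : gT) :
    quot_line f :=
  quot_line_proj f
    (lform_act (generic_quotient.repr (q : Quotient.quot (line f))) g).

Lemma lform_act_linear (g : gT) : linear (lform_act^~ g).
Proof.
move=> a u v; rewrite /lform_act scaler_sumr -big_split /=.
by apply: eq_bigr => i _; rewrite !mxE scalerDl scalerA.
Qed.

Lemma quot_line_actE (f u : 'rV[OD]_d) (g : gT) : lform_act f g = f ->
  quot_line_act (quot_line_proj f u) g = quot_line_proj f (lform_act u g).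
Proof.
move=> fg; apply/quot_line_projP.
have /quot_line_projP/lineP[b hb] := quot_line_reprK (quot_line_proj f u).
have act0 : lform_act 0 g = 0.
  by rewrite /lform_act big1 // => i _; rewrite mxE scale0r.
apply/lineP; exists b; rewrite -[in RHS]fg.
have := lform_act_linear g b f 0; rewrite addr0 act0 addr0 => <-.
rewrite -hb; have := lform_act_linear g (-1) u
  (generic_quotient.repr (quot_line_proj f u : Quotient.quot (line f))).
by rewrite !scaleN1r [- u + _]addrC [- lform_act u g + _]addrC.
Qed.

End Hyperplane.

(* Main.v *)
Require Import Defs.
From HB Require Import structures.
From mathcomp Require Import all_boot all_order all_algebra all_fingroup all_field.
From mathcomp Require Import boolp classical_sets functions constructive_ereal.
From mathcomp Require Import ring zify.

(* After passing to the component F, its function field L is Galois over K with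
   group H. Since O_D is complete with algebraically closed residue field, every
   subextension C of L is totally ramified: O_C = O_D[p] for a uniformizer p, with
   basis 1, p, ..., p^(m-1). On O_C the trace form is x |-> lambda (y * x), where
   lambda (the coefficient of p^(m-1)) induces a unimodular form; hence d_{C/D} is
   the valuation of y and tr O_C = m_D^(d_{C/D} %/ m).

   The equivariant maps O_D^d -> O_F form the product of the O_{C_j}. Let B be the
   matrix of an O_D-basis in O_F^d. By the trace formula B *m B^T is block diagonal
   with blocks the trace forms of the C_j, so \det B has O_F-valuation
   #|H| * (sum_j d_j) / 2. A basis vector at which (y_i) |-> sum_i f_i y_i takes
   its least valuation a = min_j (v f_j + d_j %/ [C_j : D]) splits off, which
   divides the determinant by the #|H| * a-th power of the uniformizer of O_F. The
   remaining determinant is that of a basis of Xi in Hom(N, O_F), and its valuation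
   is the length of the quotient. *)

Set Implicit Arguments.
Unset Strict Implicit.
Unset Printing Implicit Defensive.
Import Order.TTheory GRing.Theory Num.Theory.
Local Open Scope ring_scope.

(** * Discrete valuation rings *)

Section Uniformizer.
Variable A : idomainType.

(** Half of the discriminants appears because [B *m B^T] is a matrix of traces, so each discriminant
    is, up to a unit, the square of a determinant of conjugates. The floor comes from the trace
    ideal: tr O_C lies in m_D^s exactly when y / pi^s is integral, and as pi has valuation m = [C:D]
    in C this means m * s <= d. As f is constant on each orbit, it sends O_{C_j} onto f_j tr
    O_{C_j}; the minimum is the exponent of the sum of these ideals. The division by #|H| undoes the
    passage from v_D to v_F. Two obstacles shape the proof. The coordinate ring of the torsor is in
    general a product of several fields, and its factor at e has e as identity; field arguments
    therefore run in an abstract field with a non-unital embedding in M. And that O_C is a discrete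
    valuation ring has to be established: residues of integral elements are found by lifting
    idempotents in O_D[x], which gives the valuation ring property and then a uniformizer. *)

Definition uniformizer (pi : A) : Prop :=
  pi != 0 /\ forall a, a \isn't a GRing.unit <-> exists c, a = c * pi.

Lemma dvr_uniformizer : is_dvr A -> exists pi, uniformizer pi.
Proof.
case=> idm [a [ma a0]] pid; have [pi piE] := pid _ idm.
have mP b : b \isn't a GRing.unit <-> exists c, b = c * pi.
  change (max_ideal b <-> exists c, b = c * pi); rewrite piE.
  by split=> [[c _ <-]|[c ->]]; exists c.
exists pi; split=> //; apply/negP=> /eqP p0.
by case/mP: ma => c; rewrite p0 mulr0 => /eqP; rewrite (negPf a0).
Qed.

Variable pi : A.
Hypothesis piU : uniformizer pi.

Lemma ideal_powE n : ideal_pow (@max_ideal A) n = [set c * pi ^+ n | c in setT]%classic.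
Proof.
elim: n => [|n IHn] /=.
  by apply/seteqP; split=> // x _; exists x => //; rewrite mulr1.
rewrite {}IHn; apply/seteqP; split=> [|_ [c _ <-]].
  apply: smallest_sub.
    split=> [|_ _ [c _ <-] [b _ <-]|c _ _ [b _ <-]].
    - by exists 0 => //; rewrite mul0r.
    - by exists (c + b) => //; rewrite mulrDl.
    - by exists (c * b) => //; rewrite /GRing.scale /= mulrA.
  move=> _ [a /piU.2 [c ->] [_ [b _ <-] <-]].
  by exists (c * b) => //; rewrite mulrACA exprS.
apply: sub_gen_smallest; exists (c * pi); first by apply/piU.2; exists c.
by exists (pi ^+ n); [exists 1 => //; rewrite mul1r | rewrite exprS mulrA].
Qed.

Lemma uniformizer_complete (u : nat -> A) : m_adic_complete A ->
  (forall n, exists c, u n.+1 - u n = c * pi ^+ n) ->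
  exists x, forall n, exists c, u n - x = c * pi ^+ n.
Proof.
move=> compl uP; case: (compl u) => [n|x [xP _]].
  by rewrite ideal_powE; have [c ->] := uP n; exists c.
by exists x => n; have := xP n; rewrite ideal_powE => -[c _ <-]; exists c.
Qed.

(** The constant sequence 0 converges to [a] as well as to 0, and limits are unique. *)
Lemma uniformizer_sep (a : A) : m_adic_complete A ->
  (forall n, exists c, a = c * pi ^+ n) -> a = 0.
Proof.
move=> compl aP; case: (compl (fun=> 0)) => [n|x [_ xP]].
  by rewrite ideal_powE subrr; exists 0 => //; rewrite mul0r.
rewrite -(xP a) => [|n]; last first.
  by rewrite ideal_powE sub0r; have [c ->] := aP n; exists (- c) => //; rewrite mulNr.
by rewrite -(xP 0) => // n; rewrite ideal_powE subrr; exists 0 => //; rewrite mul0r.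
Qed.

Lemma uniformizer_unitP a : a \isn't a GRing.unit <-> exists c, a = c * pi.
Proof. exact: piU.2. Qed.

Definition has_val (a : A) (n : nat) : Prop :=
  exists2 u, u \is a GRing.unit & a = u * pi ^+ n.

Lemma has_val_ex a : m_adic_complete A -> a != 0 -> exists n, has_val a n.
Proof.
move=> compl a0.
have [n nP] : exists n, ~ exists c, a = c * pi ^+ n.
  apply: contrapT => h; move/eqP: a0; apply; apply: uniformizer_sep => // n.
  by apply: contrapT => h'; apply: h; exists n.
elim: n nP => [|n IHn] nP; first by case: nP; exists a; rewrite mulr1.
have [[c cE]|/IHn //] := pselect (exists c, a = c * pi ^+ n).
exists n; exists c => //; apply/negPn/negP => /piU.2 [b bE]; apply: nP.
by exists b; rewrite exprS mulrA -bE.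
Qed.

Lemma uniformizer_neq0 : pi != 0. Proof. exact: piU.1. Qed.

Lemma uniformizer_nunit : pi \isn't a GRing.unit.
Proof. by apply/piU.2; exists 1; rewrite mul1r. Qed.

Lemma has_val_dvd a n m : has_val a n -> (exists c, a = c * pi ^+ m) -> (m <= n)%N.
Proof.
case=> u uu -> [c /eqP e]; rewrite leqNgt; apply/negP => nm.
move: e; rewrite -(subnKC nm) addSnnS exprD [pi ^+ n * _]mulrC mulrA.
rewrite (inj_eq (mulIf _)) ?expf_neq0 ?uniformizer_neq0 // => /eqP uE.
by move: uu; rewrite uE exprSr mulrA unitrM (negPf uniformizer_nunit) andbF.
Qed.

Lemma has_val_uniq a n m : has_val a n -> has_val a m -> n = m.
Proof.
move=> an am; apply/eqP; rewrite eqn_leq.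
rewrite (has_val_dvd am) ?(has_val_dvd an) //.
  by case: am => u _ ->; exists u.
by case: an => u _ ->; exists u.
Qed.

Lemma has_val_mul a b n m : has_val a n -> has_val b m -> has_val (a * b) (n + m).
Proof.
case=> u uu -> [v uv ->]; exists (u * v); rewrite ?unitrM ?uu //.
by rewrite mulrACA exprD.
Qed.

Lemma has_val_exp a n k : has_val a n -> has_val (a ^+ k) (n * k).
Proof.
move=> an; elim: k => [|k IHk]; first by rewrite muln0; exists 1; rewrite ?mulr1 ?unitr1.
by rewrite exprS mulnS; apply: has_val_mul.
Qed.

Lemma has_val_unit u : u \is a GRing.unit -> has_val u 0.
Proof. by exists u; rewrite ?mulr1. Qed.

Lemma has_val_neq0 a n : has_val a n -> a != 0.
Proof.
by case=> u uu ->; rewrite mulf_neq0 ?expf_neq0 ?uniformizer_neq0 //; apply: contraTneq uu => ->; rewrite unitr0.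
Qed.

Lemma valD0 : valD (0 : A) = +oo%E.
Proof.
rewrite /valD; apply: xgetPN => x [n [_ h] _]; apply: h.
by rewrite ideal_powE; exists 0 => //; rewrite mul0r.
Qed.

Lemma valDE a n : has_val a n -> valD a = (n%:R)%:E.
Proof.
move=> an; rewrite /valD; case: xgetP => [x _ [m [h1 h2] <-]|/(_ ((n%:R)%:E))h].
  move: h1 h2; rewrite !ideal_powE => -[c _ cE] h2.
  rewrite (_ : m = n) //; apply/eqP; rewrite eqn_leq.
  rewrite (has_val_dvd an) /=; last by exists c.
  rewrite leqNgt; apply/negP=> mn; apply: h2; have [u _ ->] := an.
  exists (u * pi ^+ (n - m.+1)) => //.
  by rewrite -mulrA -exprD subnK.
case: h; exists n => //; split; rewrite ideal_powE.
  by case: an => u _ ->; exists u.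
case=> c _ cE; suff: (n.+1 <= n)%N by rewrite ltnn.
by apply: has_val_dvd an _; exists c.
Qed.

End Uniformizer.

(** * Finite extensions as fields *)

Section Pack.
Variables (K : fieldType) (T : falgType K).
Hypothesis TC : commutative (@GRing.mul T).
Hypothesis TU : forall x : T, x != 0 -> exists y, x * y = 1.

Let T_field : forall x : T, x != 0 -> x \is a GRing.unit.
Proof. by move=> x /TU [y xy]; apply/unitrP; exists y; rewrite TC. Qed.

Let T_integral (x y : T) : x * y = 0 -> (x == 0) || (y == 0).
Proof.
move=> xy; case: eqP => //= /eqP /T_field xU.
by rewrite -(mulKr xU y) xy mulr0.
Qed.

Definition fieldExt_of : fieldExtType K :=
  let cC := GRing.PzRing_hasCommutativeMul.Build T TC in
  let cR : comUnitRingType := HB.pack T cC in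
  let iC := GRing.ComUnitRing_isIntegral.Build cR T_integral in
  let iR : idomainType := HB.pack cR iC in
  let fC := GRing.UnitRing_isField.Build iR T_field in
  HB.pack T cC iC fC.
End Pack.

(** In the applications [W] lies in the factor of [M] at a component, and its identity [e] differs
    from 1 unless [M] is connected. An abstract field [C] makes the theory of fields available, at
    the price of an embedding that sends 1 to [e]. *)
Lemma field_model (K : fieldType) (M : falgType K) (W : {vspace M}) (e : M) :
  commutative (@GRing.mul M) -> e \in W -> e != 0 ->
  (forall x, x \in W -> x * e = x) ->
  (forall x y, x \in W -> y \in W -> x * y \in W) ->
  (forall x, x \in W -> x != 0 -> exists2 y, y \in W & x * y = e) ->
  exists (C : fieldExtType K) (i : {linear C -> M}),
    [/\ injective i, i 1 = e, {morph i : x y / x * y} &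
        forall x, x \in W <-> exists c, x = i c].
Proof.
move=> MC eW e0 We WM WV.
have aspW : is_aspace W.
  apply/andP; split; last by apply/prodvP => x y xW yW; apply: WM.
  by apply/has_algidP; exists e; split=> // u uW; rewrite ?We // MC We.
pose A : {aspace M} := ASpace aspW.
have aE : algid A = e.
  by rewrite -(We _ (memv_algid A)) -[RHS](algidl (A := A) eW).
have TC : commutative (@GRing.mul (subvs_of A)).
  by move=> x y; apply: val_inj; apply: MC.
have TU (x : subvs_of A) : x != 0 -> exists y, x * y = 1.
  move=> x0; have [|y yW xy] := WV (val x) (valP x).
    by apply: contra_neq x0 => h; apply: val_inj.
  by exists (Subvs (yW : y \in A)); apply: val_inj; rewrite /= xy aE.
exists (fieldExt_of TC TU).
exists (@vsval _ _ A : {linear subvs_of A -> M}).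
split; [exact: (@val_inj _ _ (subvs_of A)) | exact: aE | move=> x y; exact: erefl |].
move=> x; split=> [xW|[c ->]]; first by exists (Subvs (xW : x \in A)).
exact: (subvsP c).
Qed.

(** * Integral closures over a complete discrete valuation ring *)

Section Ext.
Variables (OD : idomainType) (pi : OD).
Hypothesis piU : uniformizer pi.
Hypothesis compl : m_adic_complete OD.

(** The series converges in each coefficient; the common bound [N] on the sizes makes the limit a
    polynomial. *)
Lemma poly_series_complete N (g : nat -> {poly OD}) :
  (forall t, (size (g t) <= N)%N) ->
  exists2 h : {poly OD}, (size h <= N)%N &
    forall s, exists r : {poly OD}, h - \sum_(t < s) pi ^+ t *: g t = pi ^+ s *: r.
Proof.
move=> gN.
have /choice[x xP] : forall j, exists x, forall s, exists c,
    \sum_(t < s) pi ^+ t * (g t)`_j - x = c * pi ^+ s.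
  move=> j; apply: (uniformizer_complete (u := fun s => \sum_(t < s) pi ^+ t * (g t)`_j) piU) => // n.
  by exists (g n)`_j; rewrite big_ord_recr /= addrAC subrr add0r mulrC.
exists (\poly_(j < N) x j) => [|s]; first exact: size_poly.
have /choice[c cP] : forall j, exists c, \sum_(t < s) pi ^+ t * (g t)`_j - x j = c * pi ^+ s.
  by move=> j; apply: xP.
exists (\poly_(j < N) - c j); apply/polyP => j.
rewrite coefB coef_sum coefZ !coef_poly.
under eq_bigr do rewrite coefZ.
case: ltnP => jN; first by rewrite mulrN mulrC -cP opprB.
rewrite mulr0 big1 ?subrr // => t _.
by rewrite nth_default ?mulr0 // (leq_trans (gN t)).
Qed.

Variable C : fieldExtType {fraction OD}.

Definition inc (a : OD) : C := GRing.in_alg C (tofrac a).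

HB.instance Definition _ := GRing.RMorphism.copy inc (GRing.in_alg C \o @tofrac OD).

Arguments inc : simpl never.

Lemma inc_injective : injective inc.
Proof.
by move=> a b /= /(fmorph_inj (GRing.in_alg C)) /eqP; rewrite tofrac_eq => /eqP.
Qed.

Lemma inc_eq0 a : (inc a == 0) = (a == 0).
Proof. by rewrite -(inj_eq inc_injective) rmorph0. Qed.

Definition Oint (x : C) : Prop := integralOver inc x.

Lemma Oint_inc a : Oint (inc a). Proof. exact: integral_id. Qed.
Lemma Oint0 : Oint 0. Proof. exact: integral0. Qed.
Lemma Oint1 : Oint 1. Proof. exact: integral1. Qed.
Lemma OintD x y : Oint x -> Oint y -> Oint (x + y). Proof. exact: integral_add. Qed.
Lemma OintB x y : Oint x -> Oint y -> Oint (x - y). Proof. exact: integral_sub. Qed.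
Lemma OintN x : Oint x -> Oint (- x). Proof. exact: integral_opp. Qed.
Lemma OintM x y : Oint x -> Oint y -> Oint (x * y). Proof. exact: integral_mul. Qed.
Lemma OintX x n : Oint x -> Oint (x ^+ n).
Proof. by move=> Ox; elim: n => [|n IH]; rewrite ?exprS; [exact: Oint1 | exact: OintM]. Qed.
Lemma Oint_sum (I : Type) (r : seq I) (P : pred I) F :
  (forall i, P i -> Oint (F i)) -> Oint (\sum_(i <- r | P i) F i).
Proof. by move=> h; apply: big_ind => //; [exact: Oint0 | exact: OintD]. Qed.
Lemma Oint_prod (I : Type) (r : seq I) (P : pred I) F :
  (forall i, P i -> Oint (F i)) -> Oint (\prod_(i <- r | P i) F i).
Proof. by move=> h; apply: big_ind => //; [exact: Oint1 | exact: OintM]. Qed.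

Lemma Oint_ev x (p : {poly OD}) : Oint x -> Oint (map_poly inc p).[x].
Proof.
move=> Ox; rewrite horner_poly; apply: Oint_sum => i _.
by apply: OintM; [exact: Oint_inc | exact: OintX].
Qed.

Local Notation ipi := (inc pi).

Lemma ipi_neq0 : ipi != 0.
Proof. by rewrite inc_eq0 (uniformizer_neq0 piU). Qed.

(** A monic equation of degree n for 1/pi, multiplied by pi^n, would exhibit 1 as a multiple of [pi]
    in O_D. *)
Lemma Oint_ipiV : ~ Oint ipi^-1.
Proof.
have p0 := ipi_neq0.
case=> p /monicP p1 /rootP; rewrite map_polyE.
rewrite -map_polyE horner_poly => e.
have sp : (size p > 0)%N by rewrite size_poly_gt0 -lead_coef_eq0 p1 oner_eq0.
have [n sE] : exists n, size p = n.+1 by exists (size p).-1; rewrite prednK.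
have pn : p`_n = 1 by rewrite -p1 lead_coefE sE.
move: e; rewrite sE big_ord_recr /= pn rmorph1 mul1r.
move=> /(congr1 (fun y => y * ipi ^+ n)).
rewrite mul0r mulrDl -exprMn mulVf // expr1n mulr_suml => e.
pose b := \sum_(i < n) p`_i * pi ^+ (n - i.+1).
have : b * pi + 1 = 0.
  apply: inc_injective; rewrite rmorph0 -[RHS]e rmorphD rmorph1; congr (_ + _).
  rewrite mulr_suml rmorph_sum; apply: eq_bigr => i _.
  rewrite -[RHS]mulrA (mulrC (_ ^+ i)) exprVn -expfB //.
  by rewrite -(subnSK (ltn_ord i)) !rmorphM rmorphXn exprSr mulrA.
move/eqP; rewrite addr_eq0 => /eqP/(congr1 (fun y => y * -1)).
rewrite mulrNN mulr1 => e'.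
have := uniformizer_nunit piU; have : (b * pi * -1) \is a GRing.unit by rewrite e' unitr1.
by rewrite !unitrM => /andP[/andP[_ ->]].
Qed.

(** Cancelling powers of [y] leads to a relation with nonzero constant term, which is then [y] times
    an integral element. *)
Lemma ann_const (p : {poly OD}) y : Oint y -> y != 0 -> p != 0 ->
  (map_poly inc p).[y] = 0 -> exists2 a, a != 0 & Oint (inc a / y).
Proof.
move=> Oy y0; elim/poly_ind: p => [|p c IHp]; first by rewrite eqxx.
have [->|c0 _] := eqVneq c 0.
  rewrite addr0 => pX0; rewrite rmorphM /= map_polyX hornerMX => /eqP.
  rewrite mulf_eq0 (negPf y0) orbF => /eqP; apply: IHp.
  by apply: contra_neq pX0 => ->; rewrite mul0r.
rewrite rmorphD rmorphM /= map_polyX map_polyC hornerD hornerMX hornerC.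
move=> /eqP; rewrite addrC addr_eq0 => /eqP e; exists c => //.
rewrite e -mulNr mulfK //; apply/OintN/Oint_ev/Oy.
Qed.

Lemma Oint_bound y : Oint y -> y != 0 -> exists n, Oint (ipi ^+ n / y).
Proof.
move=> Oy y0; have [p p1 /rootP py] := Oy.
have [a /(has_val_ex piU compl)[n [u uu ->]] Oa] := ann_const Oy y0 (monic_neq0 p1) py.
exists n; rewrite (_ : _ / y = inc u^-1 * (inc (u * pi ^+ n) / y)).
  by apply: OintM => //; apply: Oint_inc.
by rewrite rmorphM /= !mulrA -rmorphM mulVr // rmorph1 mul1r rmorphXn.
Qed.

(** If pi^n / y is integral and pi^(n+1) divides [y], then 1/pi is integral. Thanks to this
    separatedness, identities between limits can be checked modulo every power of [pi]. *)
Lemma Oint_sep y : Oint y -> (forall s, exists2 z, Oint z & y = ipi ^+ s * z) -> y = 0.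
Proof.
move=> Oy h; apply/eqP/negPn/negP => y0.
have [n On] := Oint_bound Oy y0; have [z Oz zE] := h n.+1.
apply: Oint_ipiV; rewrite (_ : _^-1 = ipi ^+ n / y * z); first exact: OintM.
have z0 : z != 0 by apply: contra_neq y0 => z0; rewrite zE z0 mulr0.
by rewrite zE exprS; field; rewrite ?z0 ?expf_neq0 ?ipi_neq0.
Qed.

End Ext.

(** * The ring O_D[x]: completeness, idempotents, units *)

Section Adjoin.
Variables (OD : idomainType) (pi : OD).
Hypothesis piU : uniformizer pi.
Hypothesis compl : m_adic_complete OD.
Variable C : fieldExtType {fraction OD}.
Local Notation inc := (@inc OD C).
Local Notation ipi := (inc pi).

Definition adj_ev (x : C) (p : {poly OD}) : C := horner_eval x (map_poly inc p).

HB.instance Definition _ x :=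
  GRing.RMorphism.copy (adj_ev x) (horner_eval x \o map_poly inc).

Arguments adj_ev : simpl never.

Lemma adj_evE x p : adj_ev x p = (map_poly inc p).[x]. Proof. by []. Qed.

Lemma adj_evX x : adj_ev x 'X = x.
Proof. by rewrite adj_evE map_polyX hornerX. Qed.

Lemma adj_evC x c : adj_ev x c%:P = inc c.
Proof. by rewrite adj_evE map_polyC hornerC. Qed.

Lemma adj_evZ x a p : adj_ev x (a *: p) = inc a * adj_ev x p.
Proof. by rewrite -mul_polyC rmorphM /= adj_evC. Qed.

Lemma Oint_adj_ev x p : Oint x -> Oint (adj_ev x p).
Proof. exact: Oint_ev. Qed.

Variable x : C.
Hypothesis Ox : Oint x.
Local Notation ev := (adj_ev x).

Lemma ipiX s : ipi ^+ s = inc (pi ^+ s).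
Proof. by rewrite rmorphXn. Qed.

(** O_D[x] is complete because it is finite over O_D: reducing each term modulo a monic equation of
    [x] keeps its value and bounds its size. *)
Lemma adjoin_complete (g : nat -> {poly OD}) :
  exists h, forall s, exists r, ev h - \sum_(t < s) ipi ^+ t * ev (g t) = ipi ^+ s * ev r.
Proof.
have [P P1 /rootP Px] := Ox.
have gE t : ev (Pdiv.CommonRing.rmodp (g t) P) = ev (g t).
  rewrite [in RHS](Pdiv.RingMonic.rdivp_eq P1 (g t)) rmorphD rmorphM /= [ev P]Px.
  by rewrite mulr0 add0r.
have [t|h _ hP] := @poly_series_complete _ pi piU compl (size P)
    (fun t => Pdiv.CommonRing.rmodp (g t) P).
  by rewrite ltnW // Pdiv.CommonRing.ltn_rmodpN0 // monic_neq0.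
exists h => s; have [r rE] := hP s; exists r.
rewrite ipiX -adj_evZ -rE rmorphB rmorph_sum; congr (_ - _).
by apply: eq_bigr => t _; rewrite /= adj_evZ gE rmorphXn.
Qed.

(* Newton's iteration e |-> 3 e^2 - 2 e^3 for idempotents, together with a
   cofactor r such that e^2 - e = pi^(t+1) r. *)
Fixpoint newton (e r : {poly OD}) (t : nat) : {poly OD} * {poly OD} :=
  if t is t'.+1 then
    let: (e, r) := newton e r t' in
    (e ^+ 2 * 3%:R - e ^+ 3 * 2%:R,
     pi ^+ t' *: (r ^+ 2 * (e ^+ 2 * 4%:R - e * 4%:R - 3%:R)))
  else (e, r).

(** Newton's iterates converge to an idempotent of the field [C], which can only be 0 or 1, and the
    limit is congruent to [ev e] modulo [pi]. *)
Lemma idem_lift e r : ev (e ^+ 2 - e) = ipi * ev r ->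
  (exists r', ev e = ipi * ev r') \/ (exists r', 1 - ev e = ipi * ev r').
Proof.
move=> er; pose E t := (newton e r t).1; pose R t := (newton e r t).2.
have ES t : E t.+1 = E t ^+ 2 * 3%:R - E t ^+ 3 * 2%:R.
  by rewrite /E /=; case: (newton e r t).
have RS t : R t.+1 = pi ^+ t *: (R t ^+ 2 * (E t ^+ 2 * 4%:R - E t * 4%:R - 3%:R)).
  by rewrite /R /E /=; case: (newton e r t).
have ER t : ev (E t ^+ 2 - E t) = ipi ^+ t.+1 * ev (R t).
  elim: t => [|t IH]; first by rewrite expr1.
  (* The error is squared: of its factor pi^(2t+2), pi^(t+2) is kept and pi^t goes into the next
     cofactor. *)
  have -> : E t.+1 ^+ 2 - E t.+1 =
    (E t ^+ 2 - E t) ^+ 2 * (E t ^+ 2 * 4%:R - E t * 4%:R - 3%:R) by rewrite ES; ring.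
  rewrite rmorphM rmorphXn /= IH RS adj_evZ rmorphXn /= rmorphM rmorphXn /=.
  by rewrite !exprS; ring.
(* The increment of the iteration is -(E^2 - E)(2E - 1), that is, pi^t times the value of [g t]. *)
pose g t := - pi *: (R t * (E t * 2%:R - 1)).
have [h hP] := adjoin_complete g.
have Eg t : ev (E t) = ev e + \sum_(s < t) ipi ^+ s * ev (g s).
  elim: t => [|t IH]; first by rewrite big_ord0 addr0.
  rewrite big_ord_recr /= addrA -IH.
  have -> : E t.+1 = E t - (E t ^+ 2 - E t) * (E t * 2%:R - 1) by rewrite ES; ring.
  rewrite rmorphB rmorphM /= ER /g adj_evZ rmorphN rmorphM /= exprS; ring.
pose u := ev e + ev h.
have uE : u ^+ 2 - u = 0.
  have Ou : Oint u by apply: OintD; apply: Oint_adj_ev.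
  apply: (Oint_sep piU compl) => [|s]; first by apply: OintB => //; apply: OintX.
  have [q qE] := hP s.
  have -> : u = ev (E s) + ipi ^+ s * ev q by rewrite Eg -qE /u; ring.
  exists (ev (pi *: R s + q * (E s * 2%:R + pi ^+ s *: q - 1))); first exact: Oint_adj_ev.
  rewrite rmorphD /= adj_evZ rmorphM /= rmorphB rmorphD /= adj_evZ rmorphM rmorph1 rmorph_nat /= -ipiX.
  have := ER s; rewrite rmorphB rmorphXn /= => /eqP; rewrite subr_eq => /eqP e2.
  transitivity (ev (E s) ^+ 2 - ev (E s) + ipi ^+ s * ev q * (ev (E s) * 2%:R + ipi ^+ s * ev q - 1)).
    ring.
  by rewrite e2 exprSr; ring.
have [q qE] : exists q, ev h = ipi * ev q.
  have [q] := hP 1; rewrite big_ord_recr big_ord0 /= add0r mul1r => /eqP.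
  rewrite subr_eq => /eqP ->; rewrite /g adj_evZ expr1.
  by exists (q - R 0 * (E 0 * 2%:R - 1)); rewrite rmorphB rmorphN /=; ring.
have : u * (u - 1) = 0 by rewrite -uE; ring.
move/eqP; rewrite mulf_eq0 => /orP[]/eqP e0.
  by left; exists (- q); rewrite rmorphN mulrN -qE; apply/eqP; rewrite -addr_eq0 -/u e0.
right; exists q; rewrite -qE; apply/eqP; rewrite subr_eq addrC -/u -subr_eq0 -opprB e0.
by rewrite oppr0.
Qed.

(** The inverse is the geometric series in -pi x, summed in O_D[x]. *)
Lemma one_add_unit : 1 + ipi * x != 0 /\ Oint (1 + ipi * x)^-1.
Proof.
have [h hP] := adjoin_complete (fun t => (- 'X) ^+ t).
suff e : (1 + ipi * x) * ev h = 1.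
  have n0 : 1 + ipi * x != 0.
    by apply: contra_eq_neq e => ->; rewrite mul0r eq_sym oner_eq0.
  split=> //; rewrite (_ : _^-1 = ev h); first exact: Oint_adj_ev.
  by apply: (mulfI n0); rewrite e mulfV.
have Ov : Oint (1 + ipi * x).
  by apply: OintD; [exact: Oint1 | apply: OintM => //; exact: Oint_inc].
apply/eqP; rewrite -subr_eq0; apply/eqP.
apply: (Oint_sep piU compl) => [|s].
  by apply: OintB; [apply: OintM => //; exact: Oint_adj_ev | exact: Oint1].
have [q /eqP] := hP s; rewrite subr_eq => /eqP ->.
have -> : \sum_(t < s) ipi ^+ t * ev ((- 'X) ^+ t) = \sum_(t < s) (- (ipi * x)) ^+ t.
  by apply: eq_bigr => t _; rewrite rmorphXn rmorphN /= adj_evX -exprMn mulrN.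
have gs : (1 + ipi * x) * \sum_(t < s) (- (ipi * x)) ^+ t = 1 - (- (ipi * x)) ^+ s.
  by rewrite -[RHS]opprB subrX1 -[RHS]mulNr; congr (_ * _); rewrite opprB opprK.
exists ((1 + ipi * x) * ev q - (- x) ^+ s).
  apply: OintB; first by apply: OintM => //; exact: Oint_adj_ev.
  exact/OintX/OintN.
by rewrite mulrDr gs -mulrN exprMn; ring.
Qed.

End Adjoin.

Lemma frac_rep (A : idomainType) (x : {fraction A}) :
  exists n d, d != 0 /\ x = tofrac n / tofrac d.
Proof.
elim/generic_quotient.quotW: x => r.
exists (\n_r)%R, (\d_r)%R; split; first exact: denom_ratioP.
have d0 : tofrac (\d_r) != 0 :> {fraction A} by rewrite tofrac_eq0 denom_ratioP.
apply: (canRL (mulfK d0)).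
rewrite !generic_quotient.piE; apply/generic_quotient.eqmodP.
rewrite /= FracField.equivfE /FracField.mulf !numden_Ratio ?oner_eq0 ?mulr1 ?denom_ratioP //.
by rewrite mulrC.
Qed.

(** * Residues of integral elements and the valuation ring property *)

Section Local.
Variables (OD : idomainType) (pi : OD).
Hypothesis piU : uniformizer pi.
Hypothesis compl : m_adic_complete OD.
Variables (k : fieldType) (res : {rmorphism OD -> k}).
Hypothesis k_residue : is_residue_field res.
Hypothesis k_closed : GRing.closed_field_axiom k.

Lemma lift_poly (q : {poly k}) : exists2 q0 : {poly OD}, map_poly res q0 = q &
  q \is monic -> q0 \is monic /\ size q0 = size q.
Proof.
(* Lifting 1 to 1 keeps monic polynomials monic and of the same size. *)
have /choice[l lP] : forall y, exists a, res a = y /\ (y = 1 -> a = 1).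
  move=> y; have [->|/eqP y1] := eqVneq y 1; first by exists 1; rewrite rmorph1.
  by have [a aE] := k_residue.1 y; exists a; split=> // /y1.
exists (\poly_(i < size q) l q`_i) => [|q1].
  apply/polyP => i; rewrite coef_map coef_poly /=.
  by case: ltnP => iq; [case: (lP q`_i) | rewrite ?rmorph0 ?raddf0 nth_default].
have lq : l q`_(size q).-1 = 1 by apply: (lP _).2; rewrite -lead_coefE; apply/monicP.
have sq : (size q > 0)%N by rewrite size_poly_gt0 monic_neq0.
have sE : size (\poly_(i < size q) l q`_i) = size q.
  by apply: size_poly_eq; rewrite lq oner_eq0.
split=> //; apply/monicP; rewrite lead_coefE sE coef_poly lq.
by rewrite prednK // leqnn.
Qed.

Lemma res_ker (p : {poly OD}) : map_poly res p = 0 -> exists p', p = pi *: p'.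
Proof.
move=> p0.
have /choice[c cP] : forall i, exists c, p`_i = c * pi.
  move=> i; apply/(uniformizer_unitP piU)/k_residue.2.
  by rewrite -coef_map p0 coef0.
exists (\poly_(i < size p) c i); apply/polyP => i; rewrite coefZ coef_poly.
by case: ltnP => h; [rewrite cP mulrC | rewrite nth_default ?mulr0].
Qed.

Lemma monic_has_root (q : {poly k}) : q \is monic -> (1 < size q)%N ->
  exists u, root q u.
Proof.
move=> q1 sq; have [n sE] : exists n, size q = n.+2.
  by exists (size q).-2; case: (size q) sq => [|[]].
have [u uE] := k_closed (fun i => - q`_i) (ltn0Sn n).
exists u; rewrite rootE horner_coef sE big_ord_recr /=.
have -> : q`_n.+1 = 1 by rewrite -(monicP q1) lead_coefE sE.
rewrite mul1r uE -big_split /= big1 // => i _.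
by rewrite mulNr subrr.
Qed.

Variable C : fieldExtType {fraction OD}.
Local Notation inc := (@inc OD C).
Local Notation ipi := (inc pi).

(** The cofactor is taken in O_D[x] rather than in O_C, since idempotents are lifted in O_D[x]. *)
Definition pi_dvd x y := exists r : {poly OD}, y = ipi * adj_ev x r.

Section Residue.
Variable x : C.
Hypothesis Ox : Oint x.
Local Notation ev := (adj_ev x).

Lemma pi_dvd0 : pi_dvd x 0.
Proof. by exists 0; rewrite rmorph0 mulr0. Qed.

Lemma pi_dvdD y z : pi_dvd x y -> pi_dvd x z -> pi_dvd x (y + z).
Proof. by case=> r -> [s ->]; exists (r + s); rewrite rmorphD /= mulrDr. Qed.

Lemma pi_dvdMr y p : pi_dvd x y -> pi_dvd x (y * ev p).
Proof. by case=> r ->; exists (r * p); rewrite rmorphM /= mulrA. Qed.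

Lemma pi_dvd_res (p q : {poly OD}) : map_poly res p = map_poly res q ->
  pi_dvd x (ev p - ev q).
Proof.
move=> pq; have [|r rE] := @res_ker (p - q); first by rewrite rmorphB /= pq subrr.
by exists r; rewrite -rmorphB rE /= adj_evZ.
Qed.

(* Splitting off a root of the reduction of Q yields by Bezout an approximate
   idempotent in O_D[x]; it lifts, and the field C has only trivial idempotents. *)
Lemma residue_poly n (Q : {poly OD}) : Q \is monic -> size Q = n.+1 ->
  pi_dvd x (ev Q) -> exists a s, pi_dvd x ((x - inc a) ^+ s).
Proof.
elim/ltn_ind: n Q => n IHn Q Q1 sQ Qx.
have Qb1 : map_poly res Q \is monic by exact: monic_map.
have sQb : size (map_poly res Q) = n.+1 by rewrite size_map_poly_id0 ?(monicP Q1) ?rmorph1 ?oner_eq0.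
case: n => [|n] in IHn sQ sQb *.
  exists 0, 0%N; rewrite expr0 -[1](rmorph1 ev) -(_ : Q = 1) //.
  have Q0 : Q`_0 = 1 by rewrite -(monicP Q1) lead_coefE sQ.
  by rewrite [LHS]size1_polyC ?sQ // Q0.
have [|u uQ] := monic_has_root Qb1; first by rewrite sQb.
have [s [q]] := multiplicity_XsubC (map_poly res Q) u.
rewrite monic_neq0 //= => qu Qq.
have s0 : (0 < s)%N.
  by case: s Qq => // Qq; move: uQ; rewrite Qq expr0 mulr1 (negPf qu).
have q1 : q \is monic.
  by rewrite -(monicMr q (rpredX s (monicXsubC u))) -Qq.
have sq : (size q < n.+2)%N.
  rewrite -sQb Qq size_Mmonic ?monic_neq0 ?rpredX ?monicXsubC //.
  rewrite size_exp_XsubC addnS /= -[X in (X < _)%N]addn0 ltn_add2l //.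
have [[a b] /= ab] : exists w, w.1 * ('X - u%:P) ^+ s + w.2 * q = 1.
  apply/Bezout_eq1_coprimepP; apply: coprimep_expl.
  by rewrite coprimep_sym coprimep_XsubC.
have [a0 a0E _] := lift_poly a; have [b0 b0E _] := lift_poly b.
have [q0 q0E /(_ q1)[q01 sq0]] := lift_poly q.
have [u0 u0E] := k_residue.1 u.
have XuE : map_poly res ('X - u0%:P) = 'X - u%:P.
  by rewrite rmorphB /= map_polyX map_polyC /= u0E.
have evXu : ev ('X - u0%:P) = x - inc u0 by rewrite rmorphB /= adj_evX adj_evC.
have e1 : pi_dvd x (ev (a0 * ('X - u0%:P) ^+ s + b0 * q0) - ev 1).
  apply: pi_dvd_res; rewrite rmorphD !rmorphM rmorph1 rmorphXn /=.
  by rewrite XuE a0E b0E q0E ab.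
have e2 : pi_dvd x (ev (q0 * ('X - u0%:P) ^+ s)).
  rewrite -[ev _](subrK (ev Q)); apply: pi_dvdD => //; apply: pi_dvd_res.
  by rewrite rmorphM rmorphXn /= XuE q0E -Qq.
(* With A = a0 (X - u0)^s and E = b0 q0, E^2 - E = (A + E - 1) E - A E. Modulo [pi], A + E is 1 and
   A E is a multiple of Q, which vanishes at [x]. *)
have e3 : pi_dvd x (ev ((b0 * q0) ^+ 2 - b0 * q0)).
  have -> : ev ((b0 * q0) ^+ 2 - b0 * q0) =
     (ev (a0 * ('X - u0%:P) ^+ s + b0 * q0) - ev 1) * ev (b0 * q0)
     + ev (q0 * ('X - u0%:P) ^+ s) * ev (- (a0 * b0)).
    rewrite -rmorphB -!rmorphM -rmorphD; congr ev; ring.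
  by apply: pi_dvdD; apply: pi_dvdMr.
have [r rE] := e3.
(* If E is 0 modulo [pi], then so is q0 = A q0 + E q0, and q0 has smaller degree than Q. If E is 1,
   then (x - u0)^s is 0 modulo [pi], because E (X - u0)^s is a multiple of q0 (X - u0)^s. *)
have [h|h] := idem_lift piU compl Ox rE.
  have eq0 : pi_dvd x (ev q0).
    have -> : ev q0 = ev (q0 * ('X - u0%:P) ^+ s) * ev a0
       + (ev (b0 * q0) * ev q0 + (ev (a0 * ('X - u0%:P) ^+ s + b0 * q0) - ev 1) * ev (- q0)).
      rewrite -rmorphB -!rmorphM -!rmorphD; congr ev; ring.
    by apply: pi_dvdD; [|apply: pi_dvdD]; apply: pi_dvdMr.
  apply: (IHn (size q0).-1 _ q0) => //.
    rewrite sq0; move: sq; case: (size q) => //=.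
  by rewrite prednK // size_poly_gt0 monic_neq0.
exists u0, s; rewrite -evXu -rmorphXn /=.
have -> : ev (('X - u0%:P) ^+ s) = (1 - ev (b0 * q0)) * ev (('X - u0%:P) ^+ s)
    + ev (q0 * ('X - u0%:P) ^+ s) * ev b0.
  rewrite -(rmorph1 ev) -rmorphB -!rmorphM -rmorphD; congr ev; ring.
by apply: pi_dvdD; apply: pi_dvdMr.
Qed.

End Residue.

(** For integral [x], membership in the maximal ideal of O_C, in a form that needs no
    uniformizer. *)
Definition pi_nilp (x : C) := exists s z, Oint z /\ x ^+ s = ipi * z.
Definition ounit (x : C) := [/\ x != 0, Oint x & Oint x^-1].

(** Adjoining [x] does not extend the residue field; total ramification ultimately rests on this. *)
Lemma residue_pi_nilp x : Oint x -> exists a, pi_nilp (x - inc a).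
Proof.
move=> Ox; have [P P1 /rootP Px] := Ox.
have sP : size P = (size P).-1.+1 by rewrite prednK // size_poly_gt0 monic_neq0.
have [|a [s [r rE]]] := residue_poly Ox P1 sP.
  by rewrite /pi_dvd [adj_ev x P]Px; exact: pi_dvd0.
by exists a, s, (adj_ev x r); split=> //; exact: Oint_adj_ev.
Qed.

Lemma ounitM x y : ounit x -> ounit y -> ounit (x * y).
Proof.
move=> [x0 Ox Oxi] [y0 Oy Oyi]; split; first by rewrite mulf_neq0.
  exact: OintM.
by rewrite invfM; apply: OintM.
Qed.

Lemma ounitX x n : ounit x -> ounit (x ^+ n).
Proof.
move=> xU; elim: n => [|n IH]; last by rewrite exprS; apply: ounitM.
by rewrite expr0; split; rewrite ?invr1 ?oner_eq0 //; exact: Oint1.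
Qed.

Lemma ounit_inc a : a \is a GRing.unit -> ounit (inc a).
Proof.
move=> aU.
have a0 : inc a != 0 by rewrite inc_eq0; apply: contraTneq aU => ->; rewrite unitr0.
split=> //; first exact: Oint_inc.
have -> : (inc a)^-1 = inc a^-1; last exact: Oint_inc.
by apply: (mulfI a0); rewrite mulfV // -rmorphM mulrV // rmorph1.
Qed.

Lemma ounit_dvd x y : ounit (x * y) -> Oint x -> Oint y -> ounit x.
Proof.
case; rewrite mulf_eq0 negb_or => /andP[x0 y0] _ h Ox Oy; split=> //.
have -> : x^-1 = y * (x * y)^-1 by rewrite invfM mulrCA mulfV // mulr1.
exact: OintM.
Qed.

(** [u + v] divides u^s - (-v)^s, which is u^s times some 1 + pi w with w integral, hence a unit. *)
Lemma ounit_pi_nilp_add u v : ounit u -> Oint v -> pi_nilp v -> ounit (u + v).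
Proof.
move=> uU Ov [s [z [Oz vz]]]; have [u0 Ou Oui] := uU.
pose Y := \sum_(i < s) u ^+ (s.-1 - i) * (- v) ^+ i.
have YE : (u + v) * Y = u ^+ s * (1 + ipi * (- (u^-1 ^+ s * ((-1) ^+ s * z)))).
  rewrite -{1}[v]opprK -subrXX (exprNn v) vz mulrDr mulr1; congr (_ + _).
  rewrite mulrN mulrN [u ^+ s * _]mulrCA [u ^+ s * (_ * _)]mulrA exprVn mulfV ?expf_neq0 // mul1r.
  by rewrite mulrCA.
have OY : Oint Y.
  by apply: Oint_sum => i _; apply: OintM; apply: OintX => //; apply: OintN.
have Ow : Oint (- (u^-1 ^+ s * ((-1) ^+ s * z))).
  by apply/OintN/OintM; [exact: OintX | apply: OintM => //; apply/OintX/OintN/Oint1].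
apply: (@ounit_dvd _ Y) => //; last exact: OintD.
rewrite YE; apply: ounitM; first exact: ounitX.
have [w0 wO] := one_add_unit piU compl Ow; split=> //.
by apply: OintD; [exact: Oint1 | apply: OintM => //; exact: Oint_inc].
Qed.

(** O_C is local: [x] is a constant of O_D plus an element with a power divisible by [pi], and the
    constant decides which case holds. *)
Lemma ounit_or_pi_nilp x : Oint x -> ounit x \/ pi_nilp x.
Proof.
move=> Ox; have [a xa] := residue_pi_nilp Ox.
have Oxa : Oint (x - inc a) by apply: OintB => //; exact: Oint_inc.
have [aU|aN] := boolP (a \is a GRing.unit).
  by left; rewrite -(subrKC (inc a) x); apply: ounit_pi_nilp_add => //; exact: ounit_inc.
right; have /(uniformizer_unitP piU)[c cE] := aN.
have [s [z [Oz zE]]] := xa.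
have d : x - (x - inc a) = inc a by ring.
have /eqP := subrXX x (x - inc a) s; rewrite subr_eq zE d.
set Y := (\sum_(i < s) _) => /eqP e; exists s, (inc c * Y + z); split.
  apply: OintD => //; apply: OintM; first exact: Oint_inc.
  by apply: Oint_sum => i _; apply: OintM; apply: OintX.
by rewrite e cE rmorphM; ring.
Qed.

Lemma pi_nilp_nunit x : pi_nilp x -> ~ ounit x.
Proof.
move=> [s [z [Oz xz]]] xU; have [_ _ h] := ounitX s xU.
apply: (Oint_ipiV piU (C := C)); move: h; rewrite xz.
have z0 : z != 0.
  by case: (ounitX s xU); rewrite xz mulf_eq0 negb_or => /andP[].
by move=> /OintM /(_ Oz); rewrite invfM mulfVK.
Qed.

Lemma Oint_monic_sum n (c : nat -> C) b : (forall i, (i < n)%N -> Oint (c i)) ->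
  b ^+ n + \sum_(i < n) c i * b ^+ i = 0 -> Oint b.
Proof.
move=> Oc e; pose q := 'X^n + \poly_(i < n) c i.
have sq : (size (\poly_(i < n) c i) < size ('X^n : {poly C}))%N.
  by rewrite size_polyXn ltnS size_poly.
apply: (@integral_root_monic _ _ _ _ q).
- by rewrite monicE lead_coefDl // lead_coefXn.
- by rewrite /root hornerD hornerXn horner_poly e.
apply/integral_poly => i; rewrite coefD coefXn coef_poly.
apply: OintD; first by case: eqP; [move=> _; exact: Oint1 | move=> _; exact: Oint0].
by case: ltnP => h; [exact: Oc | exact: Oint0].
Qed.

(* If the leading coefficient a_n is not a unit then a_n * x is integral, and it can
   be absorbed in the next coefficient. *)
Lemma valuation_ring_aux n (a : nat -> C) x : (forall i, (i <= n)%N -> Oint (a i)) ->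
  (exists2 i, (i <= n)%N & ounit (a i)) -> \sum_(i < n.+1) a i * x ^+ i = 0 ->
  Oint x \/ Oint x^-1.
Proof.
elim: n a => [|n IHn] a Oa [i iln aiU] e.
  move: e iln aiU; rewrite big_ord_recr big_ord0 /= add0r mulr1 leqn0 => e /eqP ->.
  by case; rewrite e eqxx.
have Oan := Oa _ (leqnn n.+1).
have [anU|anN] := ounit_or_pi_nilp Oan.
  left; have [an0 _ Oani] := anU.
  apply: (@Oint_monic_sum n.+1 (fun i => (a n.+1)^-1 * a i)) => [j jn|].
    by apply: OintM => //; apply: Oa; rewrite ltnW.
  apply: (mulfI an0); rewrite mulr0 -[RHS]e [in RHS]big_ord_recr /= [RHS]addrC mulrDr; congr (_ + _).
  by rewrite mulr_sumr; apply: eq_bigr => j _; rewrite -mulrA mulVKf.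
set b := a n.+1 * x.
have Ob : Oint b.
  apply: (@Oint_monic_sum n.+1 (fun i => a i * a n.+1 ^+ (n - i))) => [j jn|].
    by apply: OintM; [apply: Oa; rewrite ltnW | apply: OintX].
  rewrite -[RHS](mulr0 (a n.+1 ^+ n)) -[in RHS]e [in RHS]big_ord_recr /= [in RHS]addrC mulrDr.
  congr (_ + _); first by rewrite exprMn exprSr; ring.
  rewrite mulr_sumr; apply: eq_bigr => j _; rewrite exprMn.
  have -> : a n.+1 ^+ n = a n.+1 ^+ (n - j) * a n.+1 ^+ j.
    by rewrite -exprD subnK // -ltnS.
  by ring.
pose a' i := if i == n then a n + b else a i.
have a'E : \sum_(i < n.+1) a' i * x ^+ i = 0.
  rewrite -[RHS]e !big_ord_recr /= {2}/a' eqxx /b exprS.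
  under eq_bigr => j _ do rewrite /a' (ltn_eqF (ltn_ord j)).
  by ring.
have Oa' j : (j <= n)%N -> Oint (a' j).
  move=> jn; rewrite /a'; case: eqP => _; last by apply: Oa; rewrite leqW.
  by apply: OintD => //; apply: Oa.
(* Otherwise the only unit among the old coefficients is [a n], while [a n + b] is not a unit; so
   [b] is one, and x^-1 = a_(n+1) / b. *)
have [h|h] := pselect (exists2 j, (j <= n)%N & ounit (a' j)); first exact: (IHn a').
have a'N : ~ ounit (a n + b).
  by move=> hU; apply: h; exists n => //; rewrite /a' eqxx.
have iE : i = n.
  apply: contrapT => /eqP inn; move: iln; rewrite leq_eqVlt => /orP[/eqP iE|iln].
    by apply: (pi_nilp_nunit anN); rewrite -iE.
  by apply: h; exists i; rewrite // /a' (negPf inn).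
rewrite iE in aiU.
have [bU|bN] := ounit_or_pi_nilp Ob; last first.
  by case: a'N; apply: ounit_pi_nilp_add.
right; have [b0 _ Obi] := bU.
have a0 : a n.+1 != 0 by apply: contra_neq b0; rewrite /b => ->; rewrite mul0r.
have -> : x^-1 = a n.+1 * b^-1 by rewrite /b invfM mulVKf.
exact: OintM.
Qed.

End Local.

(** * Uniformizers of the integral closure *)

Lemma exists_last (P : nat -> Prop) B : P 0%N -> (forall n, P n -> (n <= B)%N) ->
  exists n, P n /\ ~ P n.+1.
Proof.
move=> P0 PB; apply: contrapT => h.
have Pall n : P n.
  elim: n => // n IH; apply: contrapT => hn; apply: h; by exists n.
by have := PB _ (Pall B.+1); rewrite ltnn.
Qed.

Section Extension.
Variables (OD : idomainType) (pi : OD).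
Hypothesis piU : uniformizer pi.
Hypothesis compl : m_adic_complete OD.
Variables (k : fieldType) (res : {rmorphism OD -> k}).
Hypothesis k_residue : is_residue_field res.
Hypothesis k_closed : GRing.closed_field_axiom k.

(** Clear the denominators by their product, then divide by the power of [pi] in a coefficient of
    least valuation. *)
Lemma scale_frac N (c : 'I_N -> {fraction OD}) i0 : c i0 != 0 ->
  exists2 l, l != 0 & exists a : 'I_N -> OD,
    (forall i, l * c i = tofrac (a i)) /\ exists i, a i \is a GRing.unit.
Proof.
move=> ci0.
have /choice[n /choice[d nd]] := fun i => frac_rep (c i).
pose D := \prod_i d i.
have D0 : D != 0 by apply/prodf_neq0 => i _; case: (nd i).
have /choice[b bP] : forall i, exists b, tofrac D * c i = tofrac b.
  move=> i; have [di ->] := nd i; exists (\prod_(j | j != i) d j * n i).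
  by rewrite /D (bigD1 i) //= !rmorphM /=; field; rewrite tofrac_eq0.
have /choice[v vP] : forall i, exists v, b i != 0 -> has_val pi (b i) v.
  move=> i; have [->|/(has_val_ex piU compl)[v vP]] := eqVneq (b i) 0; first by exists 0%N.
  by exists v.
have bi0 : b i0 != 0 by rewrite -tofrac_eq0 -bP mulf_neq0 ?tofrac_eq0.
pose i1 := [arg min_(i < i0 | b i != 0) v i].
have [bi1 vmin] : b i1 != 0 /\ forall i, b i != 0 -> (v i1 <= v i)%N.
  by rewrite /i1; case: arg_minnP.
exists (tofrac D / tofrac (pi ^+ v i1)).
  by rewrite mulf_neq0 ?invr_eq0 ?tofrac_eq0 ?expf_neq0 // (uniformizer_neq0 piU).
have /choice[a aP] : forall i, exists a, b i = a * pi ^+ v i1.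
  move=> i; have [->|b0] := eqVneq (b i) 0; first by exists 0; rewrite mul0r.
  have [u _ ->] := vP i b0; exists (u * pi ^+ (v i - v i1)).
  by rewrite -mulrA -exprD subnK // vmin.
exists a; split=> [i|].
  rewrite mulrAC bP aP rmorphM /= mulfK // tofrac_eq0 expf_neq0 //.
  exact: uniformizer_neq0 piU.
exists i1; have [u uU uE] := vP i1 bi1.
by rewrite (_ : a i1 = u) //; apply: (mulIf (expf_neq0 (v i1) (uniformizer_neq0 piU))); rewrite -aP.
Qed.

Variable C : fieldExtType {fraction OD}.
Local Notation inc := (@inc OD C).
Local Notation ipi := (inc pi).

Lemma incZ a (y : C) : tofrac a *: y = inc a * y.
Proof. by rewrite /inc /= -scalerAl mul1r. Qed.

Lemma lin_dep N (y : 'I_N -> C) : (\dim {:C} < N)%N ->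
  exists2 a : 'I_N -> OD, (exists i, a i \is a GRing.unit) &
    \sum_i inc (a i) * y i = 0.
Proof.
move=> dN; pose X := [tuple y i | i < N].
have XE (i : 'I_N) : X`_i = y i by rewrite -tnth_nth tnth_mktuple.
have nf : ~ free X.
  rewrite /free size_tuple => /eqP e; move: dN; rewrite -e ltnNge.
  by rewrite dimvS ?subvf.
have [c [cX [i0 ci0]]] : exists c, \sum_(i < N) c i *: X`_i = 0 /\ exists i, c i != 0.
  apply: contrapT => h; apply: nf; apply/freeP => c cX i.
  by apply/eqP/negPn/negP => ci; apply: h; exists c; split=> //; exists i.
have [l l0 [a [aE aU]]] := scale_frac ci0.
exists a => //.
transitivity (l *: \sum_(i < N) c i *: X`_i); last by rewrite cX scaler0.
rewrite scaler_sumr; apply: eq_bigr => i _.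
by rewrite scalerA aE XE incZ.
Qed.

(** The powers of [x] satisfy a linear relation over O_D with a unit among its coefficients. *)
Lemma valuation_ring (x : C) : Oint x \/ Oint x^-1.
Proof.
have [a [i aU] e] := @lin_dep (\dim {:C}).+1 (fun i => x ^+ i) (ltnSn _).
apply: (@valuation_ring_aux _ _ piU compl _ _ k_residue k_closed _ (\dim {:C}) (fun i => inc (a (inord i)))).
- by move=> j _; exact: Oint_inc.
- exists i; first by rewrite -ltnS.
  by rewrite inord_val; exact: ounit_inc.
by rewrite -[RHS]e; apply: eq_bigr => j _; rewrite inord_val.
Qed.

Definition ononunit (x : C) := Oint x /\ ~ ounit x.

Lemma ononunit0 : ononunit 0.
Proof. by split; [exact: Oint0 | case; rewrite eqxx]. Qed.

Lemma ononunitM x y : ononunit x -> Oint y -> ononunit (x * y).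
Proof.
move=> [Ox xN] Oy; split; first exact: OintM.
by move=> h; apply: xN; exact: ounit_dvd h Ox Oy.
Qed.

Lemma ononunitD x y : ononunit x -> ononunit y -> ononunit (x + y).
Proof.
move=> xN yN; have [->|x0] := eqVneq x 0; first by rewrite add0r.
have [->|y0] := eqVneq y 0; first by rewrite addr0.
wlog : x y xN yN x0 y0 / Oint (x / y).
  move=> h; have [|yx] := valuation_ring (x / y); first exact: h.
  by rewrite addrC; apply: h; rewrite // -invf_div.
move=> Oxy; have -> : x + y = y * (x / y + 1) by rewrite mulrDr mulr1 mulrC divfK.
by apply: ononunitM => //; apply: OintD => //; exact: Oint1.
Qed.

Lemma ononunit_sum (I : Type) (r : seq I) (P : pred I) F :
  (forall i, P i -> ononunit (F i)) -> ononunit (\sum_(i <- r | P i) F i).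
Proof. by move=> h; apply: big_ind => //; [exact: ononunit0 | exact: ononunitD]. Qed.

Lemma ononunit_pi : ononunit ipi.
Proof.
by split; [exact: Oint_inc | case=> _ _; exact: (Oint_ipiV piU)].
Qed.

(* Elements of distinct valuations in [0, v(pi)) are linearly independent over K. *)
Lemma val_chain N (y : 'I_N -> C) :
  (forall i, y i != 0 /\ Oint (y i)) -> (forall i, ononunit (ipi / y i)) ->
  (forall i j : 'I_N, (i < j)%N -> ononunit (y i / y j)) -> (N <= \dim {:C})%N.
Proof.
move=> yP piy yy; rewrite leqNgt; apply/negP => /(@lin_dep _ y) [a [i0 ai0] e].
(* The term at the last unit coefficient strictly dominates: earlier [y i] have larger valuation,
   and later coefficients are divisible by [pi], whose valuation exceeds that of [y j0]. *)
pose j0 := [arg max_(i > i0 | a i \is a GRing.unit) (i : nat)].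
have [aj0 jmax] : a j0 \is a GRing.unit /\ forall i, a i \is a GRing.unit -> (i <= j0)%N.
  by rewrite /j0; case: arg_maxnP.
have [yj0 Oyj0] := yP j0.
have {e} : inc (a j0) + \sum_(i | i != j0) inc (a i) * y i / y j0 = 0.
  apply: (mulIf yj0); rewrite mul0r -[RHS]e [in RHS](bigD1 j0) //= mulrDl mulr_suml.
  by congr (_ + _); apply: eq_bigr => i _; rewrite divfK.
move/eqP; rewrite addr_eq0 => /eqP e.
suff : ononunit (inc (a j0)) by case=> _; apply; exact: ounit_inc.
rewrite e -mulN1r mulrC; apply: ononunitM; last by apply/OintN/Oint1.
apply: ononunit_sum => i ij0.
have [ij|ji] := ltnP i j0.
  by rewrite -mulrA mulrC; apply: ononunitM; [exact: yy | exact: Oint_inc].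
have ai : a i \isn't a GRing.unit.
  by apply: contra ij0 => /jmax ij; apply/eqP/val_inj/eqP; rewrite eqn_leq ij ji.
have /(uniformizer_unitP piU)[c ->] := ai.
have -> : inc (c * pi) * y i / y j0 = (ipi / y j0) * (inc c * y i) by rewrite rmorphM; ring.
by apply: ononunitM => //; apply: OintM; [exact: Oint_inc | case: (yP i)].
Qed.

(** Otherwise every nonzero nonunit has a nonunit of strictly smaller valuation. Starting from [pi],
    this gives chains of any length below v(pi), against [val_chain]. *)
Lemma uniformizer_ext : exists2 p, p != 0 & ononunit p /\ forall y, ononunit y -> Oint (y / p).
Proof.
apply: contrapT => h.
have /choice[g gP] : forall p, exists y, p != 0 -> ononunit p ->
    [/\ y != 0, ononunit y & ononunit (p / y)].
  move=> p; have [[p0 pN]|hp] := pselect (p != 0 /\ ononunit p); last first.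
    by exists 0 => p0 pN; case: hp.
  apply: contrapT => hy; apply: h; exists p => //; split=> // y yN.
  apply: contrapT => yp; apply: hy; exists y => _ _.
  have y0 : y != 0 by apply: contra_not_neq yp => ->; rewrite mul0r; exact: Oint0.
  split=> //; split.
    by have [//|] := valuation_ring (y / p); rewrite invf_div.
  by case=> _ _; rewrite invf_div.
pose Y n := iter n g ipi.
have Y0 n : Y n != 0 /\ ononunit (Y n).
  elim: n => [|n [IH1 IH2]]; first by split; [exact: ipi_neq0 | exact: ononunit_pi].
  by have [] := gP _ IH1 IH2.
have YS n : ononunit (Y n / Y n.+1) by have [h1 h2] := Y0 n; case: (gP _ h1 h2).
have YY n d : ononunit (Y n / Y (n + d.+1)%N).
  elim: d => [|d IH]; first by rewrite addn1.
  have [Yn _] := Y0 (n + d.+1)%N.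
  rewrite (_ : _ / _ = (Y n / Y (n + d.+1)%N) * (Y (n + d.+1)%N / Y (n + d.+1).+1)).
    by apply: ononunitM => //; case: (YS (n + d.+1)%N).
  by rewrite mulrA divfK // !addnS.
suff: (\dim {:C} < \dim {:C})%N by rewrite ltnn.
apply: (@val_chain _ (fun i => Y i.+1)) => [i|i|i j ij].
- by have [h1 [h2 _]] := Y0 i.+1.
- by have := YY 0%N i; rewrite add0n.
have := YY i.+1 (j - i.+1)%N.
by rewrite addnS subnKC.
Qed.

Definition hasv (p x : C) n := exists2 u, ounit u & x = u * p ^+ n.

Section Unif.
Variable p : C.
Hypothesis p0 : p != 0.
Hypothesis pN : ononunit p.
Hypothesis pmax : forall y, ononunit y -> Oint (y / p).

Let Op : Oint p. Proof. by case: pN. Qed.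

Lemma ononunitX n : ononunit (p ^+ n.+1).
Proof. by rewrite exprS; apply: ononunitM => //; exact: OintX. Qed.

(** If p^s divides [pi], then p^(s-1), ..., p, 1 form a chain as in [val_chain]. *)
Lemma pi_val_bound s : Oint (ipi / p ^+ s) -> (s <= \dim {:C})%N.
Proof.
move=> Os; apply: (@val_chain s (fun j => p ^+ (s - j.+1))) => [i|i|i j ij].
- by split; [rewrite expf_neq0 | exact: OintX].
- have -> : ipi / p ^+ (s - i.+1) = p ^+ i.+1 * (ipi / p ^+ s).
    by rewrite expfB_cond ?(negPf p0) ?add0n // invf_div mulrCA.
  by apply: ononunitM => //; exact: ononunitX.
have -> : (s - i.+1 = s - j.+1 + (j - i.+1).+1)%N by have := ltn_ord j; lia.
by rewrite exprD mulrAC mulfV ?expf_neq0 // mul1r; exact: ononunitX.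
Qed.

Lemma ext_uniformizer_nunit n : ~ Oint (p ^+ n.+1)^-1.
Proof.
move=> h; have [On] := ononunitX n; apply; split=> //; exact: expf_neq0.
Qed.

Lemma hasv_of_bound x B : x != 0 -> Oint x ->
  (forall s, Oint (x / p ^+ s) -> (s <= B)%N) -> exists n, hasv p x n.
Proof.
move=> x0 Ox xB.
have [|n [On nN]] := @exists_last (fun s => Oint (x / p ^+ s)) B _ xB.
  by rewrite expr0 divr1.
exists n; exists (x / p ^+ n); last by rewrite divfK ?expf_neq0.
apply: contrapT => xN; apply: nN.
by rewrite exprSr invfM mulrA; apply: pmax.
Qed.

Lemma hasv_pi : exists r, hasv p ipi r /\ (r <= \dim {:C})%N.
Proof.
have [r rP] := hasv_of_bound (ipi_neq0 piU C) (Oint_inc C pi) pi_val_bound.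
exists r; split=> //; apply: pi_val_bound; case: rP => u [_ Ou _] ->.
by rewrite mulfK // expf_neq0.
Qed.

(** The valuation of [x] is bounded because [x] divides some pi^t, of valuation r t. *)
Lemma hasv_ex x : x != 0 -> Oint x -> exists n, hasv p x n.
Proof.
move=> x0 Ox; have [t Ot] := Oint_bound piU compl Ox x0.
have [r [[u uU uE] _]] := hasv_pi.
apply: (@hasv_of_bound x (r * t)) => // s Os; rewrite leqNgt; apply/negP => ts.
have [u0 Ou Oui] := ounitX t uU.
apply: (@ext_uniformizer_nunit (s - (r * t).+1)%N).
have -> : (p ^+ (s - (r * t).+1).+1)^-1 = (u ^+ t)^-1 * ((ipi ^+ t / x) * (x / p ^+ s)).
  have -> : p ^+ s = p ^+ (r * t) * p ^+ (s - (r * t).+1).+1 by rewrite -exprD; congr (_ ^+ _); lia.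
  rewrite uE exprMn -exprM; field.
  by rewrite x0 !expf_neq0 //; case: uU.
by apply: OintM => //; exact: OintM.
Qed.

Lemma hasv_uniq x n m : hasv p x n -> hasv p x m -> n = m.
Proof.
suff h a b : hasv p x a -> hasv p x b -> (b <= a)%N.
  by move=> hn hm; apply/eqP; rewrite eqn_leq !h.
case=> u [u0 Ou Oui] -> [v [v0 Ov Ovi] e]; rewrite leqNgt; apply/negP => ab.
move: e; have -> : b = (a + (b - a.+1).+1)%N by lia.
rewrite exprD mulrCA [u * _]mulrC => /(mulfI (expf_neq0 a p0)) e.
apply: (@ext_uniformizer_nunit (b - a.+1)%N).
have -> : (p ^+ (b - a.+1).+1)^-1 = v * (u)^-1.
  by rewrite e invfM mulVKf.
exact: OintM.
Qed.

(** Horner's scheme: subtract a constant with the same residue as [x], divide by [p], repeat. *)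
Lemma residue_step r x : Oint x -> exists q : {poly OD}, (size q <= r)%N /\ exists2 y, Oint y & x = adj_ev p q + p ^+ r * y.
Proof.
elim: r x => [|r IH] x Ox.
  exists 0; split; first by rewrite size_poly0.
  by exists x; rewrite // rmorph0 add0r mul1r.
have [a aN] := residue_pi_nilp piU compl k_residue k_closed Ox.
have Oy : Oint ((x - inc a) / p).
  apply: pmax; split; first by apply: OintB => //; exact: Oint_inc.
  exact: (pi_nilp_nunit piU aN).
have [q [sq [y Oy' yE]]] := IH _ Oy.
exists (q * 'X + a%:P); split.
  by rewrite size_MXaddC; case: ifP => // _.
exists y => //; rewrite rmorphD rmorphM /= adj_evX adj_evC exprS.
rewrite -[x in LHS](subrK (inc a)) -[x - inc a](divfK p0) yE; ring.
Qed.

(** As p^r is [pi] up to a unit, [residue_step] gives x = q(p) + pi x' with [q] of size at most r.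
    Iterating yields a series in [pi] whose terms have bounded size, so it sums to a polynomial of
    that size. *)
Lemma integral_expansion r x : hasv p ipi r -> Oint x ->
  exists2 q : {poly OD}, (size q <= r)%N & x = adj_ev p q.
Proof.
move=> [u uU piE] Ox; have [u0 Ou Oui] := uU.
have /choice[fg fgP] : forall x, exists qy : {poly OD} * C, Oint x ->
    [/\ (size qy.1 <= r)%N, Oint qy.2 & x = adj_ev p qy.1 + ipi * qy.2].
  move=> z; have [Oz|nOz] := pselect (Oint z); last by exists (0, 0).
  have [q [sq [y Oy yE]]] := residue_step r Oz.
  exists (q, u^-1 * y) => _; split=> //=; first exact: OintM.
  by rewrite yE piE; congr (_ + _); rewrite mulrACA mulfV // mul1r.
pose z t := iter t (fun y => (fg y).2) x.
have Oz t : Oint (z t) by elim: t => //= t IH; case: (fgP _ IH).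
have [t|h sh hP] := @poly_series_complete _ pi piU compl r (fun t => (fg (z t)).1).
  by case: (fgP _ (Oz t)).
exists h => //.
have xE s : x = \sum_(t < s) ipi ^+ t * adj_ev p (fg (z t)).1 + ipi ^+ s * z s.
  elim: s => [|s IH]; first by rewrite big_ord0 add0r mul1r.
  rewrite big_ord_recr /= -addrA {1}IH; congr (_ + _).
  by have [_ _ zE] := fgP _ (Oz s); rewrite {1}zE exprSr; ring.
apply/eqP; rewrite -subr_eq0; apply/eqP; apply: (Oint_sep piU compl) => [|s].
  by apply: OintB => //; exact: Oint_adj_ev.
have [q qE] := hP s; exists (z s - adj_ev p q).
  by apply: OintB => //; exact: Oint_adj_ev.
rewrite (xE s); have -> : adj_ev p h =
    \sum_(t < s) ipi ^+ t * adj_ev p (fg (z t)).1 + ipi ^+ s * adj_ev p q.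
  rewrite (ipiX pi C s) -adj_evZ -qE rmorphB rmorph_sum /= addrC.
  rewrite [X in _ - X](_ : _ = \sum_(t < s) ipi ^+ t * adj_ev p (fg (z t)).1) ?subrK //.
  by apply: eq_bigr => t _; rewrite adj_evZ ipiX.
by rewrite mulrBr opprD addrACA subrr add0r.
Qed.

Lemma adj_ev_coef r (q : {poly OD}) : (size q <= r)%N ->
  adj_ev p q = \sum_(i < r) inc q`_i * p ^+ i.
Proof.
move=> sq; rewrite adj_evE (@horner_coef_wide _ r); last exact: leq_trans (size_poly _ _) sq.
by apply: eq_bigr => i _; rewrite coef_map.
Qed.

Definition pow_tuple r : r.-tuple C := [tuple p ^+ i | i < r].

(** Total ramification. If r = v(pi), the powers 1, ..., p^(r-1) span [C] by [integral_expansion],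
    so r is at least the degree; [pi_val_bound] gives the converse. *)
Lemma hasv_pi_dim : hasv p ipi (\dim {:C}) /\ basis_of {:C} (pow_tuple (\dim {:C})).
Proof.
have [r [rP rd]] := hasv_pi.
have sp : (fullv <= <<pow_tuple r>>)%VS.
  apply/subvP => y _.
  have [t Ot] : exists t, Oint (ipi ^+ t * y).
    have [Oy|Oy] := valuation_ring y; first by exists 0%N; rewrite mul1r.
    have [->|y0] := eqVneq y 0; first by exists 0%N; rewrite mulr0; exact: Oint0.
    have [|t Ot] := Oint_bound piU compl Oy; first by rewrite invr_eq0.
    by exists t; rewrite invrK in Ot.
  have [q sq qE] := integral_expansion rP Ot.
  have -> : y = (tofrac (pi ^+ t))^-1 *: (ipi ^+ t * y).
    rewrite ipiX -incZ scalerA mulVf ?scale1r // tofrac_eq0 expf_neq0 //.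
    exact: uniformizer_neq0 piU.
  apply: memvZ; rewrite qE (adj_ev_coef sq); apply: memv_suml => i _.
  rewrite -incZ; apply: memvZ; apply: memv_span.
  by apply/codomP; exists i.
have rE : r = \dim {:C}.
  apply/eqP; rewrite eqn_leq rd /=.
  by apply: leq_trans (dimvS sp) (leq_trans (dim_span _) _); rewrite size_tuple.
rewrite -rE; split=> //.
by rewrite basisEdim sp size_tuple.
Qed.

End Unif.
End Extension.

(** * Traces and discriminants *)

Section Trace.
Variables (OD : idomainType) (pi : OD).
Hypothesis piU : uniformizer pi.
Hypothesis compl : m_adic_complete OD.
Variables (k : fieldType) (res : {rmorphism OD -> k}).
Hypothesis k_residue : is_residue_field res.
Hypothesis k_closed : GRing.closed_field_axiom k.
Variable C : fieldExtType {fraction OD}.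
Local Notation inc := (@inc OD C).
Local Notation ipi := (inc pi).
Local Notation K := {fraction OD}.
Variable p : C.
Hypothesis p0 : p != 0.
Hypothesis pN : ononunit p.
Hypothesis pmax : forall y, ononunit y -> Oint (y / p).
Variable m : nat.
Hypothesis m_gt0 : (0 < m)%N.
Hypothesis Cm : \dim {:C} = m.

Local Notation X := (pow_tuple p m).

Let Op : Oint p. Proof. by case: pN. Qed.

Lemma pow_nth (i : 'I_m) : X`_i = p ^+ i.
Proof. by rewrite -tnth_nth tnth_mktuple. Qed.

Lemma pow_tuple_basis : basis_of {:C} X.
Proof. by case: (hasv_pi_dim piU compl k_residue k_closed p0 pN pmax); rewrite Cm. Qed.

Lemma hasv_pi_deg : hasv p ipi m.
Proof. by case: (hasv_pi_dim piU compl k_residue k_closed p0 pN pmax); rewrite Cm. Qed.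

Lemma coord_powE x : x = \sum_i coord X i x *: p ^+ i.
Proof.
rewrite {1}(coord_basis pow_tuple_basis (memvf x)); apply: eq_bigr => i _.
by rewrite pow_nth.
Qed.

Lemma coord_pow_sum (c : 'I_m -> K) j : coord X j (\sum_i c i *: p ^+ i) = c j.
Proof.
rewrite -(coord_sum_free c j (basis_free pow_tuple_basis)); congr (coord X j _).
by apply: eq_bigr => i _; rewrite pow_nth.
Qed.

Lemma coord_int x : Oint x -> exists a : 'I_m -> OD, forall j, coord X j x = tofrac (a j).
Proof.
move=> Ox.
have [q sq ->] := integral_expansion piU compl k_residue k_closed p0 pN pmax hasv_pi_deg Ox.
exists (fun j => q`_j) => j; rewrite (adj_ev_coef p sq).
rewrite -[RHS](coord_pow_sum (fun i : 'I_m => tofrac q`_i)); congr (coord X j _).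
by apply: eq_bigr => i _; rewrite incZ.
Qed.

Lemma coord_int_inv x (a : 'I_m -> OD) : (forall j, coord X j x = tofrac (a j)) -> Oint x.
Proof.
move=> xa; rewrite [x]coord_powE; apply: Oint_sum => i _; rewrite xa incZ.
by apply: OintM; [exact: Oint_inc | exact: OintX].
Qed.

Definition mulmat (x : C) : 'M[K]_m := \matrix_(i, j) coord X j (x * p ^+ i).

Lemma mulmatE x (i : 'I_m) : x * p ^+ i = \sum_j mulmat x i j *: p ^+ j.
Proof. by rewrite [LHS]coord_powE; apply: eq_bigr => j _; rewrite mxE. Qed.

Lemma mulmatM x y : mulmat (x * y) = mulmat x *m mulmat y.
Proof.
apply/matrixP => i j; rewrite !mxE -mulrA [_ * (y * _)]mulrCA mulmatE mulr_sumr.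
rewrite linear_sum; apply: eq_bigr => l _.
by rewrite -scalerAr linearZ /= !mxE.
Qed.

Lemma mulmat_inc a : mulmat (inc a) = (tofrac a)%:M.
Proof.
apply/matrixP => i j; rewrite !mxE -incZ linearZ /= -pow_nth.
by rewrite (coord_free _ _ (basis_free pow_tuple_basis)) mulr_natr.
Qed.

Lemma mulmat_int x : Oint x -> exists A : 'M[OD]_m, mulmat x = map_mx (@tofrac OD) A.
Proof.
move=> Ox.
have /choice[a aP] : forall i : 'I_m, exists a : 'I_m -> OD, forall j, coord X j (x * p ^+ i) = tofrac (a j).
  by move=> i; apply: coord_int; apply: OintM => //; exact: OintX.
by exists (\matrix_(i, j) a i j); apply/matrixP => i j; rewrite !mxE aP.
Qed.

Definition mul_det x := \det (mulmat x).

Lemma mul_detM x y : mul_det (x * y) = mul_det x * mul_det y.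
Proof. by rewrite /mul_det mulmatM det_mulmx. Qed.

Lemma mul_det1 : mul_det 1 = 1.
Proof. by rewrite /mul_det -(rmorph1 inc) mulmat_inc rmorph1 det1. Qed.

Lemma mul_detX x n : mul_det (x ^+ n) = mul_det x ^+ n.
Proof. by elim: n => [|n IH]; rewrite ?mul_det1 // !exprS mul_detM IH. Qed.

Lemma mul_det_int x : Oint x -> exists a, mul_det x = tofrac a.
Proof.
by move=> /mulmat_int[A AE]; exists (\det A); rewrite /mul_det AE det_map_mx.
Qed.

Lemma mul_det_unit u : ounit u -> exists2 a, a \is a GRing.unit & mul_det u = tofrac a.
Proof.
move=> [u0 Ou Oui]; have [a aE] := mul_det_int Ou; have [b bE] := mul_det_int Oui.
exists a => //; apply/unitrP; exists b.
have : mul_det u * mul_det u^-1 = 1 by rewrite -mul_detM mulfV // mul_det1.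
rewrite aE bE -rmorphM -(rmorph1 (@tofrac OD)) => /eqP; rewrite tofrac_eq => /eqP e.
by rewrite mulrC.
Qed.

(** The norm of [p] has valuation 1, because the norm pi^m of [pi] is a unit times its m-th
    power. *)
Lemma mul_det_val y n : hasv p y n -> exists2 a, has_val pi a n & mul_det y = tofrac a.
Proof.
have [u uU piE] := hasv_pi_deg.
have [a aU aE] := mul_det_unit uU.
have [b bE] := mul_det_int Op.
have e : pi ^+ m = a * b ^+ m.
  apply/eqP; rewrite -tofrac_eq !(rmorphM, rmorphXn) /= -aE -bE -mul_detX -mul_detM.
  by rewrite -piE /mul_det mulmat_inc det_scalar.
have b0 : b != 0.
  apply: contra_eq_neq e => ->; rewrite expr0n -leqn0 leqNgt m_gt0 mulr0 expf_neq0 //.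
  exact: uniformizer_neq0 piU.
have [v bv] := has_val_ex piU compl b0.
have v1 : v = 1%N.
  have h1 : has_val pi (pi ^+ m) m by exists 1; rewrite ?unitr1 ?mul1r.
  have h2 : has_val pi (pi ^+ m) (0 + v * m).
    by rewrite e; apply: has_val_mul; [exact: has_val_unit | exact: has_val_exp].
  have := has_val_uniq piU h1 h2; rewrite add0n.
  by move=> h; apply/eqP; rewrite -(eqn_pmul2r m_gt0) mul1n -h.
case=> w wU ->; have [c cU cE] := mul_det_unit wU.
exists (c * b ^+ n).
  rewrite -[n]add0n; apply: has_val_mul; first exact: has_val_unit.
  by rewrite -[X in has_val _ _ X]mul1n -v1; exact: has_val_exp.
by rewrite mul_detM mul_detX cE bE rmorphM rmorphXn.
Qed.

Definition field_trace (x : C) : K := \tr (mulmat x).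

Lemma field_trace_linear a x y : field_trace (a *: x + y) = a * field_trace x + field_trace y.
Proof.
rewrite /field_trace /mxtrace mulr_sumr -big_split /=; apply: eq_bigr => i _.
by rewrite !mxE mulrDl -scalerAl linearP.
Qed.

Lemma field_trace_sum (c : 'I_m -> K) (f : 'I_m -> C) :
  field_trace (\sum_i c i *: f i) = \sum_i c i * field_trace (f i).
Proof.
have f0 : field_trace 0 = 0.
  by rewrite /field_trace /mxtrace big1 // => i _; rewrite mxE mul0r linear0.
elim/big_rec2: _ => [|i y1 y2 _ IH]; first exact: f0.
by rewrite field_trace_linear IH.
Qed.

Lemma field_trace_int x : Oint x -> exists a, field_trace x = tofrac a.
Proof.
move=> /mulmat_int[A AE]; exists (\tr A).
by rewrite /field_trace AE /mxtrace rmorph_sum; apply: eq_bigr => i _; rewrite mxE.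
Qed.

Definition last_ord : 'I_m := Ordinal (ltac:(by rewrite prednK) : (m.-1 < m)%N).

(** The form lambda; it generates the O_D-linear forms on O_C as an O_C-module. *)
Definition top_coord (x : C) : K := coord X last_ord x.

Lemma top_coord_sum (c : 'I_m -> K) (f : 'I_m -> C) :
  top_coord (\sum_i c i *: f i) = \sum_i c i * top_coord (f i).
Proof.
by rewrite /top_coord linear_sum; apply: eq_bigr => i _; rewrite linearZ.
Qed.

Lemma top_coord_pow (j : nat) : (j < m)%N -> top_coord (p ^+ j) = (j == m.-1)%:R.
Proof.
move=> jm; rewrite /top_coord -[j]/(nat_of_ord (Ordinal jm)) -pow_nth.
by rewrite (coord_free _ _ (basis_free pow_tuple_basis)).
Qed.

(* The Gram matrix is antitriangular with ones on the antidiagonal. *)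
Lemma top_coord_gram : exists2 S : 'M[OD]_m, S \in unitmx &
  forall i j : 'I_m, top_coord (p ^+ i * p ^+ j) = tofrac (S i j).
Proof.
have /choice[s sP] : forall i : 'I_m, exists s : 'I_m -> OD, forall j : 'I_m, top_coord (p ^+ i * p ^+ j) = tofrac (s j).
  move=> i; have /choice[s sP] : forall j : 'I_m, exists s, top_coord (p ^+ i * p ^+ j) = tofrac s.
    move=> j; have [|a aP] := @coord_int (p ^+ i * p ^+ j); first by apply: OintM; exact: OintX.
    by exists (a last_ord); rewrite /top_coord aP.
  by exists s.
pose S : 'M[OD]_m := \matrix_(i, j) s i j.
have SE (i j : 'I_m) : top_coord (p ^+ i * p ^+ j) = tofrac (S i j) by rewrite mxE sP.
exists S => //.
pose sg : 'S_m := perm (@rev_ord_inj m).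
have Slow (i j : 'I_m) : (j < i)%N -> S (rev_ord i) j = 0.
  move=> ji; apply/eqP; rewrite -tofrac_eq0 -SE -exprD top_coord_pow /=; last first.
    by have := ltn_ord i; lia.
  by rewrite (_ : (m - i.+1 + j == m.-1)%N = false) //; apply/negbTE/eqP; have := ltn_ord i; lia.
have Sdiag (i : 'I_m) : S (rev_ord i) i = 1.
  apply/eqP; rewrite -tofrac_eq -SE -exprD top_coord_pow /=; last first.
    by have := ltn_ord i; lia.
  by rewrite (_ : (m - i.+1 + i == m.-1)%N = true) ?rmorph1 //; apply/eqP; have := ltn_ord i; lia.
have d1 : \det (row_perm sg S) = 1.
  rewrite -det_tr det_trig; last first.
    by apply/is_trig_mxP => i j ij; rewrite !mxE permE; have := Slow _ _ ij; rewrite mxE.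
  by rewrite big1 // => i _; rewrite !mxE permE; have := Sdiag i; rewrite mxE.
have : \det (row_perm sg S) \is a GRing.unit by rewrite d1 unitr1.
by rewrite row_permE det_mulmx unitrM => /andP[_]; rewrite unitmxE.
Qed.

(** O_C is its own dual for lambda: the Gram matrix is invertible over O_D, so the coordinates of
    [z] are recovered integrally. *)
Lemma top_coord_int_inv z (c : 'I_m -> OD) : (forall j : 'I_m, top_coord (z * p ^+ j) = tofrac (c j)) -> Oint z.
Proof.
move=> zc; have [S SU SE] := top_coord_gram.
pose zr : 'rV[K]_m := \row_j coord X j z.
have zS : zr *m map_mx (@tofrac OD) S = map_mx (@tofrac OD) (\row_j c j).
  apply/rowP => j; rewrite !mxE -zc [in RHS](coord_powE z) mulr_suml.
  under [in RHS]eq_bigr do rewrite -scalerAl.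
  rewrite top_coord_sum; apply: eq_bigr => i _; by rewrite !mxE SE.
have zE : zr = map_mx (@tofrac OD) (\row_j c j *m invmx S).
  rewrite map_mxM -zS -mulmxA -map_mxM mulmxV // map_mx1 mulmx1 //.
apply: (@coord_int_inv z (fun j => (\row_j c j *m invmx S) 0 j)) => j.
by move/rowP: zE => /(_ j); rewrite !mxE.
Qed.

(** The coordinates of [y] solve a linear system with the unimodular Gram matrix. When the trace is
    nonzero, [y] generates the different of C over K. *)
Lemma field_trace_top_coord : exists2 y, Oint y & forall x, field_trace x = top_coord (y * x).
Proof.
have [S SU SE] := top_coord_gram.
have /choice[t tP] : forall j : 'I_m, exists t, field_trace (p ^+ j) = tofrac t.
  by move=> j; apply: field_trace_int; exact: OintX.
pose yc := \row_j t j *m invmx S.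
exists (\sum_i tofrac (yc 0 i) *: p ^+ i).
  apply: Oint_sum => i _; rewrite incZ.
  by apply: OintM; [exact: Oint_inc | exact: OintX].
move=> x; rewrite [x]coord_powE field_trace_sum mulr_sumr.
under [in RHS]eq_bigr do rewrite -scalerAr.
rewrite top_coord_sum; apply: eq_bigr => j _; congr (_ * _).
rewrite tP mulr_suml; under [in RHS]eq_bigr do rewrite -scalerAl.
rewrite top_coord_sum.
have <- : (yc *m S) 0 j = t j by rewrite -mulmxA mulVmx // mulmx1 mxE.
by rewrite mxE rmorph_sum; apply: eq_bigr => i _; rewrite rmorphM SE.
Qed.

Hypothesis tr_neq0 : exists x, field_trace x != 0.

(** The matrix of traces is Y S, with Y the matrix of multiplication by [y] and S unimodular, so its
    determinant has the valuation of the norm of [y], that is d = v_p(y). And d %/ m is the largest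
    s with y / pi^s integral, since v_p(pi) = m. *)
Lemma trace_disc : exists d (T : 'M[OD]_m),
  [/\ forall i j : 'I_m, field_trace (p ^+ i * p ^+ j) = tofrac (T i j),
      has_val pi (\det T) d,
      forall x, Oint x -> exists a, field_trace x = tofrac (a * pi ^+ (d %/ m)) &
      exists (i : 'I_m) a, field_trace (p ^+ i) = tofrac a /\ has_val pi a (d %/ m)].
Proof.
have [S SU SE] := top_coord_gram; have [y Oy yP] := field_trace_top_coord.
have y0 : y != 0.
  have [x] := tr_neq0; rewrite yP; apply: contra_neq => ->.
  by rewrite mul0r /top_coord linear0.
have [d yd] := hasv_ex piU compl k_residue k_closed p0 pN pmax y0 Oy.
have [Y YE] := mulmat_int Oy.
have TE (i j : 'I_m) : field_trace (p ^+ i * p ^+ j) = tofrac ((Y *m S) i j).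
  rewrite yP mulrA (mulmatE y i) mulr_suml; under eq_bigr do rewrite -scalerAl.
  rewrite top_coord_sum mxE rmorph_sum; apply: eq_bigr => l _.
  by rewrite rmorphM YE !mxE SE.
exists d, (Y *m S).
have Yd : has_val pi (\det Y) d.
  have [a ad /eqP] := mul_det_val yd; rewrite /mul_det YE det_map_mx tofrac_eq => /eqP -> //.
have dS : has_val pi (\det (Y *m S)) d.
  rewrite det_mulmx -[d]addn0; apply: has_val_mul => //; apply: has_val_unit.
  by rewrite -unitmxE.
have [u uU piE] := hasv_pi_deg; have [u0 Ou Oui] := uU.
have [w wU yE] := yd; have [w0 Ow Owi] := wU.
have ftrD x : Oint x -> exists a, field_trace x = tofrac (a * pi ^+ (d %/ m)).
  move=> Ox; pose z := y / ipi ^+ (d %/ m).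
  have Oz : Oint z.
    have -> : z = w * (u^-1) ^+ (d %/ m) * p ^+ (d - m * (d %/ m)).
      rewrite /z yE piE exprMn -exprM exprVn.
      have {1}-> : (d = m * (d %/ m) + (d - m * (d %/ m)))%N.
        by rewrite subnKC // mulnC leq_trunc_div.
      rewrite exprD; field; by rewrite !expf_neq0.
    apply: OintM; last exact: OintX.
    by apply: OintM => //; exact: OintX.
  have [|a aP] := @coord_int (z * x); first exact: OintM.
  exists (a last_ord); rewrite rmorphM /= mulrC -aP yP -/(top_coord _).
  have -> : y * x = tofrac (pi ^+ (d %/ m)) *: (z * x).
    by rewrite incZ -ipiX /z; field; rewrite expf_neq0 // (ipi_neq0 piU).
  by rewrite /top_coord linearZ.
split=> //.
(* Otherwise the traces of all powers of [p] are divisible by pi^(d %/ m + 1), and self-duality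
   makes y / pi^(d %/ m + 1) integral, although its valuation d - m (d %/ m + 1) is negative. *)
apply: contrapT => h.
have /choice[c cP] : forall i : 'I_m, exists c, field_trace (p ^+ i) = tofrac (c * pi ^+ (d %/ m).+1).
  move=> i; have [|a aE] := ftrD (p ^+ i); first exact: OintX.
  have [aU|aN] := boolP (a \is a GRing.unit).
    by case: h; exists i, (a * pi ^+ (d %/ m)); split=> //; exists a.
  have /(uniformizer_unitP piU)[c cE] := aN.
  by exists c; rewrite aE cE exprS mulrA.
pose z := y / ipi ^+ (d %/ m).+1.
have pi0 : ipi ^+ (d %/ m).+1 != 0 by rewrite expf_neq0 // (ipi_neq0 piU).
have Oz : Oint z.
  apply: (@top_coord_int_inv z c) => j.
  have ->: z * p ^+ j = (tofrac (pi ^+ (d %/ m).+1))^-1 *: (y * p ^+ j).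
    apply: (scalerI (_ : tofrac (pi ^+ (d %/ m).+1) != 0)).
      by rewrite tofrac_eq0 expf_neq0 // (uniformizer_neq0 piU).
    rewrite scalerA mulfV ?scale1r ?tofrac_eq0 ?expf_neq0 ?(uniformizer_neq0 piU) //.
    by rewrite incZ -ipiX /z; field.
  rewrite /top_coord linearZ /= -/(top_coord _) -yP cP rmorphM /= mulrC mulfK //.
  by rewrite tofrac_eq0 expf_neq0 // (uniformizer_neq0 piU).
have dlt : (d < m * (d %/ m).+1)%N by rewrite mulnC ltn_ceil.
apply: (ext_uniformizer_nunit p0 pN (n := (m * (d %/ m).+1 - d.+1))).
have -> : (p ^+ (m * (d %/ m).+1 - d.+1).+1)^-1 = w^-1 * (u ^+ (d %/ m).+1) * z.
  have e : p ^+ (m * (d %/ m).+1) = p ^+ d * p ^+ (m * (d %/ m).+1 - d.+1).+1.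
    by rewrite -exprD; congr (_ ^+ _); lia.
  rewrite /z yE piE exprMn -exprM e; field.
  by rewrite w0 !expf_neq0.
by apply: OintM => //; apply: OintM => //; exact: OintX.
Qed.

End Trace.

(** * Transfer between subalgebras of M and their field models *)

Section Model.
Variables (OD : idomainType) (pi : OD).
Local Notation K := {fraction OD}.
Variables (M : falgType K) (C : fieldExtType K) (iota : {linear C -> M}).
Hypothesis iota_inj : injective iota.
Hypothesis iotaM : {morph iota : x y / x * y}.
Local Notation inc := (@inc OD C).
Local Notation incM := (GRing.in_alg M \o @tofrac OD).

Lemma iotaXS x n : iota (x ^+ n.+1) = iota x ^+ n.+1.
Proof. by elim: n => [|n IH]; rewrite ?expr1 // exprS iotaM IH -exprS. Qed.

(** [iota] need not send 1 to 1, so it need not commute with evaluation because of the constant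
    term. The extra factor [x] repairs this; integral equations are accordingly multiplied by 'X. *)
Lemma iota_horner (q : {poly OD}) x :
  (map_poly incM q).[iota x] * iota x = iota ((map_poly inc q).[x] * x).
Proof.
rewrite !horner_poly !mulr_suml linear_sum; apply: eq_bigr => i _.
rewrite -mulrA -exprSr -[in RHS]mulrA -[in RHS]exprSr -incZ linearZ /= iotaXS.
by rewrite -scalerAl mul1r.
Qed.

Lemma intclosure_iota x : intclosure (iota x) <-> Oint x.
Proof.
split=> -[q q1 /rootP qx]; exists (q * 'X); rewrite ?monicMr ?monicX //; apply/rootP.
  rewrite rmorphM /= map_polyX hornerMX; apply: iota_inj.
  by rewrite -iota_horner linear0 [X in X * _]qx mul0r.
rewrite -[LHS]/((map_poly incM (q * 'X)).[iota x]) rmorphM /= map_polyX hornerMX.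
by rewrite [LHS]iota_horner qx mul0r linear0.
Qed.

Variable W : {vspace M}.
Hypothesis WE : forall x, x \in W <-> exists c, x = iota c.

Lemma dim_model : \dim {:C} = \dim W.
Proof.
have -> : W = (linfun iota @: fullv)%VS.
  apply/vspaceP => x; apply/idP/memv_imgP.
    by move=> /WE [c ->]; exists c; rewrite ?memvf ?lfunE.
  by case=> c _ ->; rewrite lfunE; apply/WE; exists c.
rewrite limg_dim_eq // (eqP (_ : lker _ == 0%VS)) ?capv0 //.
by apply/lker0P => x y; rewrite !lfunE => /iota_inj.
Qed.

Lemma dim_model_gt0 : (0 < \dim W)%N.
Proof. by rewrite -dim_model adim_gt0. Qed.

Hypothesis piU : uniformizer pi.
Hypothesis compl : m_adic_complete OD.
Variables (k : fieldType) (res : {rmorphism OD -> k}).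
Hypothesis k_residue : is_residue_field res.
Hypothesis k_closed : GRing.closed_field_axiom k.
Variable p : C.
Hypothesis p0 : p != 0.
Hypothesis pN : ononunit p.
Hypothesis pmax : forall y, ononunit y -> Oint (y / p).

Local Notation m := (\dim W).
Local Notation X := (pow_tuple p m).
Local Notation field_trace := (@field_trace OD C p m).

Lemma trace_on_iota x : trace_on W (iota x) = field_trace x.
Proof.
have /choice[c cE] : forall i : 'I_m, exists c, (vbasis W)`_i = iota c.
  by move=> i; apply/WE; rewrite vbasis_mem // mem_nth // size_tuple.
pose P := \matrix_(i < m, j < m) coord X j (c i).
pose Q := \matrix_(j < m, i < m) coord (vbasis W) i (iota (p ^+ j)).
have crd z i : coord (vbasis W) i (iota z) = \sum_j coord X j z * Q j i.
  rewrite {1}(coord_powE piU compl k_residue k_closed p0 pN pmax dim_model z) !linear_sum.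
  by apply: eq_bigr => j _; rewrite !linearZ !mxE.
have PQ : P *m Q = 1%:M.
  apply/matrixP => i j; rewrite !mxE.
  under eq_bigr do rewrite mxE.
  rewrite -crd -cE (coord_free _ _ (basis_free (vbasisP W))) //.
transitivity (\tr (P *m (mulmat p m x *m Q))); last first.
  by rewrite mxtrace_mulC -mulmxA (mulmx1C PQ) mulmx1.
rewrite /trace_on /mxtrace; apply: eq_bigr => i _; rewrite cE -iotaM crd mulmxA mxE.
apply: eq_bigr => j _; congr (_ * _); rewrite mxE.
rewrite {1}(coord_powE piU compl k_residue k_closed p0 pN pmax dim_model (c i)) mulr_sumr linear_sum.
by apply: eq_bigr => l _; rewrite -scalerAr linearZ /= !mxE.
Qed.

(** The powers of [p] are an O_D-basis of the integral elements of [W]; passing to another integral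
    family multiplies the discriminant by the square of a determinant over O_D. *)
Lemma disc_exp_model d (T : 'M[OD]_m) :
  (forall i j : 'I_m, field_trace (p ^+ i * p ^+ j) = tofrac (T i j)) ->
  has_val pi (\det T) d -> disc_exp W = d.
Proof.
move=> TE Td.
have Op : Oint p by case: pN.
have discE : disc_ideal W = ideal_pow (@max_ideal OD) d.
  rewrite (ideal_powE piU); have [u uU dE] := Td; apply/seteqP; split.
    apply: smallest_sub.
      split; first by exists 0 => //; rewrite mul0r.
        by move=> _ _ [a _ <-] [b _ <-]; exists (a + b); rewrite // mulrDl.
      by move=> a _ _ [b _ <-]; exists (a * b) => //; rewrite -mulrA.
    move=> a [b bW].
    have /choice[c cE] : forall i, exists c, b i = iota c by move=> i; apply/WE; case: (bW i).
    have /choice[A AE] : forall i : 'I_m, exists A : 'I_m -> OD, forall j, coord X j (c i) = tofrac (A j).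
      move=> i; apply: (coord_int piU compl k_residue k_closed p0 pN pmax dim_model).
      by apply/intclosure_iota; rewrite -cE; case: (bW i).
    pose B : 'M[OD]_m := \matrix_(i, j) A i j.
    have BE i : c i = \sum_j tofrac (B i j) *: p ^+ j.
      rewrite (coord_powE piU compl k_residue k_closed p0 pN pmax dim_model (c i)).
      by apply: eq_bigr => j _; rewrite AE mxE.
    rewrite /family_disc (_ : (\matrix_(i, j) _) = map_mx (@tofrac OD) (B *m T *m B^T)).
      rewrite det_map_mx => /eqP; rewrite tofrac_eq => /eqP <-.
      exists (\det B ^+ 2 * u) => //.
      by rewrite !det_mulmx det_tr dE; ring.
    apply/matrixP => i j; rewrite !mxE !cE -iotaM trace_on_iota (BE j) mulr_sumr.
    under eq_bigr do rewrite -scalerAr.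
    rewrite field_trace_sum rmorph_sum; apply: eq_bigr => l _.
    rewrite rmorphM mulrC !mxE; congr (_ * _).
    rewrite BE mulr_suml; under eq_bigr do rewrite -scalerAl.
    rewrite field_trace_sum rmorph_sum; apply: eq_bigr => r _.
    by rewrite rmorphM TE !mxE.
  move=> _ [a _ <-].
  have -> : a * pi ^+ d = (a * u^-1) * \det T by rewrite dE mulrA mulrVK.
  move=> I [[_ _ IZ] sI]; apply: (IZ (a * u^-1)) => //; apply: sI.
  exists (fun i : 'I_m => iota (p ^+ i)).
    by move=> i; split; [apply/WE; exists (p ^+ i) | apply/intclosure_iota/OintX].
  rewrite /family_disc -det_map_mx; congr (\det _); apply/matrixP => i j.
  by rewrite !mxE -iotaM trace_on_iota TE.
rewrite /disc_exp; case: xgetP => [n _|/(_ d)]; last by rewrite discE; case.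
rewrite /= discE => e; rewrite (ideal_powE piU d) (ideal_powE piU n) in e.
have v1 n' : has_val pi (pi ^+ n') n' by exists 1; rewrite ?unitr1 ?mul1r.
apply/eqP; rewrite eqn_leq; apply/andP; split.
  apply: (has_val_dvd piU (v1 d)).
  have : [set c * pi ^+ n | c in setT]%classic (pi ^+ d) by rewrite -e; exists 1; rewrite ?mul1r.
  by case=> c _ <-; exists c.
apply: (has_val_dvd piU (v1 n)).
have : [set c * pi ^+ d | c in setT]%classic (pi ^+ n) by rewrite e; exists 1; rewrite ?mul1r.
by case=> c _ <-; exists c.
Qed.

End Model.

(** * Torsors and Galois descent *)

Section TypeAction.
Variables (gT : finGroupType) (T : Type) (act : {action gT &-> T}).

Lemma type_actM x a b : act x (a * b)%g = act (act x a) b.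
Proof. by case: act => f [_ h] /=; apply: h; rewrite inE. Qed.

Lemma type_act1 x : act x 1%g = x.
Proof.
by case: act => f [i h] /=; apply: (i 1%g); rewrite -h ?inE // mulg1.
Qed.

Lemma type_actK g x : act (act x g) g^-1%g = x.
Proof. by rewrite -type_actM mulgV type_act1. Qed.

Lemma type_actKV g x : act (act x g^-1%g) g = x.
Proof. by rewrite -type_actM mulVg type_act1. Qed.

End TypeAction.

Section Torsor.
Variable OD : idomainType.
Local Notation K := {fraction OD}.
Variables (M : falgType K) (gT : finGroupType) (act : {action gT &-> M}).
Hypothesis E_cover : is_Gcover act.

Lemma cover_mulC : commutative (@GRing.mul M). Proof. by case: E_cover. Qed.

Lemma act_lin g a x y : act (a *: x + y) g = a *: act x g + act y g.
Proof. by case: E_cover => _ /(_ g)h _ _; exact: h. Qed.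

Lemma act_mul g x y : act (x * y) g = act x g * act y g.
Proof. by case: E_cover => _ _ /(_ g)[_ h] _; exact: h. Qed.

Lemma act_one g : act 1 g = 1.
Proof. by case: E_cover => _ _ /(_ g)[h _] _; exact: h. Qed.

Lemma act_zero g : act 0 g = 0.
Proof. by have := act_lin g (-1) 0 0; rewrite addr0 scaler0 scaleN1r addNr. Qed.

Lemma act_add g x y : act (x + y) g = act x g + act y g.
Proof. by have := act_lin g 1 x y; rewrite !scale1r. Qed.

Lemma act_scale g a x : act (a *: x) g = a *: act x g.
Proof. by have := act_lin g a x 0; rewrite !addr0 act_zero addr0. Qed.

Lemma act_sum g (I : Type) (r : seq I) (P : pred I) (F : I -> M) :
  act (\sum_(i <- r | P i) F i) g = \sum_(i <- r | P i) act (F i) g.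
Proof. by apply: (big_morph (fun x => act x g)); [exact: act_add | exact: act_zero]. Qed.

(** The preimage under [torsor_map] of the indicator function of the identity; recovering elements
    from their traces relies on it. *)
Lemma galois_coords : exists c : 'I_(\dim {:M}) -> M, forall g,
  \sum_i c i * act (vbasis {:M})`_i g = (g == 1%g)%:R.
Proof.
have [_ _ _ [inv _ torsK]] := E_cover.
exists (inv [ffun g => (g == 1%g)%:R]) => g.
by have /ffunP/(_ g) := torsK [ffun g => (g == 1%g)%:R]; rewrite !ffunE.
Qed.

(** The elements 1 (x) x and x (x) 1 both map to the constant family x, so they agree by injectivity
    of [torsor_map]; a coordinate at which 1 is nonzero then shows that [x] is a scalar. *)
Lemma fixed_scalar x : (forall g, act x g = x) -> exists a : K, x = a%:A.
Proof.
move=> xG; have [_ _ _ /bij_inj tors_inj] := E_cover.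
pose cf y i := coord (vbasis {:M}) i y.
have cfE y : y = \sum_i cf y i *: (vbasis {:M})`_i by exact: coord_vbasis (memvf y).
have tE : torsor_map act [ffun i => (cf x i)%:A] = torsor_map act [ffun i => cf 1 i *: x].
  apply/ffunP => g; rewrite !ffunE.
  transitivity x.
    rewrite -[RHS](xG g) [in RHS](cfE x) act_sum; apply: eq_bigr => i _.
    by rewrite ffunE act_scale -scalerAl mul1r.
  rewrite -[LHS]mulr1 -[in LHS](act_one g) [in LHS](cfE 1) act_sum mulr_sumr; apply: eq_bigr => i _.
  by rewrite ffunE act_scale -scalerAr -scalerAl.
have e i : (cf x i)%:A = cf 1 i *: x.
  by have /ffunP/(_ i) := tors_inj _ _ tE; rewrite !ffunE.
have [i ci] : exists i, cf 1 i != 0.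
  apply: contrapT => h; have /eqP := oner_neq0 M; apply.
  rewrite (cfE 1) big1 // => i _; suff -> : cf 1 i = 0 by rewrite scale0r.
  by apply/eqP/negPn/negP => ci; apply: h; exists i.
by exists ((cf 1 i)^-1 * cf x i); rewrite -scalerA e scalerA mulVf // scale1r.
Qed.

Definition torsor_trace y := \sum_g act y g.

Lemma torsor_trace_scalar y : exists a : K, torsor_trace y = a%:A.
Proof.
apply: fixed_scalar => g; rewrite /torsor_trace act_sum.
rewrite [RHS](reindex_inj (mulIg g)) /=; apply: eq_bigr => h _.
by rewrite type_actM.
Qed.

(** [galois_coords] writes [x] as a combination of the traces of b_i x, with (b_i) the basis of [M];
    one of these scalars is nonzero and can be normalized. *)
Lemma torsor_trace_neq0 x : x != 0 -> exists b, torsor_trace (b * x) = 1.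
Proof.
move=> x0; have [c cE] := galois_coords.
have xE : x = \sum_i c i * torsor_trace ((vbasis {:M})`_i * x).
  under eq_bigr do rewrite /torsor_trace mulr_sumr; rewrite exchange_big /=.
  under eq_bigr => g _.
    under eq_bigr do rewrite act_mul mulrA.
    rewrite -mulr_suml cE; over.
  rewrite (bigD1 1%g) //= eqxx mul1r type_act1 big1 ?addr0 // => g /negPf ->.
  by rewrite mul0r.
have [i ti] : exists i, torsor_trace ((vbasis {:M})`_i * x) != 0.
  apply: contrapT => h; move/eqP: x0; apply; rewrite xE big1 // => i _.
  suff -> : torsor_trace ((vbasis {:M})`_i * x) = 0 by rewrite mulr0.
  by apply/eqP/negPn/negP => ti; apply: h; exists i.
have [a aE] := torsor_trace_scalar ((vbasis {:M})`_i * x).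
have a0 : a != 0 by apply: contra_neq ti => a0; rewrite aE a0 scale0r.
exists (a^-1 *: (vbasis {:M})`_i).
rewrite -scalerAl /torsor_trace; under eq_bigr do rewrite act_scale.
by rewrite -scaler_sumr -/(torsor_trace _) aE scalerA mulVf // scale1r.
Qed.

Lemma expr_add_sqz (s t : M) n : s * s = 0 ->
  (s + t) ^+ n.+1 = t ^+ n.+1 + (t ^+ n * s) *+ n.+1.
Proof.
move=> s2; elim: n => [|n IH]; first by rewrite !expr1 expr0 mul1r addrC.
rewrite exprS IH mulrDl !mulrDr -!mulrnAr.
have e1 : s * (t ^+ n * (s *+ n.+1)) = 0.
  by rewrite [s * _]cover_mulC -mulrA mulrnAl s2 mul0rn mulr0.
rewrite e1 addr0 addrC -addrA -exprS; congr (_ + _).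
by rewrite mulrA -exprS [s * _]cover_mulC !mulrnAr [RHS]mulrS addrC.
Qed.

Lemma sum_sqz_nilp (I : Type) (r : seq I) (F : I -> M) :
  (forall i, F i * F i = 0) -> exists n, (\sum_(i <- r) F i) ^+ n.+1 = 0.
Proof.
move=> F2; elim: r => [|i r [n IH]]; first by exists 0%N; rewrite big_nil expr1.
by exists n.+1; rewrite big_cons expr_add_sqz // exprS IH mulr0 mul0r mul0rn addr0.
Qed.

(* If x is nilpotent, so are all the traces of its multiples, but one of these is 1
   when x is nonzero. *)
Lemma cover_reduced (x : M) n : x ^+ n = 0 -> x = 0.
Proof.
suff sq (y : M) : y * y = 0 -> y = 0.
  elim/ltn_ind: n => -[_|n IH] xn.
    by apply/eqP; move/eqP: xn; rewrite expr0 oner_eq0.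
  case: n => [|n] in IH xn; first by rewrite expr1 in xn.
  apply: (IH n.+1) => //; apply: sq.
  by rewrite -exprD addSn -addnS exprD xn mulr0.
move=> y2; apply/eqP/negPn/negP => /torsor_trace_neq0 [b tb].
have [|N] := @sum_sqz_nilp _ (index_enum gT) (fun g => act (b * y) g).
  move=> g; rewrite -act_mul mulrA [b * y * b]cover_mulC mulrA -mulrA y2 mulr0.
  exact: act_zero.
by rewrite -/(torsor_trace _) tb expr1n => /eqP; rewrite oner_eq0.
Qed.

Variable e : M.
Hypothesis F_comp : is_component e.
Local Notation H := (comp_stab act e).

Lemma comp_idem : e * e = e. Proof. by case: F_comp. Qed.
Lemma comp_neq0 : e != 0. Proof. by case: F_comp. Qed.
Lemma comp_prim e' : e' * e' = e' -> e' * e = e' -> e' = 0 \/ e' = e.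
Proof. by case: F_comp => _ _; apply. Qed.

Lemma stabP h : reflect (act e h = e) (h \in H).
Proof. by rewrite inE; exact: eqP. Qed.

(** The product is an idempotent below the primitive [e], so it is 0 or [e]. In the latter case g^-1
    sends [e] to a nonzero idempotent below [e], hence to [e]. *)
Lemma comp_orth g : g \notin H -> e * act e g = 0.
Proof.
move=> gH.
have [||//|eg] := @comp_prim (e * act e g).
- by rewrite mulrA [e * _ * e]cover_mulC mulrA comp_idem -mulrA -act_mul comp_idem.
- by rewrite cover_mulC mulrA comp_idem.
have eg' : act e g^-1%g * e = act e g^-1%g.
  by rewrite -[in RHS]eg act_mul type_actK.
have [|//|e0|e0] := @comp_prim (act e g^-1%g).
- by rewrite -act_mul comp_idem.
- by move: comp_neq0; rewrite -(type_actKV act g e) e0 act_zero eqxx.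
by case/stabP: gH; rewrite -{1}e0 type_actKV.
Qed.

Lemma comp_orth_act g x : x * e = x -> g \notin H -> e * act x g = 0.
Proof. by move=> <- gH; rewrite act_mul [act x g * _]cover_mulC mulrA comp_orth ?mul0r. Qed.

(* x^j = x^(j+1) * s for some j, so that (x * s)^(j+1) is an idempotent. *)
Lemma comp_inv x : x * e = x -> x != 0 -> exists2 y, y * e = y & x * y = e.
Proof.
move=> xe x0.
have [j [s js]] : exists j s, x ^+ j = x ^+ j.+1 * s.
  pose X := [tuple x ^+ i | i < (\dim {:M}).+1].
  have XE (i : 'I_(\dim {:M}).+1) : X`_i = x ^+ i by rewrite -tnth_nth tnth_mktuple.
  have nf : ~ free X.
    rewrite /free size_tuple => /eqP eq.
    by have := dimvS (subvf <<X>>%VS); rewrite eq ltnn.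
  have [c [cX [i0 ci0]]] : exists c : 'I_(\dim {:M}).+1 -> K,
      \sum_i c i *: X`_i = 0 /\ exists i, c i != 0.
    apply: contrapT => h; apply: nf; apply/freeP => c cX i.
    by apply/eqP/negPn/negP => ci; apply: h; exists c; split=> //; exists i.
  pose j := [arg min_(i < i0 | c i != 0) (i : nat)].
  have [cj jmin] : c j != 0 /\ forall i, c i != 0 -> (j <= i)%N.
    by rewrite /j; case: arg_minnP.
  exists j, (- ((c j)^-1 *: \sum_(i | i != j) c i *: x ^+ (i - j.+1))).
  apply: (scalerI cj); apply/eqP; rewrite mulrN scalerN -addr_eq0 -scalerAr.
  rewrite scalerA mulfV // scale1r; apply/eqP; rewrite -[RHS]cX [in RHS](bigD1 j) //= XE.
  congr (_ + _).
  rewrite mulr_sumr; apply: eq_bigr => i ij; rewrite XE -scalerAr.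
  have [->|ci] := eqVneq (c i) 0; first by rewrite !scale0r.
  rewrite -exprD subnKC // ltn_neqAle jmin // andbT eq_sym.
  by apply: contra ij => /eqP h; apply/eqP/val_inj.
have jn n : x ^+ j.+1 = x ^+ j.+1 * (x ^+ n * s ^+ n).
  elim: n => [|n IH]; first by rewrite !mulr1.
  have h : x ^+ j.+1 = x ^+ j.+1 * x * s by rewrite -exprSr exprS js [in RHS]exprS !mulrA.
  rewrite [LHS]IH {1}h -!mulrA; congr (_ * _); rewrite [in RHS]exprS -!mulrA; congr (_ * _).
  by rewrite mulrA [s * _]cover_mulC -mulrA -exprS.
pose eps := x ^+ j.+1 * s ^+ j.+1.
have ee : eps * eps = eps by rewrite /eps mulrA -(mulrA (x ^+ _)) [s ^+ _ * _]cover_mulC -jn.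
have ie : eps * e = eps.
  by rewrite /eps -mulrA [_ * e]cover_mulC mulrA exprSr -(mulrA _ x) xe.
have [e0|e1] := comp_prim ee ie.
  have : x ^+ j.+1 = 0 by rewrite (jn j.+1) -/eps e0 mulr0.
  by move/cover_reduced => x00; rewrite x00 eqxx in x0.
exists (x ^+ j * s ^+ j.+1 * e); first by rewrite -mulrA comp_idem.
by rewrite mulrA mulrA -exprS -/eps ie.
Qed.

Lemma mem_KC (A : {set gT}) x : reflect (x * e = x /\ forall h, h \in A -> act x h = x) (x \in KC act e A).
Proof.
have lin h : linear (act^~ h) by move=> a u v; exact: act_lin.
have lfE h u : linfun (act^~ h) u = act u h.
  pose F := GRing.isLinear.Build K M M _ (act^~ h) (lin h).
  pose f : {linear M -> M} := HB.pack (act^~ h) F.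
  by rewrite -[act^~ h]/(f : M -> M) lfunE.
apply: (iffP idP) => [|[xe xA]].
  rewrite memv_cap => /andP[xe /subv_bigcapP xA]; split.
    have sub : (<[e]> * {:M} <= {:M} * <[e]>)%VS.
      by apply/prodvP => u v ue _; rewrite cover_mulC memv_mul ?memvf.
    by have /memv_cosetP[u _ ->] := subvP sub _ xe; rewrite -mulrA comp_idem.
  move=> h hA; have := xA h hA; rewrite -memvE => /fixedSpaceP.
  by rewrite lfE.
rewrite memv_cap; apply/andP; split.
  by rewrite -xe cover_mulC memv_mul ?memv_line ?memvf.
by rewrite memvE; apply/subv_bigcapP => h hA; rewrite -memvE; apply/fixedSpaceP; rewrite lfE xA.
Qed.

End Torsor.

(** * Conjugates of a fixed field along an orbit *)

Section Galois.
Variables (K : fieldType) (L : fieldExtType K) (gT : finGroupType) (H : {group gT}).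
Variable rho : L -> gT -> L.
Hypothesis rho_lin : forall h, h \in H -> forall a x y,
  rho (a *: x + y) h = a *: rho x h + rho y h.
Hypothesis rho_mul : forall h, h \in H -> forall x y, rho (x * y) h = rho x h * rho y h.
Hypothesis rhoM : forall g h, g \in H -> h \in H -> forall x,
  rho x (g * h)%g = rho (rho x g) h.
Hypothesis rho1 : forall x, rho x 1%g = x.
Variables (N : nat) (cc bb : 'I_N -> L).
Hypothesis rho_coords : forall h, h \in H ->
  \sum_i cc i * rho (bb i) h = (h == 1%g)%:R.
Hypothesis rho_fixed : forall x, (forall h, h \in H -> rho x h = x) -> exists a : K, x = a%:A.

Lemma rho0 h : h \in H -> rho 0 h = 0.
Proof. by move=> hH; have := rho_lin hH (-1) 0 0; rewrite addr0 scaler0 scaleN1r addNr. Qed.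

Lemma rhoD h : h \in H -> {morph rho^~ h : x y / x + y}.
Proof. by move=> hH x y; have := rho_lin hH 1 x y; rewrite !scale1r. Qed.

Lemma rhoZ h : h \in H -> forall a x, rho (a *: x) h = a *: rho x h.
Proof. by move=> hH a x; have := rho_lin hH a x 0; rewrite rho0 // !addr0. Qed.

Lemma rho_sum h (I : Type) (r : seq I) (P : pred I) (F : I -> L) : h \in H ->
  rho (\sum_(i <- r | P i) F i) h = \sum_(i <- r | P i) rho (F i) h.
Proof. by move=> hH; apply: (big_morph (fun x => rho x h)); [exact: rhoD | exact: rho0]. Qed.

Definition galois_trace x := \sum_(h in H) rho x h.

Lemma galois_trace_scalar x : exists a : K, galois_trace x = a%:A.
Proof.
apply: rho_fixed => g gH; rewrite /galois_trace rho_sum //.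
rewrite [RHS](reindex_inj (mulIg g)) /=.
by apply: eq_big => [h|h hH]; rewrite ?groupMr // rhoM.
Qed.

Lemma galois_trace_coords x : x = \sum_i cc i * galois_trace (bb i * x).
Proof.
under eq_bigr do rewrite /galois_trace mulr_sumr; rewrite exchange_big /=.
under eq_bigr => h hH.
  under eq_bigr do rewrite rho_mul // mulrA.
  rewrite -mulr_suml rho_coords //; over.
rewrite (bigD1 1%g) //= eqxx mul1r rho1 big1 ?addr0 // => g /andP[_ /negPf ->].
by rewrite mul0r.
Qed.

Variables (T : finType) (to : {action gT &-> T}) (x0 : T).
Local Notation O := (orbit to H x0).
Variable sg : T -> gT.
Hypothesis sgP : forall o, o \in O -> sg o \in H /\ to x0 (sg o) = o.
Variables (C : fieldExtType K) (kap : {linear C -> L}).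
Hypothesis kap_inj : injective kap.
Hypothesis kapM : {morph kap : x y / x * y}.
Hypothesis kapP : forall y,
  (forall h, h \in 'C_H[x0 | to]%g -> rho y h = y) <-> exists d, y = kap d.
Variables (m : nat) (X : m.-tuple C).
Hypothesis pow_tuple_basis : basis_of {:C} X.

Lemma kap_stab d h : h \in H -> to x0 h = x0 -> rho (kap d) h = kap d.
Proof.
move=> hH xh; apply: (kapP (kap d)).2; first by exists d.
by rewrite inE hH; apply/astab1P.
Qed.

(** The orbit stands for the cosets of the stabilizer of [x0], hence for the embeddings of [C] into
    [L]; [sg] chooses representatives. *)
Definition conj_mx : 'M[L]_(m, #|O|) :=
  \matrix_(i, c) rho (kap X`_i) (sg (enum_val c)).

(** Artin's argument. A relation [v] between the rows gives sum_i h(v_i) X_i = 0 for every h.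
    Multiplying by h(z) and summing over h turns the coefficients into the traces of z v_i, which
    are scalars and so vanish; [galois_trace_coords] recovers v_i from such traces. *)
Lemma conj_mx_free : row_free conj_mx.
Proof.
apply: inj_row_free => v vB.
have vh h : h \in H -> \sum_i rho (v 0 i) h * kap X`_i = 0.
  move=> hH; have oO : to x0 h^-1%g \in O by apply: mem_orbit; rewrite groupV.
  have [sH so] := sgP oO.
  have := congr1 (fun w : 'rV[L]_#|O| => rho (w 0 (enum_rank_in oO (to x0 h^-1%g))) h) vB.
  rewrite !mxE rho0 // rho_sum // => e; rewrite -[RHS]e; apply: eq_bigr => i _.
  rewrite rho_mul // !mxE enum_rankK_in // -rhoM // kap_stab ?groupM //.
  by rewrite actM so actKV.
have vz z i : galois_trace (z * v 0 i) = 0.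
  have /choice[t tP] := fun i => galois_trace_scalar (z * v 0 i).
  suff t0 : forall j, t j = 0 by rewrite tP t0 scale0r.
  have /freeP X_free := basis_free pow_tuple_basis.
  apply: X_free; apply: kap_inj.
  rewrite linear0 linear_sum.
  transitivity (\sum_(h in H) rho z h * \sum_i rho (v 0 i) h * kap X`_i).
    under [RHS]eq_bigr do rewrite mulr_sumr; rewrite exchange_big /=.
    apply: eq_bigr => l _; rewrite linearZ /= -[kap X`_l in LHS]mul1r scalerAl -tP /galois_trace mulr_suml.
    by apply: eq_bigr => h hH; rewrite mulrA rho_mul.
  by rewrite big1 // => h hH; rewrite vh // mulr0.
apply/rowP => i; rewrite mxE [LHS]galois_trace_coords big1 // => l _.
by rewrite vz mulr0.
Qed.

(* Any w is the combination with coefficients cc of the equivariant vectors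
   obtained by averaging bb_l * w over H. *)
Lemma conj_mx_full : row_full conj_mx.
Proof.
have span (w : T -> L) : exists u : 'rV_m, \row_(c < #|O|) w (enum_val c) = u *m conj_mx.
  pose tr l o := \sum_(h in H) rho (bb l * w (to o h^-1%g)) h.
  have trE l o g : g \in H -> tr l (to o g) = rho (tr l o) g.
    move=> gH; rewrite /tr rho_sum // [LHS](reindex_inj (mulIg g)) /=.
    apply: eq_big => [h|h hH]; first by rewrite groupMr.
    rewrite groupMr // in hH.
    by rewrite invMg actM actK rhoM.
  have /choice[d dE] : forall l, exists d, tr l x0 = kap d.
    move=> l; apply/kapP => h; rewrite inE => /andP[hH /astab1P xh].
    by rewrite -trE // xh.
  exists (\sum_l cc l *: \row_i (coord X i (d l))%:A).
  apply/rowP => c; rewrite mxE mulmx_suml summxE.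
  have oO : enum_val c \in O by exact: enum_valP.
  have [sH so] := sgP oO.
  transitivity (\sum_l cc l * tr l (enum_val c)).
    rewrite /tr; under [RHS]eq_bigr do rewrite mulr_sumr; rewrite exchange_big /=.
    under [RHS]eq_bigr => h hH.
      under eq_bigr do rewrite rho_mul // mulrA.
      rewrite -mulr_suml rho_coords //; over.
    rewrite (bigD1 1%g) //= eqxx mul1r rho1 invg1 act1 big1 ?addr0 // => g /andP[_ /negPf ->].
    by rewrite mul0r.
  apply: eq_bigr => l _; rewrite -scalemxAl mxE; congr (_ * _).
  rewrite -{1}so trE // dE mxE {1}(coord_basis pow_tuple_basis (memvf (d l))).
  rewrite linear_sum rho_sum //; apply: eq_bigr => i _.
  by rewrite linearZ /= rhoZ // !mxE -scalerAl mul1r.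
apply/row_fullP.
have /choice[u uP] : forall c : 'I_#|O|, exists u : 'rV_m, row c 1%:M = u *m conj_mx.
  move=> c; have [u uE] := span (fun o => (o == enum_val c)%:R).
  exists u; rewrite -uE; apply/rowP => c'; rewrite !mxE.
  by rewrite (inj_eq enum_val_inj) eq_sym.
exists (\matrix_c u c); apply/row_matrixP => c.
by rewrite row_mul rowK uP.
Qed.

Lemma orbit_degree : m = #|O|.
Proof. by rewrite -(eqP conj_mx_free) (eqP conj_mx_full). Qed.

(** The invertible matrix of conjugates diagonalizes multiplication by [x], with the conjugates of
    [x] as eigenvalues. *)
Lemma conj_trace (Y : 'M[K]_m) x : (forall i : 'I_m, x * X`_i = \sum_j Y i j *: X`_j) ->
  (\tr Y)%:A = \sum_(o in O) rho (kap x) (sg o) :> L.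
Proof.
move=> YE; pose Z := map_mx (GRing.in_alg L) Y.
pose D : 'M[L]_#|O| := diag_mx (\row_c rho (kap x) (sg (enum_val c))).
have ZB : Z *m conj_mx = conj_mx *m D.
  apply/matrixP => i c; rewrite mul_mx_diag !mxE.
  have [sH _] := sgP (enum_valP c).
  rewrite mulrC -rho_mul // -kapM YE linear_sum rho_sum //; apply: eq_bigr => j _.
  by rewrite linearZ /= rhoZ // !mxE -scalerAl mul1r.
have /row_freeP[V BV] := conj_mx_free.
have VB : V *m conj_mx = 1%:M.
  have /row_fullP[U UB] := conj_mx_full.
  by rewrite -[V]mul1mx -UB -(mulmxA U) BV mulmx1.
transitivity (\tr Z).
  by rewrite /mxtrace -[LHS]/(GRing.in_alg L _) rmorph_sum; apply: eq_bigr => i _; rewrite mxE.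
rewrite -[Z]mulmx1 -BV mulmxA ZB -mulmxA mxtrace_mulC -mulmxA VB mulmx1.
rewrite mxtrace_diag [RHS]big_enum_val; apply: eq_bigr => c _; by rewrite mxE.
Qed.

End Galois.

(** * The stabilizer acting on the field of the component, and the covers C_j *)

Section KCModel.
Variable OD : idomainType.
Local Notation K := {fraction OD}.
Variables (M : falgType K) (gT : finGroupType) (act : {action gT &-> M}).
Hypothesis E_cover : is_Gcover act.
Variable e : M.
Hypothesis F_comp : is_component e.
Local Notation H := (comp_stab act e).

Lemma KC_model (A : {set gT}) : (forall h, h \in A -> h \in H) ->
  exists (C : fieldExtType K) (i : {linear C -> M}),
    [/\ injective i, i 1 = e, {morph i : x y / x * y} &
        forall x, x \in KC act e A <-> exists c, x = i c].
Proof.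
move=> AH; apply: field_model.
- exact: cover_mulC E_cover.
- apply/(mem_KC E_cover F_comp); split; first exact: comp_idem F_comp.
  by move=> h /AH /stabP.
- exact: comp_neq0 F_comp.
- by move=> x /(mem_KC E_cover F_comp)[].
- move=> x y /(mem_KC E_cover F_comp)[xe xA] /(mem_KC E_cover F_comp)[ye yA].
  apply/(mem_KC E_cover F_comp); split; first by rewrite -mulrA ye.
  by move=> h hA; rewrite (act_mul E_cover) xA // yA.
move=> x /(mem_KC E_cover F_comp)[xe xA] x0.
have [y ye xy] := comp_inv E_cover F_comp xe x0; exists y => //.
apply/(mem_KC E_cover F_comp); split=> // h hA.
have eh : act e h = e by apply/stabP/AH.
have ye' : act y h * e = act y h by rewrite -{1}eh -(act_mul E_cover) ye.
have xy' : x * act y h = e by rewrite -{1}(xA h hA) -(act_mul E_cover) xy eh.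
by rewrite -ye' -xy mulrA (cover_mulC E_cover (act y h)) xy' (cover_mulC E_cover e) ye.
Qed.

Lemma intclosure_act x h : intclosure x -> intclosure (act x h).
Proof.
case=> q q1 /rootP qx; exists q => //; apply/rootP.
have actX n : act (x ^+ n) h = act x h ^+ n.
  by elim: n => [|n IH]; rewrite ?(act_one E_cover) // !exprS (act_mul E_cover) IH.
transitivity (act (map_poly (fun a : OD => (tofrac a)%:A : M) q).[x] h).
  rewrite !horner_poly (act_sum E_cover); apply: eq_bigr => i _.
  by rewrite (act_mul E_cover) actX (act_scale E_cover) (act_one E_cover).
by rewrite qx (act_zero E_cover).
Qed.

Variables (L : fieldExtType K) (iota : {linear L -> M}) (pr : M -> L).
Hypothesis iota_inj : injective iota.
Hypothesis iota1 : iota 1 = e.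
Hypothesis iotaM : {morph iota : x y / x * y}.
Hypothesis prE : forall x, iota (pr x) = x * e.
Local Notation inc := (@inc OD L).

Lemma iota_e y : iota y * e = iota y.
Proof. by rewrite -iota1 -iotaM mulr1. Qed.

Lemma comp_projK y : pr (iota y) = y.
Proof. by apply: iota_inj; rewrite prE iota_e. Qed.

Lemma comp_proj_linear : linear pr.
Proof. by move=> a x y; apply: iota_inj; rewrite linearP /= !prE mulrDl scalerAl. Qed.

Lemma comp_proj_mul x y : pr (x * y) = pr x * pr y.
Proof.
apply: iota_inj; rewrite iotaM !prE -mulrA -[RHS]mulrA; congr (_ * _).
by rewrite (cover_mulC E_cover e) -mulrA (comp_idem F_comp).
Qed.

(** Defined for every h, but an action by field automorphisms only on the stabilizer, where [act]
    preserves the image of [iota]. *)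
Definition rho y h := pr (act (iota y) h).

Lemma iota_rho y h : h \in H -> iota (rho y h) = act (iota y) h.
Proof.
by move=> /stabP hH; rewrite prE -[X in _ * X]hH -(act_mul E_cover) iota_e.
Qed.

Lemma rho_linear h : h \in H -> forall a x y, rho (a *: x + y) h = a *: rho x h + rho y h.
Proof.
move=> hH a x y; apply: iota_inj.
by rewrite linearP /= !iota_rho // linearP /= (act_lin E_cover).
Qed.

Lemma rho_morph h : h \in H -> forall x y, rho (x * y) h = rho x h * rho y h.
Proof.
by move=> hH x y; apply: iota_inj; rewrite iotaM !iota_rho // iotaM (act_mul E_cover).
Qed.

Lemma rho_1 x : rho x 1%g = x.
Proof. by rewrite /rho type_act1 comp_projK. Qed.

Variable Hg : {group gT}.
Hypothesis HgE : Hg = H :> {set gT}.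

Lemma mem_stab h : h \in Hg -> h \in H. Proof. by rewrite HgE. Qed.

Lemma rho_comp g h : g \in Hg -> h \in Hg -> forall x, rho x (g * h)%g = rho (rho x g) h.
Proof.
move=> gH hH x; apply: iota_inj.
by rewrite !iota_rho ?mem_stab ?groupM // type_actM.
Qed.

Lemma rho_coords_ex : exists N, exists cb : ('I_N -> L) * ('I_N -> L), forall h, h \in Hg ->
  \sum_i cb.1 i * rho (cb.2 i) h = (h == 1%g)%:R.
Proof.
have [c cE] := galois_coords E_cover.
exists (\dim {:M}), (fun i => pr (c i), fun i : 'I_(\dim {:M}) => pr (vbasis {:M})`_i) => h /mem_stab hH /=.
apply: iota_inj; rewrite linear_sum.
transitivity ((\sum_i c i * act (vbasis {:M})`_i h) * e).
  rewrite mulr_suml; apply: eq_bigr => i _; rewrite iotaM iota_rho // !prE.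
  have eh : act e h = e by apply/stabP.
  rewrite (act_mul E_cover) eh.
  rewrite mulrA -(mulrA (c i)) (cover_mulC E_cover e) mulrA.
  by rewrite -[_ * e * e]mulrA (comp_idem F_comp).
rewrite cE; case: eqP => _; first by rewrite mul1r iota1.
by rewrite mul0r linear0.
Qed.

(** For z in the factor at [e] with trace 1 over the whole group, [x] is the component at [e] of the
    trace of x z: terms outside the stabilizer vanish there by orthogonality, and [x] factors out of
    the others. That trace is a scalar. *)
Lemma rho_fixed_scalar x : (forall h, h \in Hg -> rho x h = x) -> exists a : K, x = a%:A.
Proof.
move=> xH.
have [b tb] := torsor_trace_neq0 E_cover (comp_neq0 F_comp).
pose z := b * e; have ze : z * e = z by rewrite /z -mulrA (comp_idem F_comp).
have [a aE] := torsor_trace_scalar E_cover (iota x * z).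
have eH w : w * e = w -> e * torsor_trace act w = \sum_(h in H) act w h.
  move=> we; rewrite /torsor_trace mulr_sumr (bigID (mem H)) /= [X in _ + X]big1 ?addr0.
    apply: eq_bigr => h /stabP hH.
    by rewrite (cover_mulC E_cover e) -{1}hH -(act_mul E_cover) we.
  by move=> h hH; apply: (comp_orth_act E_cover F_comp).
exists a; apply: iota_inj; rewrite linearZ /= iota1.
transitivity (e * torsor_trace act (iota x * z)).
  rewrite eH; last by rewrite -mulrA ze.
  transitivity (iota x * (e * torsor_trace act z)).
    by rewrite [torsor_trace act z]tb mulr1 iota_e.
  rewrite eH // mulr_sumr; apply: eq_bigr => h hH.
  by rewrite (act_mul E_cover) -iota_rho // xH // HgE.
by rewrite aE -scalerAr mulr1.
Qed.

Lemma rho_int y h : h \in Hg -> Oint y -> Oint (rho y h).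
Proof.
move=> /mem_stab hH Oy; apply/(intclosure_iota iota_inj iotaM); rewrite iota_rho //.
exact/intclosure_act/(intclosure_iota iota_inj iotaM).
Qed.

(** [orbit_degree] for the regular action: the stabilizer of 1 is trivial, so the fixed field is
    [L], and the orbit is the whole group. *)
Lemma rho_dim : \dim {:L} = #|Hg|.
Proof.
have [N [cb cbE]] := rho_coords_ex.
have sgP o : o \in orbit 'R Hg 1%g -> id o \in Hg /\ 'R%act 1%g o = o.
  case/orbitP => h hH <-; split; last by rewrite /= !mul1g.
  by rewrite /= mul1g.
rewrite (orbit_degree (fun h hH => rho_linear (mem_stab hH)) (fun h hH => rho_morph (mem_stab hH))
  rho_comp rho_1 cbE rho_fixed_scalar sgP (kap := idfun) _ _ (vbasisP {:L})) //.
  apply: eq_card => h; apply/orbitP/idP => [[g gH <-]|hH]; first by rewrite /= mul1g.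
  by exists h; rewrite //= mul1g.
move=> y; split; first by exists y.
move=> _ h; rewrite inE => /andP[_ /astab1P /=]; rewrite mul1g => ->.
exact: rho_1.
Qed.

Variable pi : OD.
Hypothesis piU : uniformizer pi.
Hypothesis compl : m_adic_complete OD.
Variables (k : fieldType) (res : {rmorphism OD -> k}).
Hypothesis k_residue : is_residue_field res.
Hypothesis k_closed : GRing.closed_field_axiom k.

Variables (T : finType) (to : {action gT &-> T}) (x0 : T).
Local Notation O := (orbit to Hg x0).
Variable sg : T -> gT.
Hypothesis sgP : forall o, o \in O -> sg o \in Hg /\ to x0 (sg o) = o.
Local Notation A := 'C_Hg[x0 | to]%g.
Local Notation W := (KC act e A).
Local Notation d := (disc_exp W).
Local Notation m := (\dim W).

(** Everything used later about C_j is stated inside [L]: the field model of C_j is embedded by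
    [kap], and [p] is the image of its uniformizer. Sums over the orbit are traces by
    [conj_trace]. *)
Lemma orbit_invariants :
  m = #|O| /\ exists p : L, [/\ Oint p, forall h, h \in A -> rho p h = p,
    forall y, Oint y -> (forall h, h \in A -> rho y h = y) ->
      exists a : 'I_m -> OD, y = \sum_i inc (a i) * p ^+ i,
    exists2 D : 'M[OD]_m, has_val pi (\det D) d &
      forall i j : 'I_m, inc (D i j) = \sum_(o in O) rho (p ^+ i * p ^+ j) (sg o) &
    (forall y, Oint y -> (forall h, h \in A -> rho y h = y) ->
       exists a, \sum_(o in O) rho y (sg o) = inc (a * pi ^+ (d %/ m))) /\
    exists (i : 'I_m) a, \sum_(o in O) rho (p ^+ i) (sg o) = inc a /\ has_val pi a (d %/ m)].
Proof.
have AH h : h \in A -> h \in Hg by rewrite inE => /andP[].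
have [C [iC [iC_inj iC1 iCM iCP]]] := KC_model (fun h hA => mem_stab (AH h hA)).
have iCe c : iC c * e = iC c by rewrite -iC1 -iCM mulr1.
have [kap kapE] : exists kap : {linear C -> L}, forall c, iota (kap c) = iC c.
  have kap_lin : linear (pr \o iC) by move=> a x y; rewrite /= linearP /= comp_proj_linear.
  pose kap : {linear C -> L} := HB.pack (pr \o iC) (GRing.isLinear.Build K C L _ (pr \o iC) kap_lin).
  exists kap => c.
  by rewrite [LHS]prE iCe.
have kap_inj : injective kap.
  by move=> x y /(congr1 iota); rewrite !kapE => /iC_inj.
have kapM : {morph kap : x y / x * y}.
  by move=> x y; apply: iota_inj; rewrite iotaM !kapE iCM.
have kap_int c : Oint (kap c) <-> Oint c.
  rewrite -(intclosure_iota iota_inj iotaM) kapE.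
  exact: (intclosure_iota iC_inj iCM).
have kapP y : (forall h, h \in A -> rho y h = y) <-> exists c, y = kap c.
  split=> [yA|[c ->] h hA].
    have : iota y \in W.
      apply/(mem_KC E_cover F_comp); split; first exact: iota_e.
      by move=> h hA; rewrite -iota_rho ?mem_stab ?AH // yA.
    by move=> /iCP[c cE]; exists c; apply: iota_inj; rewrite kapE.
  apply: iota_inj; rewrite iota_rho ?mem_stab ?AH // kapE.
  have : iC c \in W by apply/iCP; exists c.
  by case/(mem_KC E_cover F_comp) => _ /(_ h hA).
have kap1 : kap 1 = 1 by apply: iota_inj; rewrite kapE iC1 iota1.
have kapX c n : kap (c ^+ n) = kap c ^+ n.
  by elim: n => [|n IH]; rewrite ?kap1 // !exprS kapM IH.
have [N [cb cbE]] := rho_coords_ex.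
have m0 := dim_model_gt0 iC_inj iCP.
have Cm := dim_model iC_inj iCP.
have [pC pC0 [pCN pCmax]] := uniformizer_ext piU compl k_residue k_closed C.
have Xb := pow_tuple_basis piU compl k_residue k_closed pC0 pCN pCmax Cm.
have rl h (hH : h \in Hg) := rho_linear (mem_stab hH).
have rm h (hH : h \in Hg) := rho_morph (mem_stab hH).
have mO := orbit_degree rl rm rho_comp rho_1 cbE rho_fixed_scalar sgP kap_inj kapP Xb.
have trE c : (field_trace pC m c)%:A = \sum_(o in O) rho (kap c) (sg o) :> L.
  apply: (conj_trace rl rm rho_comp rho_1 cbE rho_fixed_scalar sgP kap_inj kapM kapP Xb).
  move=> i; rewrite pow_nth (mulmatE piU compl k_residue k_closed pC0 pCN pCmax Cm).
  by apply: eq_bigr => j _; rewrite pow_nth.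
(* If all traces vanished, the matrix of conjugates would kill the vector of ones, against
   [conj_mx_full]. *)
have tr_neq0 : exists c, field_trace pC m c != 0.
  apply: contrapT => h.
  have /row_fullP[U UB] := conj_mx_full rl rm rho_comp rho_1 cbE sgP kapP Xb.
  have x0O : x0 \in O by exact: orbit_refl.
  have : @conj_mx _ _ _ Hg rho _ to x0 sg _ kap _ (pow_tuple pC m) *m (const_mx 1 : 'cV[L]_#|O|) = 0.
    apply/colP => i; rewrite !mxE.
    transitivity (\sum_(o in O) rho (kap (pC ^+ i)) (sg o)).
      rewrite [RHS]big_enum_val; apply: eq_bigr => c _; rewrite !mxE mulr1 pow_nth //.
    rewrite -trE (_ : field_trace _ _ _ = 0) ?scale0r //.
    by apply/eqP/negPn/negP => t0; apply: h; exists (pC ^+ i).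
  move=> /(congr1 (mulmx U)); rewrite mulmxA UB mul1mx mulmx0.
  move=> /colP/(_ (enum_rank_in x0O x0)); rewrite !mxE => /eqP.
  by rewrite oner_eq0.
have [d' [D [DE Dd trD [i0 [a0 [ia0 a0v]]]]]] :=
  trace_disc piU compl k_residue k_closed pC0 pCN pCmax m0 Cm tr_neq0.
have dE : d = d'.
  exact: (disc_exp_model iC_inj iCM iCP piU compl k_residue k_closed pC0 pCN pCmax DE Dd).
split=> //; exists (kap pC); split.
- by apply/kap_int; case: pCN.
- by apply/kapP; exists pC.
- move=> y Oy /kapP[c cE]; rewrite cE in Oy *; move/kap_int: Oy => Oc.
  have [a aE] := coord_int piU compl k_residue k_closed pC0 pCN pCmax Cm Oc.
  exists a; rewrite {1}(coord_powE piU compl k_residue k_closed pC0 pCN pCmax Cm c) linear_sum.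
  by apply: eq_bigr => i _; rewrite linearZ /= aE incZ kapX.
- exists D; first by rewrite dE.
  by move=> i j; rewrite -!kapX -kapM -trE DE.
split=> [y Oy /kapP[c cE]|].
  rewrite cE in Oy *; move/kap_int: Oy => Oc.
  by have [a aE] := trD _ Oc; exists a; rewrite -trE aE dE.
exists i0, a0; rewrite dE; split=> //.
by rewrite -kapX -trE ia0.
Qed.

End KCModel.

(** * Lengths *)

Section JordanHoelder.
Local Open Scope classical_set_scope.
Variables (R : nzRingType) (A : set R) (V : lmodType R).
Implicit Types X Y Z T : set V.
Local Notation submod := (is_submod A (V := V)).

Definition simple_step Z X := Z `<` X /\
  (forall T, submod T -> Z `<=` T -> T `<=` X -> T = Z \/ T = X).

(** A composition series read from the top, so that induction on the length can change X. *)
Fixpoint comp_chain n Y X : Prop :=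
  if n is n'.+1 then exists Z, [/\ submod Z, comp_chain n' Y Z & simple_step Z X]
  else X = Y.

Variable Xtop : set V.
Hypothesis Xopp : exists2 a, A a & forall u, Xtop u -> a *: u = - u.

Lemma submodB T u v : submod T -> T `<=` Xtop -> T u -> T v -> T (u - v).
Proof.
move=> [_ TD TZ] TX Tu Tv; apply: TD => //.
by have [a Aa <-] := Xopp; [exact: TZ | exact: TX].
Qed.

(** Intersecting the terms of a series with Z leaves simple or trivial steps; at least one step
    becomes trivial when Z is proper. *)
Lemma comp_chain_inter n Y X Z : submod X -> submod Z -> Y `<=` Z -> Z `<=` X ->
  X `<=` Xtop -> comp_chain n Y X ->
  exists2 n', (n' <= n)%N & comp_chain n' Y Z /\ (Z <> X -> (n' < n)%N).
Proof.
elim: n X Z => [|n IHn] X Z sX sZ YZ ZX XT /=.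
  move=> XY; have ZY : Z = Y by apply/seteqP; split=> //; rewrite -XY.
  by exists 0%N => //; split=> //; rewrite ZY XY.
move=> [X' [sX' cX' [X'X X'max]]].
have X'sub : X' `<=` X by case: X'X.
have [ZX'|ZX'] := pselect (Z `<=` X').
  have [n' n'n [cZ _]] := IHn _ _ sX' sZ YZ ZX' (subset_trans X'sub XT) cX'.
  by exists n'; [exact: leqW | split=> // _; exact: n'n].
have sI : submod (Z `&` X').
  case: sZ sX' => [Z0 ZD ZZ] [X0 XD XZ]; split=> //.
    by move=> u v [? ?] [? ?]; split; [exact: ZD | exact: XD].
  by move=> a u Aa [? ?]; split; [exact: ZZ | exact: XZ].
have YX' : Y `<=` X'.
  elim: {IHn} n X' cX' {sX' X'X X'max X'sub ZX' sI} => [|n IH] X' /=; first by move=> ->.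
  by move=> [Z' [_ /IH YZ' [[Z'X' _] _]]]; exact: subset_trans YZ' Z'X'.
have [|//|n' n'n [cI In']] := IHn X' (Z `&` X') sX' sI _ _ (subset_trans X'sub XT) cX'.
  by move=> y Yy; split; [exact: YZ | exact: YX'].
exists n'.+1; first exact: n'n.
split.
  exists (Z `&` X'); split=> //; split.
    split; first by move=> x [].
    by move=> h; apply: ZX' => z Zz; case: (h z Zz).
  move=> T sT IT TZ.
  (* T + X' lies between X' and X, so it is one of them; by the modular law T is then the
     intersection of Z and X', or Z. *)
  pose TX : set V := [set w | exists u v, [/\ T u, X' v & w = u + v]].
  have sTX : submod TX.
    case: sT sX' => [T0 TD TM] [X0 XD XM]; split.
    - by exists 0, 0; rewrite addr0.
    - move=> _ _ [u [v [Tu Xv ->]]] [u' [v' [Tu' Xv' ->]]].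
      by exists (u + u'), (v + v'); rewrite addrACA; split; [exact: TD | exact: XD |].
    - move=> a _ Aa [u [v [Tu Xv ->]]].
      by exists (a *: u), (a *: v); rewrite scalerDr; split; [exact: TM | exact: XM |].
  have TX1 : X' `<=` TX.
    by move=> v Xv; exists 0, v; rewrite add0r; split=> //; case: sT.
  have TX2 : TX `<=` X.
    move=> _ [u [v [Tu Xv ->]]]; case: sX => _ XD _; apply: XD; first exact/ZX/TZ.
    exact: X'sub.
  have [e|e] := X'max TX sTX TX1 TX2.
    left; apply/seteqP; split=> // t Tt; split; first exact: TZ.
    by rewrite -e; exists t, 0; rewrite addr0; split=> //; case: sX'.
  right; apply/seteqP; split=> // z Zz.
  have : TX z by rewrite e; exact: ZX.
  case=> t [x [Tt Xx zE]]; rewrite zE; case: (sT) => _ TD _; apply: TD => //.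
  apply: IT; split=> //.
  have -> : x = z - t by rewrite zE addrAC subrr add0r.
  by apply: submodB => //; [exact: subset_trans ZX XT | exact: TZ].
move=> nZX; rewrite ltnS; apply: In' => e.
have X'Z : X' `<=` Z by rewrite -e => x [].
have [h|//] := X'max Z sZ X'Z ZX.
by apply: ZX'; rewrite h.
Qed.

(** The last proper term Z of the series of length m cuts the other series down to one of Z / Y of
    length less than n; induction on m compares the two. *)
Lemma comp_chain_le m n Y X : submod X -> X `<=` Xtop ->
  comp_chain n Y X -> comp_chain m Y X -> (m <= n)%N.
Proof.
elim: m n X => // m IH n X sX XT cn /= [Z [sZ cZ [[ZX nXZ] _]]].
have YZ : Y `<=` Z.
  elim: {IH} m Z cZ {sZ ZX nXZ} => [|m IH] Z /=; first by move=> ->.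
  by move=> [Z' [_ /IH YZ' [[Z'X' _] _]]]; exact: subset_trans YZ' Z'X'.
have [n' _ [cZ' h]] := comp_chain_inter sX sZ YZ ZX XT cn.
have nn' : (n' < n)%N by apply: h => e; apply: nXZ; rewrite e.
by apply: leq_trans nn'; apply: IH sZ _ cZ' cZ; exact: subset_trans ZX XT.
Qed.

Lemma comp_series_chain n X Y : has_comp_series A X Y n -> comp_chain n Y X.
Proof.
move=> [S [<- <- Ssub Sstep]].
have : (n <= n)%N by [].
elim: {-2}n => // i IH ilt /=; exists (S i); split.
- by apply: Ssub; exact: ltnW.
- by apply: IH; exact: ltnW.
exact: Sstep.
Qed.

End JordanHoelder.

Lemma quot_lengthE (R : nzRingType) (A : set R) (V : lmodType R) (X Y : set V) n :
  (exists2 a, A a & forall u, X u -> a *: u = - u) ->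
  has_comp_series A X Y n -> quot_length A X Y = (n%:R)%:E.
Proof.
move=> Xopp Xn; rewrite /quot_length; case: xgetP => [x _ [m Xm <-]|/(_ ((n%:R)%:E)) h].
  have sX : is_submod A X by have [S [_ <- h _]] := Xn; exact: h.
  have := comp_series_chain Xn; have := comp_series_chain Xm => cm cn.
  congr ((_%:R)%:E); apply/eqP; rewrite eqn_leq.
  by rewrite (comp_chain_le Xopp sX _ cn cm) ?(comp_chain_le Xopp sX _ cm cn).
by case: h; exists n.
Qed.

Section Transport.
Local Open Scope classical_set_scope.
Variables (R R' : nzRingType) (A : set R) (A' : set R') (V : lmodType R) (V' : lmodType R').
Variables (th : V -> V') (pr : R -> R') (X Y : set V) (X' Y' : set V').
Hypothesis th0 : th 0 = 0.
Hypothesis thD : {morph th : u v / u + v}.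
Hypothesis thZ : forall a u, th (a *: u) = pr a *: th u.
Hypothesis prA : forall a, A a -> A' (pr a).
Hypothesis prA' : forall a', A' a' -> exists2 a, A a & pr a = a'.
Hypothesis sX : is_submod A X.
Hypothesis th_inj : forall u v, X u -> X v -> th u = th v -> u = v.
Hypothesis thX : forall u, X u -> X' (th u).
Hypothesis thX' : forall u', X' u' -> exists2 u, X u & th u = u'.
Hypothesis YX : Y `<=` X.
Hypothesis YY' : forall u, X u -> (Y u <-> Y' (th u)).

(** The series is pulled back along [th], a bijection from X to X' that is semilinear for [pr]. In
    the application the scalars are in [M] on one side and in [L] on the other. *)
Lemma transport_series n : has_comp_series A' X' Y' n -> has_comp_series A X Y n.
Proof.
move=> [S [S0 Sn Ssub Sstep]].
have SXn j : (j <= n)%N -> S (n - j)%N `<=` X'.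
  elim: j => [_|j IH jn]; first by rewrite subn0 Sn.
  have [|[h _] _] := Sstep (n - j.+1)%N; first by rewrite -subn_gt0 subKn.
  by apply: subset_trans h _; rewrite subnSK //; apply: IH; exact: ltnW.
have SX i : (i <= n)%N -> S i `<=` X' by move=> h; rewrite -(subKn h); apply: SXn; exact: leq_subr.
have [X0 XD XZ] := sX.
exists (fun i => [set u | X u /\ S i (th u)]); split.
- apply/seteqP; split=> [u [Xu]|u Yu]; first by rewrite S0 => /(YY' Xu).2.
  by split; [exact: YX | rewrite S0; apply/(YY' (YX Yu)).1].
- by apply/seteqP; split=> [u []|u Xu] //; split=> //; rewrite Sn; exact: thX.
- move=> i /Ssub[S0' SD SZ]; split; first by rewrite /= th0.
    by move=> u v [Xu Su] [Xv Sv]; split; [exact: XD | rewrite thD; exact: SD].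
  by move=> a u Aa [Xu Su]; split; [exact: XZ | rewrite thZ; apply: SZ => //; exact: prA].
move=> i ilt; have [[Si nSi] Smax] := Sstep i ilt; split.
  split; first by move=> u [Xu /Si].
  move=> h; apply: nSi => u' Su'.
  have [u Xu uE] := thX' (SX _ ilt _ Su').
  have [_ Su] : X u /\ S i (th u) by apply: h; split=> //=; rewrite uE.
  by rewrite -uE.
move=> T [T0 TD TZ] ST TS.
pose T' : set V' := [set th u | u in T].
have TX : T `<=` X by move=> u /TS[].
have sT' : is_submod A' T'.
  split; first by exists 0.
    by move=> _ _ [u Tu <-] [v Tv <-]; exists (u + v); [exact: TD | exact: thD].
  move=> a' _ /prA'[a Aa <-] [u Tu <-]; exists (a *: u); [exact: TZ | exact: thZ].
have TE u : X u -> T u <-> T' (th u).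
  move=> Xu; split=> [Tu|[v Tv e]]; first by exists u.
  by rewrite -(th_inj (TX _ Tv) Xu e).
have [||e|e] := Smax T' sT'.
- move=> u' Su'; have [u Xu uE] := thX' (SX _ (ltnW ilt) _ Su').
  by by exists u => //; apply: ST; split=> //=; rewrite uE.
- by move=> _ [u /TS[_ Su] <-].
- left; apply/seteqP; split=> u; first by move=> Tu; split; [exact: TX | rewrite -e; exact/(TE _ (TX _ Tu))].
  by move=> [Xu Su]; apply/(TE _ Xu); rewrite e.
right; apply/seteqP; split=> u; first by move=> Tu; split; [exact: TX | rewrite -e; exact/(TE _ (TX _ Tu))].
by move=> [Xu Su]; apply/(TE _ Xu); rewrite e.
Qed.

End Transport.

Lemma det_setcol (R : comNzRingType) n (v : 'I_n -> R) (j : 'I_n) :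
  \det (\matrix_(i, k) if k == j then v i else (i == k)%:R) = v j.
Proof.
rewrite (expand_det_col _ j) (bigD1 j) //=.
have cofE (i : 'I_n) : cofactor (\matrix_(i, k) if k == j then v i else (i == k)%:R) i j
    = (i == j)%:R.
  transitivity (cofactor (1%:M : 'M[R]_n) i j).
    rewrite /cofactor; congr (_ * \det _); apply/matrixP => a b; rewrite !mxE.
    by rewrite eq_sym (negPf (neq_lift _ _)).
  have := mul_mx_adj (1%:M : 'M[R]_n); rewrite mul1mx det1 => /matrixP/(_ j i).
  by rewrite !mxE => ->; rewrite eq_sym.
rewrite mxE eqxx cofE eqxx mulr1 big1 ?addr0 // => i ij.
by rewrite cofE (negPf ij) mulr0.
Qed.

(** * Length and determinant of lattices over O_L *)

Section Lattice.
Local Open Scope classical_set_scope.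
Variables (OD : idomainType) (pi : OD).
Hypothesis piU : uniformizer pi.
Hypothesis compl : m_adic_complete OD.
Variables (k : fieldType) (res : {rmorphism OD -> k}).
Hypothesis k_residue : is_residue_field res.
Hypothesis k_closed : GRing.closed_field_axiom k.
Variable L : fieldExtType {fraction OD}.
Variable p : L.
Hypothesis p0 : p != 0.
Hypothesis pN : ononunit p.
Hypothesis pmax : forall y, ononunit y -> Oint (y / p).

Lemma Oint_det r (P : 'M[L]_r) : (forall i j, Oint (P i j)) -> Oint (\det P).
Proof.
move=> OP; apply: Oint_sum => s _; apply: OintM; last by apply: Oint_prod.
by apply: OintX; apply/OintN/Oint1.
Qed.

Lemma Oint_adj r (P : 'M[L]_r) : (forall i j, Oint (P i j)) -> forall i j, Oint ((\adj P) i j).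
Proof.
move=> OP i j; rewrite mxE; apply: OintM; first by apply: OintX; apply/OintN/Oint1.
by apply: Oint_det => a b; rewrite !mxE.
Qed.

Definition int_rows r : set 'rV[L]_r := [set u | forall j, Oint (u 0 j)].
Definition row_lattice r (P : 'M[L]_r) : set 'rV[L]_r := [set c *m P | c in @int_rows r].

Lemma int_rows_submod r : is_submod (@Oint OD L) (@int_rows r).
Proof.
split; first by move=> j; rewrite mxE; exact: Oint0.
  by move=> u v Ou Ov j; rewrite mxE; exact: OintD (Ou j) (Ov j).
by move=> a u Oa Ou j; rewrite mxE; exact: OintM Oa (Ou j).
Qed.

Lemma row_lattice_submod r (P : 'M[L]_r) : is_submod (@Oint OD L) (row_lattice P).
Proof.
have [O0 OD' OZ] := int_rows_submod r.
split; first by exists 0 => //; rewrite mul0mx.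
  by move=> _ _ [u Ou <-] [v Ov <-]; exists (u + v); [exact: OD' | rewrite mulmxDl].
by move=> a _ Oa [u Ou <-]; exists (a *: u); [exact: OZ | rewrite scalemxAl].
Qed.

Lemma ounit_hasv0 x : ounit x <-> hasv p x 0.
Proof.
split=> [xU|[u uU ->]]; last by rewrite mulr1.
by exists x; rewrite ?mulr1.
Qed.

(* A row of the adjugate of P, divided by the greatest power of p that divides all of
   its entries. *)
Lemma adj_reduced r (P : 'M[L]_r) n : (forall i j, Oint (P i j)) ->
  hasv p (\det P) n.+1 -> exists (c : 'rV[L]_r) j,
  [/\ int_rows c, ounit (c 0 j) & int_rows (p^-1 *: (c *m P))].
Proof.
move=> OP Pn; have [u uU dE] := Pn; have [u0 Ou _] := uU.
pose Q s := p ^- s *: \adj P.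
have QE s i j : Q s i j = p ^- s * (\adj P) i j by exact: mxE.
have QP s : Q s *m P = (p ^- s * \det P)%:M.
  by rewrite -scalemxAl mul_adj_mx scale_scalar_mx.
have bound s : (forall i j, Oint (Q s i j)) -> (s <= n)%N.
  move=> Os; rewrite leqNgt; apply/negP => ns.
  have : ounit (\det (Q n.+1) * \det P).
    rewrite -det_mulmx QP det_scalar dE mulrCA mulVf ?expf_neq0 // mulr1.
    exact: ounitX.
  have OQ : forall i j, Oint (Q n.+1 i j).
    move=> i j; have -> : Q n.+1 i j = p ^+ (s - n.+1) * Q s i j.
      rewrite !QE mulrA; congr (_ * _).
      have -> : p ^+ s = p ^+ (s - n.+1) * p ^+ n.+1 by rewrite -exprD subnK.
      by field; rewrite !expf_neq0.
    by apply: OintM => //; apply: OintX; case: pN.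
  rewrite mulrC => /ounit_dvd/(_ (Oint_det OP) (Oint_det OQ))/ounit_hasv0 h.
  by have := hasv_uniq p0 pN Pn h.
have [|s [Qs nQs]] := @exists_last (fun s => forall i j, Oint (Q s i j)) n _ bound.
  by move=> i j; rewrite QE expr0 invr1 mul1r; exact: Oint_adj.
have [i [j nQ]] : exists i j, ~ Oint (Q s.+1 i j).
  apply: contrapT => h; apply: nQs => i j; apply: contrapT => h'.
  by apply: h; exists i, j.
exists (row i (Q s)), j; split.
- by move=> l; rewrite mxE.
- rewrite mxE; apply: contrapT => h; apply: nQ.
  have -> : Q s.+1 i j = Q s i j / p by rewrite !QE exprSr invfM mulrAC.
  by apply: pmax.
have sn := bound _ Qs.
move=> l; rewrite -row_mul QP !mxE dE.
have -> : p^-1 * (p ^- s * (u * p ^+ n.+1) *+ (i == l)) = (u * p ^+ (n - s)) *+ (i == l).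
  rewrite mulrnAr; congr (_ *+ _).
  have -> : p ^+ n.+1 = p ^+ (n - s) * p ^+ s * p by rewrite -exprD subnK // exprSr.
  by field; rewrite p0 expf_neq0.
case: (i == l); rewrite ?mulr1n ?mulr0n; last exact: Oint0.
by apply: OintM => //; apply: OintX; case: pN.
Qed.

(** For n = 0 the matrix is invertible over O_L. Otherwise an integral z = (c P) / p with c_j a unit
    replaces row j of [P]: the determinant loses one factor [p], and the lattice grows by a simple
    quotient killed by [p]. *)
Lemma lattice_series r (P : 'M[L]_r) n : (forall i j, Oint (P i j)) ->
  hasv p (\det P) n -> has_comp_series (@Oint OD L) (@int_rows r) (row_lattice P) n.
Proof.
elim: n P => [|n IHn] P OP Pn.
  have [u0 Ou Oui] := (ounit_hasv0 _).2 Pn.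
  have e : @int_rows r = row_lattice P.
    apply/seteqP; split=> [v Ov|_ [c Oc <-] j]; last first.
      by rewrite mxE; apply: Oint_sum => i _; exact: OintM.
    exists ((\det P)^-1 *: (v *m \adj P)).
      move=> j; rewrite !mxE; apply: OintM => //; apply: Oint_sum => i _.
      by apply: OintM => //; exact: Oint_adj.
    by rewrite -scalemxAl -mulmxA mul_adj_mx mul_mx_scalar scalerA mulVf // scale1r.
  exists (fun=> @int_rows r); split=> // i _; exact: int_rows_submod.
have [c [j [Oc cU Ocz]]] := adj_reduced OP Pn.
pose E : 'M[L]_r := \matrix_(i, l) if i == j then c 0 l / p else (i == l)%:R.
have dE : \det E = c 0 j / p.
  rewrite -det_tr -(det_setcol (fun l => c 0 l / p) j); congr (\det _).
  by apply/matrixP => a b; rewrite !mxE [a == b]eq_sym.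
pose P' := E *m P.
pose z := p^-1 *: (c *m P).
have cut (b : 'rV[L]_r) : b *m E = (b 0 j / p) *: c + \row_l (if l == j then 0 else b 0 l).
  apply/rowP => l; rewrite !mxE (bigD1 j) //= !mxE eqxx; congr (_ + _); first by rewrite mulrA mulrAC.
  have [->|lj] := eqVneq l j.
    by apply: big1 => i ij; rewrite !mxE (negPf ij) mulr0.
  rewrite (bigD1 l) //= big1 ?addr0 => [|i /andP[ij il]].
    by rewrite !mxE (negPf lj) eqxx mulr1.
  by rewrite !mxE (negPf ij) (negPf il) mulr0.
have cutP b : b *m P' = b 0 j *: z + (\row_l (if l == j then 0 else b 0 l)) *m P.
  by rewrite mulmxA cut mulmxDl -scalemxAl scalerA.
have Ocut b : int_rows b -> int_rows (\row_l (if l == j then 0 else b 0 l)).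
  by move=> Ob l; rewrite mxE; case: eqP => // _; exact: Oint0.
have Odelta (i : 'I_r) : int_rows (delta_mx 0 i : 'rV[L]_r).
  by move=> l; rewrite mxE; case: andb; [exact: Oint1 | exact: Oint0].
have OP' : forall i l, Oint (P' i l).
  move=> i l; have -> : P' i l = ((delta_mx 0 i : 'rV[L]_r) *m P') 0 l by rewrite -rowE [RHS]mxE.
  rewrite cutP mxE; apply: OintD.
    by rewrite mxE; apply: OintM; [exact: Odelta | exact: Ocz].
  rewrite mxE; apply: Oint_sum => l' _; apply: OintM => //; exact: Ocut.
have P'n : hasv p (\det P') n.
  have [u uU uE] := Pn; exists (c 0 j * u); first exact: ounitM.
  by rewrite det_mulmx dE uE exprSr; field.
have PU : P \in unitmx.
  rewrite unitmxE unitfE; have [u [u0 _ _] ->] := Pn.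
  by rewrite mulf_neq0 // expf_neq0.
have [S [S0 Sn Ssub Sstep]] := IHn P' OP' P'n.
have [cj0 Ocj Ocji] := cU.
have sub : row_lattice P `<=` row_lattice P'.
  move=> _ [a Oa <-].
  (* The solution of b E = a, integral because c_j is a unit. *)
  pose b : 'rV[L]_r := \row_l if l == j then a 0 j * p / c 0 j else a 0 l - a 0 j * c 0 l / c 0 j.
  exists b.
    move=> l; rewrite mxE; case: eqP => _.
      by apply: OintM => //; apply: OintM => //; case: pN.
    by apply: OintB => //; apply: OintM => //; exact: OintM.
  rewrite mulmxA cut; congr (_ *m _); apply/rowP => l; rewrite !mxE eqxx.
  case: eqP => [->|_]; field; by rewrite ?cj0 ?p0.
exists (fun i => if i is i'.+1 then S i' else row_lattice P); split=> //.
- by case=> [|i] ilt; [exact: row_lattice_submod | exact: Ssub].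
case=> [|i] ilt; last exact: Sstep.
rewrite S0; split.
  split=> // h.
  have [a Oa aE] : row_lattice P z.
    apply: h; exists (delta_mx 0 j) => //.
    rewrite cutP mxE !eqxx scale1r [X in X *m _](_ : _ = 0) ?mul0mx ?addr0 //.
    by apply/rowP => l; rewrite !mxE eqxx /=; case: eqP.
  move: aE; rewrite /z scalemxAl => /(can_inj (mulmxK PU))/rowP/(_ j); rewrite mxE => aj.
  case: pN => Op; apply; split=> //.
  have -> : p^-1 = a 0 j / c 0 j by rewrite aj mulrK ?unitfE.
  exact: OintM.
move=> T sT PT TP'.
have [h|h] := pselect (T `<=` row_lattice P); first by left; apply/seteqP.
right; apply/seteqP; split=> //.
have [t Tt nPt] : exists2 t, T t & ~ row_lattice P t.
  by apply: contrapT => h'; apply: h => t Tt; apply: contrapT => h''; apply: h'; exists t.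
have [b Ob bE] := TP' t Tt.
(* If b_j were divisible by [p], then [t] would lie in the lattice of [P]. As b_j is a unit, [z] can
   be recovered from [t] modulo that lattice. *)
have bU : ounit (b 0 j).
  apply: contrapT => nb; apply: nPt; rewrite -bE /P' mulmxA.
  exists (b *m E) => //; rewrite cut => l; rewrite !mxE; apply: OintD.
    by apply: OintM => //; exact: pmax.
  by case: eqP => // _; exact: Oint0.
have [bj0 _ Obji] := bU.
case: sT => T0 TD TZ.
have Tz : T z.
  have -> : z = (b 0 j)^-1 *: (t + (-1) *: ((\row_l (if l == j then 0 else b 0 l)) *m P)).
    by rewrite -bE cutP scaleN1r addrK scalerA mulVf // scale1r.
  apply: (TZ) => //; apply: (TD) => //; apply: (TZ); first by apply/OintN/Oint1.
  by apply: PT; exists (\row_l (if l == j then 0 else b 0 l)) => //; exact: Ocut.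
move=> _ [b' Ob' <-]; rewrite cutP; apply: TD; first exact: TZ.
by apply: PT; exists (\row_l (if l == j then 0 else b' 0 l)) => //; exact: Ocut.
Qed.

End Lattice.

(** * Lattices cut out by a linear form *)

Lemma det_mxdiag (R : comNzRingType) l (m_ : 'I_l -> nat) (D : forall j, 'M[R]_(m_ j)) :
  \det (\mxdiag_j D j) = \prod_j \det (D j).
Proof.
elim: l m_ D => [|l IH] m_ D.
  have det0 n (A : 'M[R]_n) : n = 0%N -> \det A = 1.
    by case: n A => // A _; exact: det_mx00.
  by rewrite [RHS]big_ord0; apply: det0; rewrite big_ord0.
rewrite mxdiag_recl [RHS]big_ord_recl -IH -(det_ublock _ 0).
by move: (mxsize_recl) (block_mx _ _ _ _) => h; case: _ / h.
Qed.

Lemma sum_lift (V : zmodType) n (k0 : 'I_n) (F : 'I_n -> V) :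
  \sum_(i | i != k0) F i = \sum_i F (lift k0 i).
Proof.
case: n k0 F => [[]|n] // k0 F.
apply: (addrI (F k0)); transitivity (\sum_i F i); first by rewrite [RHS](bigD1 k0).
by rewrite (bigD1_ord k0).
Qed.

(** [Q] subtracts [ta i] times row [k0] from row i, and [F] puts the values [t] in column [i0], with
    det Q = 1 and det F = f i0. In Q B F, column [i0] has [t k0] as its only possibly nonzero entry,
    along which the determinant is expanded. *)
Lemma kernel_det (R : comNzRingType) d (B : 'M[R]_d) (f t ta : 'I_d -> R) (k0 i0 : 'I_d) :
  (forall i, \sum_k B i k * f k = t i) -> (forall i, t i = ta i * t k0) ->
  exists b : bool, \det B * f i0 = t k0 * ((-1) ^+ b *
    \det (\matrix_(i, j) (B (lift k0 i) (lift i0 j) - ta (lift k0 i) * B k0 (lift i0 j)))).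
Proof.
move=> Bf tE.
pose w i : R := if i == k0 then 1 else - ta i.
pose Q : 'M[R]_d := \matrix_(i, k) if k == k0 then w i else (i == k)%:R.
pose F : 'M[R]_d := \matrix_(k, j) if j == i0 then f k else (k == j)%:R.
have QB (X : 'M[R]_d) i j : i != k0 -> (Q *m X) i j = X i j - ta i * X k0 j.
  move=> ik; rewrite mxE (bigD1 k0) //= (bigD1 i) //= big1 => [|k /andP[kk ki]].
    by rewrite !mxE eqxx (negPf ik) eqxx mul1r addr0 /w (negPf ik) mulNr addrC.
  by rewrite !mxE (negPf kk) eq_sym (negPf ki) mul0r.
have QB0 (X : 'M[R]_d) j : (Q *m X) k0 j = X k0 j.
  rewrite mxE (bigD1 k0) //= big1 => [|k kk].
    by rewrite !mxE eqxx /w eqxx mul1r addr0.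
  by rewrite !mxE (negPf kk) eq_sym (negPf kk) mul0r.
have BF i j : (B *m F) i j = if j == i0 then t i else B i j.
  rewrite mxE; case: eqP => [->|/eqP ji].
    by rewrite -Bf; apply: eq_bigr => k _; rewrite mxE eqxx.
  rewrite (bigD1 j) //= big1 => [|k kj]; rewrite mxE (negPf ji).
    by rewrite eqxx mulr1 addr0.
  by rewrite (negPf kj) mulr0.
have dQ : \det Q = 1 by rewrite det_setcol /w eqxx.
have dF : \det F = f i0 by rewrite det_setcol.
exists (odd (k0 + i0)); rewrite signr_odd.
transitivity (\det (Q *m (B *m F))); first by rewrite !det_mulmx dQ dF mul1r.
rewrite (expand_det_col _ i0) (bigD1 k0) //=.
rewrite big1 ?addr0 => [|i ik]; last by rewrite QB // !BF !eqxx -tE subrr mul0r.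
rewrite QB0 BF eqxx /cofactor; congr (_ * (_ * \det _)).
apply/matrixP => i j; rewrite [LHS]mxE [LHS]mxE QB; last by rewrite eq_sym neq_lift.
by rewrite [RHS]mxE !BF eq_sym (negPf (neq_lift _ _)).
Qed.

Section Kernel.
Variables (OD : idomainType) (pi : OD).
Hypothesis piU : uniformizer pi.
Hypothesis compl : m_adic_complete OD.
Variables (k : fieldType) (res : {rmorphism OD -> k}).
Hypothesis k_residue : is_residue_field res.
Hypothesis k_closed : GRing.closed_field_axiom k.
Variable L : fieldExtType {fraction OD}.
Local Notation inc := (@inc OD L).
Local Notation ipi := (inc pi).
Variable p : L.
Hypothesis p0 : p != 0.
Hypothesis pN : ononunit p.
Hypothesis pmax : forall y, ononunit y -> Oint (y / p).
Variable n : nat.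
Hypothesis ipin : hasv p ipi n.

Lemma hasvM x y a b : hasv p x a -> hasv p y b -> hasv p (x * y) (a + b).
Proof.
case=> u uU -> [v vU ->]; exists (u * v); first exact: ounitM.
by rewrite exprD mulrACA.
Qed.

Lemma hasvX x a j : hasv p x a -> hasv p (x ^+ j) (a * j).
Proof.
move=> xa; elim: j => [|j IH]; last by rewrite exprS mulnS; exact: hasvM.
by rewrite muln0 expr0; exists 1; rewrite ?mulr1 //; split; rewrite ?oner_eq0 ?invr1 //; exact: Oint1.
Qed.

Lemma hasv_inc a v : has_val pi a v -> hasv p (inc a) (n * v).
Proof.
case=> u uU ->; rewrite rmorphM rmorphXn /= -[(n * v)%N]add0n; apply: hasvM.
  by apply/ounit_hasv0/ounit_inc.
exact: hasvX.
Qed.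

(** On the kernel of the form the coordinate at [i0], where the coefficient is a unit, is determined
    by the others; dropping it identifies Hom(N, O_F) with O_F^(d-1). *)
Definition omit d (i0 : 'I_d) (y : 'I_d -> L) : 'rV[L]_(d.-1) := \row_j y (lift i0 j).

(** [k0] is a row of [B] where the form has least valuation; the rows of [P] are B_i - (t_i / t_k0)
    B_k0 without the entry at [i0]. By [kernel_det], det B * f i0 is t k0 * det P up to sign. The
    height [s] is kept apart from [d] because for stacked blocks it is a sum, equal to [d] only by a
    proof. *)
Lemma kernel_lattice s d (B : 'M[L]_(s, d)) (f : 'I_d -> OD) (t : 'I_s -> OD) (i0 : 'I_d) N2 :
  s = d -> (forall i j, Oint (B i j)) ->
  (forall i, \sum_j B i j * inc (f j) = inc (t i)) -> f i0 \is a GRing.unit ->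
  hasv p (\det (B *m B^T)) N2 ->
  exists k0 a (P : 'M[L]_(d.-1)) N,
    [/\ has_val pi (t k0) a, forall i, exists c, t i = c * t k0,
        (forall i j, Oint (P i j)) /\ hasv p (\det P) N, (N + n * a).*2 = N2 &
        (forall i, exists c : 'I_s -> OD, \sum_i c i * t i = 0 /\
           row i P = omit i0 (fun j => \sum_i inc (c i) * B i j)) /\
        (forall c : 'I_s -> OD, \sum_i c i * t i = 0 -> exists c' : 'rV[L]_(d.-1),
           int_rows c' /\ omit i0 (fun j => \sum_i inc (c i) * B i j) = c' *m P)].
Proof.
move=> sd; case: _ / sd f i0 B => f i0 B OB Bf fU BN.
have f0 : f i0 != 0 by apply: contraTneq fU => ->; rewrite unitr0.
have dBT : \det (B *m B^T) = \det B * \det B by rewrite det_mulmx det_tr.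
have dB0 : \det B != 0.
  by case: BN => u [u0 _ _]; rewrite dBT; apply: contra_eq_neq => ->; rewrite mul0r eq_sym mulf_neq0 // expf_neq0.
have [N1 BN1] := hasv_ex piU compl k_residue k_closed p0 pN pmax dB0 (Oint_det OB).
have N12 : N1.*2 = N2.
  by rewrite -addnn; apply: (hasv_uniq p0 pN (hasvM BN1 BN1)); rewrite -dBT.
have [k1 tk1] : exists i, t i != 0.
  apply: contrapT => h.
  have : B *m (\col_j inc (f j)) = 0.
    apply/colP => i; rewrite !mxE.
    have -> : \sum_j B i j * (\col_j inc (f j)) j 0 = inc (t i).
      by rewrite -Bf; apply: eq_bigr => j _; rewrite mxE.
    rewrite (_ : t i = 0) ?rmorph0 //.
    by apply/eqP/negPn/negP => ti; apply: h; exists i.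
  move=> /(congr1 (mulmx (invmx B))).
  rewrite mulKmx ?unitmxE ?unitfE // mulmx0 => /colP/(_ i0).
  by rewrite !mxE => /eqP; rewrite inc_eq0 (negPf f0).
have /choice[v vP] : forall i, exists v, t i != 0 -> has_val pi (t i) v.
  move=> i; have [->|/(has_val_ex piU compl)[v vP]] := eqVneq (t i) 0; first by exists 0%N.
  by exists v.
pose k0 := [arg min_(i < k1 | t i != 0) v i].
have [tk0 vmin] : t k0 != 0 /\ forall i, t i != 0 -> (v k0 <= v i)%N.
  by rewrite /k0; case: arg_minnP.
have /choice[ta taE] : forall i, exists c, t i = c * t k0.
  move=> i; have [->|ti] := eqVneq (t i) 0; first by exists 0; rewrite mul0r.
  have [u uU ->] := vP _ ti; have [u' u'U ->] := vP _ tk0.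
  exists (u * pi ^+ (v i - v k0) * u'^-1).
  by rewrite mulrA mulrVK // -mulrA -exprD subnK // vmin.
pose P := \matrix_(i, j) (B (lift k0 i) (lift i0 j) - inc (ta (lift k0 i)) * B k0 (lift i0 j)).
have [b bE] : exists b : bool, \det B * inc (f i0) = inc (t k0) * ((-1) ^+ b * \det P).
  apply: (@kernel_det _ _ B (fun j => inc (f j)) (fun i => inc (t i)) (fun i => inc (ta i)) k0 i0) => //.
  by move=> i; rewrite -rmorphM -taE.
have OP i j : Oint (P i j).
  by rewrite mxE; apply: OintB => //; apply: OintM => //; exact: Oint_inc.
have sgnU : ounit ((-1) ^+ b : L).
  apply: ounitX; split; rewrite ?oppr_eq0 ?oner_eq0 ?invrN1 //; exact/OintN/Oint1.
have dP0 : \det P != 0.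
  have : \det B * inc (f i0) != 0 by rewrite mulf_neq0 // inc_eq0.
  by rewrite bE !mulf_eq0 !negb_or => /andP[_ /andP[]].
have [N PN] := hasv_ex piU compl k_residue k_closed p0 pN pmax dP0 (Oint_det OP).
have NE : (N + n * v k0)%N = N1.
  have h1 : hasv p (\det B * inc (f i0)) (N1 + 0).
    by apply: hasvM => //; apply/ounit_hasv0/ounit_inc.
  have h2 : hasv p (\det B * inc (f i0)) (n * v k0 + (0 + N)).
    rewrite bE; apply: hasvM; first exact/hasv_inc/vP.
    by apply: hasvM => //; apply/ounit_hasv0.
  by have := hasv_uniq p0 pN h1 h2; lia.
exists k0, (v k0), P, N; split=> //; first exact: vP.
- by move=> i; exists (ta i).
- by rewrite NE.
split=> [i|c ct].
  (* As [t k0] is nonzero and divides every [t i], these relations form a basis of all O_D-linear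
     relations between the [t i]. *)
  pose c j : OD := (j == lift k0 i)%:R - (j == k0)%:R * ta (lift k0 i).
  have cs (F : 'I_s -> L) : \sum_j inc (c j) * F j = F (lift k0 i) - inc (ta (lift k0 i)) * F k0.
    rewrite (bigD1 k0) //= (bigD1 (lift k0 i)) /=; last by rewrite eq_sym neq_lift.
    rewrite big1 ?addr0 => [|j /andP[jk jl]].
      rewrite /c !eqxx (negPf (neq_lift _ _)) eq_sym (negPf (neq_lift _ _)) mul0r mul1r.
      by rewrite subr0 sub0r rmorphN rmorph1 mul1r mulNr addrC.
    by rewrite /c (negPf jk) (negPf jl) mul0r subr0 rmorph0 mul0r.
  exists c; split.
    apply: (@inc_injective _ L); rewrite rmorph0 rmorph_sum.
    under eq_bigr do rewrite rmorphM.
    by rewrite (cs (fun j => inc (t j))) -rmorphM -taE subrr.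
  by apply/rowP => j; rewrite !mxE cs.
exists (\row_i inc (c (lift k0 i))); split; first by move=> i; rewrite mxE; exact: Oint_inc.
have ck0 : c k0 = - \sum_(i | i != k0) c i * ta i.
  apply/eqP; rewrite -addr_eq0; apply/eqP; apply: (mulIf tk0).
  rewrite mul0r -[RHS]ct [in RHS](bigD1 k0) //= mulrDl mulr_suml; congr (_ + _).
  by apply: eq_bigr => i _; rewrite -mulrA -taE.
apply/rowP => j; rewrite !mxE (bigD1 k0) //= ck0 rmorphN rmorph_sum mulNr mulr_suml addrC -sumrB.
rewrite sum_lift; apply: eq_bigr => i _; rewrite !mxE mulrBr rmorphM; ring.
Qed.

End Kernel.

(** * The lattice of equivariant maps killing f *)

Section Equivariant.
Variables (OD : idomainType) (pi : OD).
Hypothesis piU : uniformizer pi.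
Hypothesis compl : m_adic_complete OD.
Variables (k : fieldType) (res : {rmorphism OD -> k}).
Hypothesis k_residue : is_residue_field res.
Hypothesis k_closed : GRing.closed_field_axiom k.
Local Notation K := {fraction OD}.
Variable L : fieldExtType K.
Local Notation inc := (@inc OD L).
Local Notation ipi := (inc pi).
Variable p : L.
Hypothesis p0 : p != 0.
Hypothesis pN : ononunit p.
Hypothesis pmax : forall y, ononunit y -> Oint (y / p).
Variable n : nat.
Hypothesis ipin : hasv p ipi n.

Variables (gT : finGroupType) (H : {group gT}) (rho : L -> gT -> L).
Hypothesis rho_lin : forall h, h \in H -> forall a x y,
  rho (a *: x + y) h = a *: rho x h + rho y h.
Hypothesis rho_mul : forall h, h \in H -> forall x y, rho (x * y) h = rho x h * rho y h.
Hypothesis rho_one : forall h, h \in H -> rho 1 h = 1.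
Hypothesis rhoM : forall g h, g \in H -> h \in H -> forall x,
  rho x (g * h)%g = rho (rho x g) h.
Hypothesis rho_int : forall x h, h \in H -> Oint x -> Oint (rho x h).

Variables (d : nat) (to : {action gT &-> 'I_d}) (f : 'I_d -> OD).
Hypothesis f_inv : forall i g, f (to i g) = f i.
Variables (l : nat) (x : 'I_l -> 'I_d).
Local Notation O j := (orbit to H (x j)).
Hypothesis O_cover : forall i, exists j, i \in O j.
Hypothesis O_uniq : forall i j j', i \in O j -> i \in O j' -> j = j'.
Variable sg : 'I_l -> 'I_d -> gT.
Hypothesis sgP : forall j o, o \in O j -> sg j o \in H /\ to (x j) (sg j o) = o.
Local Notation A j := 'C_H[x j | to]%g.
Variables (m_ d_ : 'I_l -> nat) (w : 'I_l -> L).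
Hypothesis m_card : forall j, m_ j = #|O j|.
Hypothesis w_int : forall j, Oint (w j).
Hypothesis w_fix : forall j h, h \in A j -> rho (w j) h = w j.
Hypothesis w_basis : forall j y, Oint y -> (forall h, h \in A j -> rho y h = y) ->
  exists a : 'I_(m_ j) -> OD, y = \sum_i inc (a i) * w j ^+ i.
Hypothesis w_disc : forall j, exists2 D : 'M[OD]_(m_ j), has_val pi (\det D) (d_ j) &
  forall i i' : 'I_(m_ j), inc (D i i') = \sum_(o in O j) rho (w j ^+ i * w j ^+ i') (sg j o).
Hypothesis w_trace : forall j y, Oint y -> (forall h, h \in A j -> rho y h = y) ->
  exists a, \sum_(o in O j) rho y (sg j o) = inc (a * pi ^+ (d_ j %/ m_ j)).
Hypothesis w_trace_min : forall j, exists (i : 'I_(m_ j)) a,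
  \sum_(o in O j) rho (w j ^+ i) (sg j o) = inc a /\ has_val pi a (d_ j %/ m_ j).

Definition equivariant (y : 'I_d -> L) :=
  [/\ forall i, Oint (y i), forall i h, h \in H -> y (to i h) = rho (y i) h &
      \sum_i y i * inc (f i) = 0].

Lemma pow_fixed j h i : h \in A j -> rho (w j ^+ i) h = w j ^+ i.
Proof.
move=> hA; have hH : h \in H by move: hA; rewrite inE => /andP[].
elim: i => [|i IH]; first by rewrite expr0 rho_one.
by rewrite !exprS rho_mul // w_fix // IH.
Qed.

Lemma coset_eq j z g h : (forall h, h \in A j -> rho z h = z) ->
  g \in H -> h \in H -> to (x j) g = to (x j) h -> rho z g = rho z h.
Proof.
move=> zA gH hH e; rewrite -[g](mulgKV h) rhoM ?groupM ?groupV //.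
rewrite zA // inE groupM ?groupV //; apply/astab1P.
by rewrite actM e actK.
Qed.

Lemma mem_orbit_act j i h : h \in H -> (to i h \in O j) = (i \in O j).
Proof.
by move=> hH; exact: orbit_actr.
Qed.

(** Row i is the equivariant family supported on the orbit of [x j] with value w_j^i at [x j]. *)
Definition conj_block j : 'M[L]_(m_ j, d) :=
  \matrix_(i, o) if o \in O j then rho (w j ^+ i) (sg j o) else 0.
Local Notation B := (\mxcol_j conj_block j).

Lemma conj_block_equiv j i o h : h \in H ->
  conj_block j i (to o h) = rho (conj_block j i o) h.
Proof.
move=> hH; rewrite !mxE mem_orbit_act //; case: ifP => oO; last first.
  by have := rho_lin hH (-1) 0 0; rewrite addr0 scaler0 scaleN1r addNr.
have [sH so] := sgP oO; have oO' : to o h \in O j by rewrite mem_orbit_act.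
have [sH' so'] := sgP oO'.
rewrite -rhoM //; apply: (@coset_eq j); rewrite ?groupM //; first by move=> g; exact: pow_fixed.
by rewrite actM so so'.
Qed.

Lemma conj_block_int j i o : Oint (conj_block j i o).
Proof.
rewrite mxE; case: ifP => [oO|_]; last exact: Oint0.
by have [sH _] := sgP oO; apply: rho_int => //; exact: OintX.
Qed.

Lemma rho_comb h (I : Type) (r : seq I) (a : I -> OD) (F : I -> L) : h \in H ->
  rho (\sum_(i <- r) inc (a i) * F i) h = \sum_(i <- r) inc (a i) * rho (F i) h.
Proof.
move=> hH.
have r0 : rho 0 h = 0 by have := rho_lin hH (-1) 0 0; rewrite addr0 scaler0 scaleN1r addNr.
elim: r => [|i r IH]; first by rewrite !big_nil.
by rewrite !big_cons -!incZ rho_lin // IH incZ.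
Qed.

(** Rows from distinct orbits have disjoint supports; within one orbit the products of entries sum
    to a trace. *)
Lemma conj_block_gram : exists D : forall j, 'M[OD]_(m_ j),
  (forall j, has_val pi (\det (D j)) (d_ j)) /\
  B *m B^T = \mxdiag_j map_mx inc (D j).
Proof.
have wD j : exists D : 'M[OD]_(m_ j), has_val pi (\det D) (d_ j) /\
    forall i i' : 'I_(m_ j), inc (D i i') = \sum_(o in O j) rho (w j ^+ i * w j ^+ i') (sg j o).
  by have [D D1 D2] := w_disc j; exists D.
pose D j := sval (cid (wD j)).
have D1 j : has_val pi (\det (D j)) (d_ j) by case: (svalP (cid (wD j))).
have D2 j (i i' : 'I_(m_ j)) : inc (D j i i') =
    \sum_(o in O j) rho (w j ^+ i * w j ^+ i') (sg j o) by case: (svalP (cid (wD j))).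
exists D; split=> //.
rewrite tr_mxcol mul_mxcol_mxrow /mxdiag; apply/eq_mxblockP => j j'.
case: eqP => [jj'|/eqP jj'].
  move: (j') jj' => _ <-; rewrite conform_mx_id; apply/matrixP => i i'; rewrite !mxE.
  rewrite D2 [RHS]big_mkcond /=; apply: eq_bigr => o _.
  rewrite !mxE; case: ifP => oO; last by rewrite mul0r.
  by have [sH _] := sgP oO; rewrite rho_mul.
apply/matrixP => i i'; rewrite !mxE big1 // => o _; rewrite !mxE.
case: ifP => oO; last by rewrite mul0r.
case: ifP => oO'; last by rewrite mulr0.
by rewrite (O_uniq oO oO') eqxx in jj'.
Qed.

Lemma rank_sum : (\sum_j m_ j = d)%N.
Proof.
under eq_bigr do rewrite m_card -sum1_card.
rewrite (exchange_big_dep xpredT) //=.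
rewrite -[RHS]card_ord -sum1_card; apply: eq_bigr => i _.
have [j ij] := O_cover i; rewrite (bigD1 j) //= big1 // => j' /andP[ij' jj'].
by rewrite (O_uniq ij' ij) eqxx in jj'.
Qed.

Lemma hasv_prod (I : Type) (r : seq I) (F : I -> L) (e : I -> nat) :
  (forall i, hasv p (F i) (e i)) -> hasv p (\prod_(i <- r) F i) (\sum_(i <- r) e i).
Proof.
move=> Fe; elim: r => [|i r IH]; last by rewrite !big_cons; exact: hasvM.
rewrite !big_nil; exists 1; rewrite ?mulr1 //.
by split; rewrite ?oner_eq0 ?invr1 //; exact: Oint1.
Qed.

(** [kernel_lattice] applied to the stacked blocks, whose rows span the equivariant integral
    families over O_D; what remains is to identify the least value [a]. *)
Lemma equivariant_lattice i0 : f i0 \is a GRing.unit ->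
  exists a (P : 'M[L]_(d.-1)) N,
  [/\ (forall i j, Oint (P i j)) /\ hasv p (\det P) N,
      (N + n * a).*2 = (n * \sum_j d_ j)%N,
      (forall i, exists y, equivariant y /\ row i P = omit i0 y) /\
      (forall y, equivariant y -> exists c, int_rows c /\ omit i0 y = c *m P),
      forall j v, has_val pi (f (x j)) v -> (a <= v + d_ j %/ m_ j)%N &
      exists j v, has_val pi (f (x j)) v /\ a = (v + d_ j %/ m_ j)%N].
Proof.
move=> fU.
have f_orb j o : o \in O j -> f o = f (x j) by case/orbitP => h _ <-; rewrite f_inv.
have BE s o : B s o = conj_block (tagnat.sig1 s) (tagnat.sig2 s) o by exact: mxE.
have OB s o : Oint (B s o) by rewrite BE; exact: conj_block_int.
have blockf j i : \sum_o conj_block j i o * inc (f o) =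
    inc (f (x j)) * \sum_(o in O j) rho (w j ^+ i) (sg j o).
  rewrite mulr_sumr [RHS]big_mkcond /=; apply: eq_bigr => o _; rewrite mxE.
  by case: ifP => oO; [rewrite (f_orb _ _ oO) mulrC | rewrite mul0r].
(* On the row of w_j^i the form takes the value f_j tr(w_j^i), because [f] is constant on the
   orbit. *)
have /choice[t tE] : forall s, exists t, \sum_o B s o * inc (f o) = inc t /\
    exists b, t = f (x (tagnat.sig1 s)) * (b * pi ^+ (d_ (tagnat.sig1 s) %/ m_ (tagnat.sig1 s))).
  move=> s; pose j := tagnat.sig1 s.
  have [||b bE] := @w_trace j (w j ^+ tagnat.sig2 s); first exact: OintX.
    by move=> h; exact: pow_fixed.
  exists (f (x j) * (b * pi ^+ (d_ j %/ m_ j))); split; last by exists b.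
  by rewrite rmorphM /= -bE -blockf; apply: eq_bigr => o _; rewrite mxE.
have [D [Dd BB]] := conj_block_gram.
have BN : hasv p (\det (B *m B^T)) (n * \sum_j d_ j)%N.
  rewrite BB det_mxdiag big_distrr /=; apply: hasv_prod => j.
  by rewrite det_map_mx; exact: (hasv_inc ipin (Dd j)).
have [k0 [a [P [N [tk0 tdvd PN Ne [PB BP]]]]]] :=
  kernel_lattice piU compl k_residue k_closed p0 pN pmax ipin rank_sum OB
    (fun s => (tE s).1) fU BN.
(* A power of w_j whose trace generates tr O_{C_j} gives a row where the form has valuation exactly
   v + d_j %/ m_j. *)
have amin j v : has_val pi (f (x j)) v -> (a <= v + d_ j %/ m_ j)%N.
  move=> fv; have [i [b [ib bv]]] := w_trace_min j.
  have ts : t (tagnat.Rank j i) = f (x j) * b.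
    apply: (@inc_injective _ L); rewrite -(tE _).1 rmorphM /= -ib -blockf.
    apply: eq_bigr => o _; congr (_ * _).
    by have /matrixP/(_ i o) := mxcolK conj_block j; rewrite mxE.
  have := has_val_mul fv bv; rewrite -ts => tv.
  apply: (has_val_dvd piU tv); have [c ->] := tdvd (tagnat.Rank j i).
  by have [u _ ->] := tk0; exists (c * u); rewrite mulrA.
exists a, P, N; split=> //.
- split=> [s|y [Oy yH yf]].
    have [c [ct rE]] := PB s.
    exists (fun o => \sum_i inc (c i) * B i o); split=> //; split.
    + by move=> o; apply: Oint_sum => i _; apply: OintM => //; exact: Oint_inc.
    + move=> o h hH; rewrite rho_comb //; apply: eq_bigr => i _.
      by rewrite !BE conj_block_equiv.
    + transitivity (\sum_o \sum_i inc (c i) * B i o * inc (f o)).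
        by apply: eq_bigr => o _; rewrite mulr_suml.
      transitivity (inc (\sum_i c i * t i)); last by rewrite ct rmorph0.
      rewrite exchange_big rmorph_sum; apply: eq_bigr => i _.
      by rewrite rmorphM /= -(tE i).1 mulr_sumr; apply: eq_bigr => o _; rewrite mulrA.
  have yA j h : h \in A j -> rho (y (x j)) h = y (x j).
    by rewrite inE => /andP[hH /astab1P xh]; rewrite -yH // xh.
  (* On each orbit [y] is determined by its value at [x j], which lies in O_{C_j}; the coordinates
     of these values on the powers of w_j are those of [y] on the rows of [B]. *)
  pose b j := sval (cid (w_basis (Oy (x j)) (@yA j))).
  have bE j : y (x j) = \sum_i inc (b j i) * w j ^+ i by exact: svalP (cid (w_basis (Oy (x j)) (@yA j))).
  pose c s := b (tagnat.sig1 s) (tagnat.sig2 s).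
  have yE o : y o = \sum_s inc (c s) * B s o.
    transitivity (((\mxrow_j \row_i inc (b j i)) *m B) 0 o); last first.
      by rewrite mxE; apply: eq_bigr => s _; rewrite !mxE.
    rewrite mul_mxrow_mxcol summxE; have [j oj] := O_cover o.
    rewrite (bigD1 j) //= big1 ?addr0 => [|j' j'j]; last first.
      rewrite mxE big1 // => i _; rewrite !mxE; case: ifP => oj'; last by rewrite mulr0.
      by rewrite (O_uniq oj' oj) eqxx in j'j.
    have [sH so] := sgP oj; rewrite -{1}so yH // bE rho_comb // mxE.
    by apply: eq_bigr => i _; rewrite !mxE oj.
  have ct : \sum_s c s * t s = 0.
    apply: (@inc_injective _ L); rewrite rmorph0 -[RHS]yf rmorph_sum.
    transitivity (\sum_o \sum_s inc (c s) * B s o * inc (f o)); last first.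
      by apply: eq_bigr => o _; rewrite yE mulr_suml.
    rewrite [RHS]exchange_big /=; apply: eq_bigr => s _.
    by rewrite rmorphM /= -(tE s).1 mulr_sumr; apply: eq_bigr => o _; rewrite mulrA.
  have [c' [Oc' c'E]] := BP c ct; exists c'; split=> //.
  by rewrite -c'E; apply/rowP => i; rewrite !mxE yE; apply: eq_bigr => s _; rewrite mxE.
(* The bound is attained in the block of the minimizing row, since [t k0] is a multiple of f_j
   pi^(d_j %/ m_j). *)
have [b tb] := (tE k0).2; set j := tagnat.sig1 k0 in tb.
have fj0 : f (x j) != 0.
  by apply: contraTneq (has_val_neq0 piU tk0) => f0; rewrite tb f0 mul0r eqxx.
have [v fv] := has_val_ex piU compl fj0.
exists j, v; split=> //; apply/eqP; rewrite eqn_leq amin //=.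
apply: (has_val_dvd piU tk0); have [u _ uE] := fv.
by exists (u * b); rewrite tb uE exprD; ring.
Qed.

End Equivariant.

(** * The hyperplane *)

Section HyperplaneLength.
Variable OD : idomainType.
Local Notation K := {fraction OD}.
Variables (M : falgType K) (gT : finGroupType) (act : {action gT &-> M}).
Hypothesis E_cover : is_Gcover act.
Variable e : M.
Hypothesis F_comp : is_component e.
Variables (L : fieldExtType K) (iota : {linear L -> M}) (pr : M -> L).
Hypothesis iota_inj : injective iota.
Hypothesis iota1 : iota 1 = e.
Hypothesis iotaM : {morph iota : x y / x * y}.
Hypothesis iotaP : forall x, x * e = x <-> exists c, x = iota c.
Hypothesis prE : forall x, iota (pr x) = x * e.
Variable H : {group gT}.
Hypothesis HE : H = comp_stab act e :> {set gT}.
Variables (d : nat) (to : {action gT &-> 'I_d}) (f : 'rV[OD]_d).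
Hypothesis f_inv : forall g : gT, lform_act to f g = f.
Variable i0 : 'I_d.
Hypothesis f_unit : f 0 i0 \is a GRing.unit.
Local Notation inc := (@inc OD L).
Local Notation N := (quot_line f).
Local Notation proj := (quot_line_proj f).
Local Notation rho := (rho act iota pr).
Local Notation Hom := (@HomOF OD M N e).
Local Notation Xi := (@Xi OD M gT act N (quot_line_act to (f := f)) e).

Lemma OF_iota x : OF e x <-> exists2 y, Oint y & x = iota y.
Proof.
split=> [[xint /iotaP[y yE]]|[y Oy ->]].
  by exists y => //; apply/(intclosure_iota iota_inj iotaM); rewrite -yE.
split; first exact/(intclosure_iota iota_inj iotaM).
exact: (iota_e iota1 iotaM).
Qed.

Definition coeffs (phi : N -> M^o) (i : 'I_d) : L := pr (phi (proj (delta_mx 0 i))).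

Definition hom_of_coeffs (y : 'I_d -> L) (q : N) : M^o :=
  iota (\sum_i inc ((generic_quotient.repr (q : Quotient.quot (line f))) 0 i) * y i).

Definition on_kernel (y : 'I_d -> L) := \sum_i y i * inc (f 0 i) = 0.

(** Two representatives differ by a multiple of [f], on which the map given by [y] vanishes. *)
Lemma hom_of_coeffsE y (u : 'rV[OD]_d) : on_kernel y ->
  hom_of_coeffs y (proj u) = iota (\sum_i inc (u 0 i) * y i).
Proof.
move=> yf; rewrite /hom_of_coeffs.
have /quot_line_projP/lineP[b hb] := quot_line_reprK (proj u).
congr (iota _); apply/eqP; rewrite -subr_eq0 -sumrB; apply/eqP.
transitivity (inc b * \sum_i y i * inc (f 0 i)); last by rewrite [X in _ * X]yf mulr0.
rewrite mulr_sumr; apply: eq_bigr => i _.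
rewrite -mulrBl -rmorphB /=; move/rowP: hb => /(_ i); rewrite !mxE => ->.
by rewrite rmorphM /=; ring.
Qed.

Lemma HomOF0 phi : Hom phi -> phi 0 = 0.
Proof.
case=> lin _; have /eqP := lin 1 0 0; rewrite scaler0 addr0 rmorph1 scale1r eq_sym.
by rewrite -subr_eq0 addrK => /eqP.
Qed.

Lemma HomOFD phi u v : Hom phi -> phi (u + v) = phi u + phi v.
Proof.
by case=> lin _; have := lin 1 u v; rewrite scale1r rmorph1 scale1r.
Qed.

Lemma HomOFZ phi a u : Hom phi -> phi (a *: u) = tofrac a *: (phi u : M).
Proof.
by move=> hp; have := hp.1 a u 0; rewrite (HomOF0 hp) !addr0.
Qed.

Lemma quot_line_projZ a u : proj (a *: u) = a *: proj u.
Proof. by rewrite [RHS]quot_line_scaleE. Qed.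

Lemma HomOF_iota phi u : Hom phi -> iota (pr (phi u)) = phi u.
Proof. by case=> _ /(_ u)[_ ue]; rewrite prE. Qed.

Lemma HomOFE phi u : Hom phi -> phi (proj u) = iota (\sum_i inc (u 0 i) * coeffs phi i).
Proof.
move=> hp.
have proj0 : proj 0 = 0 by rewrite -(scale0r (0 : 'rV[OD]_d)) quot_line_projZ scale0r.
rewrite {1}[u]row_sum_delta (big_morph proj (quot_line_projD f) proj0).
rewrite (big_morph phi (fun u v => HomOFD u v hp) (HomOF0 hp)) linear_sum.
apply: eq_bigr => i _; rewrite quot_line_projZ HomOFZ // -incZ linearZ /=.
by rewrite /coeffs HomOF_iota.
Qed.

Lemma coeffs_kernel phi : Hom phi -> on_kernel (coeffs phi).
Proof.
move=> hp; apply: iota_inj; rewrite linear0.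
have -> : \sum_i coeffs phi i * inc (f 0 i) = \sum_i inc (f 0 i) * coeffs phi i.
  by apply: eq_bigr => i _; rewrite mulrC.
rewrite -HomOFE // -[RHS](HomOF0 hp); congr phi.
transitivity (proj 0); last by rewrite -(scale0r (0 : 'rV[OD]_d)) quot_line_projZ scale0r.
by apply/quot_line_projP/lineP; exists 1; rewrite subr0 scale1r.
Qed.

Lemma coeffs_int phi i : Hom phi -> Oint (coeffs phi i).
Proof.
move=> hp; apply/(intclosure_iota iota_inj iotaM); rewrite HomOF_iota //.
by case: hp => _ /(_ (proj (delta_mx 0 i)))[].
Qed.

Lemma coeffs_inj phi psi : Hom phi -> Hom psi -> coeffs phi =1 coeffs psi -> phi = psi.
Proof.
move=> hp hs e1; apply/funext => q; rewrite -(quot_line_reprK q) !HomOFE //.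
by congr (iota _); apply: eq_bigr => i _; rewrite e1.
Qed.

Lemma hom_of_coeffs_HomOF y : on_kernel y -> (forall i, Oint (y i)) -> Hom (hom_of_coeffs y).
Proof.
move=> yf Oy; split=> [a u v|u].
  rewrite -(quot_line_reprK u) -(quot_line_reprK v) -quot_line_projZ -quot_line_projD !hom_of_coeffsE //.
  rewrite -linearP /=; congr (iota _); rewrite scaler_sumr -big_split /=.
  by apply: eq_bigr => i _; rewrite !mxE rmorphD rmorphM /= incZ; ring.
apply/OF_iota; eexists; last by reflexivity.
by apply: Oint_sum => i _; apply: OintM => //; exact: Oint_inc.
Qed.

Lemma hom_of_coeffsK y : on_kernel y -> coeffs (hom_of_coeffs y) =1 y.
Proof.
move=> yf i; rewrite /coeffs hom_of_coeffsE // (comp_projK iota_inj iota1 iotaM prE).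
rewrite (bigD1 i) //= big1 => [|j ji]; rewrite !mxE eqxx.
  by rewrite eqxx rmorph1 mul1r addr0.
by rewrite (negPf ji) rmorph0 mul0r.
Qed.

Lemma lform_act_delta i h : lform_act to (delta_mx 0 i : 'rV[OD]_d) h = delta_mx 0 (to i h).
Proof.
rewrite /lform_act (bigD1 i) //= big1 => [|j ji].
  by rewrite !mxE !eqxx scale1r addr0.
by rewrite !mxE eqxx (negPf ji) scale0r.
Qed.

Lemma Xi_equivariant phi : Xi phi -> equivariant H rho to (f 0) (coeffs phi).
Proof.
case=> hp hx; split; [by move=> i; exact: coeffs_int | | exact: coeffs_kernel].
move=> i h hH; rewrite HE in hH.
rewrite /coeffs -lform_act_delta -(quot_line_actE _ (f_inv h)) hx //.
by rewrite /rho HomOF_iota.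
Qed.

Lemma equivariant_Xi y : equivariant H rho to (f 0) y -> Xi (hom_of_coeffs y).
Proof.
case=> Oy yH yf; split; first exact: hom_of_coeffs_HomOF.
move=> h u hH; have hH' : h \in H by rewrite HE.
rewrite -(quot_line_reprK u) (quot_line_actE _ (f_inv h)) !hom_of_coeffsE //.
set v := generic_quotient.repr _.
rewrite -(iota_rho E_cover iota1 iotaM prE) //.
have rl g : g \in H -> forall a x y, rho (a *: x + y) g = a *: rho x g + rho y g.
  by rewrite HE => gH; exact: (rho_linear E_cover iota_inj iota1 iotaM prE gH).
rewrite (rho_comb rl) //; congr (iota _).
transitivity (\sum_i inc (v 0 i) * y (to i h)); last first.
  by apply: eq_bigr => i _; rewrite yH.
rewrite (reindex_inj (act_inj to h)) /=; apply: eq_bigr => i _; congr (inc _ * _).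
rewrite summxE (bigD1 i) //= big1 => [|j ji]; rewrite !mxE eqxx /=.
  by rewrite eqxx mulr1 addr0.
by rewrite (inj_eq (act_inj to h)) eq_sym (negPf ji) mulr0.
Qed.

Lemma HomOF_submod : is_submod (@OF OD M e) Hom.
Proof.
have OF0 : OF e 0 by apply/OF_iota; exists 0; [exact: Oint0 | rewrite linear0].
split.
- by split=> [a u v|u //]; rewrite scaler0 addr0.
- move=> phi psi [lp op] [ls os]; split=> [a u v|u].
    by rewrite /= [(phi + psi) _]/(_ + _) lp ls scalerDr addrACA.
  have /OF_iota[y Oy yE] := op u; have /OF_iota[z Oz zE] := os u.
  by apply/OF_iota; exists (y + z); [exact: OintD | rewrite linearD -yE -zE].
move=> a phi /OF_iota[b Ob ->] [lp op]; split=> [c u v|u].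
  rewrite -[(_ *: phi) _]/(iota b * _) lp mulrDr; congr (_ + _).
  by rewrite -scalerAr.
have /OF_iota[y Oy yE] := op u; apply/OF_iota; exists (b * y); first exact: OintM.
by rewrite iotaM -yE.
Qed.

Variable p : L.
Variables (P : 'M[L]_(d.-1)) (len : nat).
Hypothesis P_rows : forall i, exists y, equivariant H rho to (f 0) y /\ row i P = omit i0 y.
Hypothesis P_span : forall y, equivariant H rho to (f 0) y ->
  exists c, int_rows c /\ omit i0 y = c *m P.
Hypothesis P_len : has_comp_series (@Oint OD L) (@int_rows OD L d.-1) (row_lattice P) len.

Lemma omit_inj y z : on_kernel y -> on_kernel z -> omit i0 y = omit i0 z -> y =1 z.
Proof.
move=> yf zf e1.
have el i : i != i0 -> y i = z i.
  case: (unliftP i0 i) => [j ->|->]; last by rewrite eqxx.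
  by move=> _; move/rowP: e1 => /(_ j); rewrite !mxE.
move=> i; have [->|/el //] := eqVneq i i0.
have f0 : inc (f 0 i0) != 0.
  by rewrite inc_eq0; apply: contraTneq f_unit => ->; rewrite unitr0.
apply: (mulIf f0); move: yf zf; rewrite /on_kernel (bigD1 i0) // [in X in _ -> X](bigD1 i0) //=.
move=> /eqP; rewrite addr_eq0 => /eqP -> /eqP; rewrite addr_eq0 => /eqP ->.
by congr (- _); apply: eq_bigr => j /el ->.
Qed.

(** A map on N is encoded by its values at the coordinates other than [i0]; this carries [Hom] to
    the integral rows and the span of [Xi] to the row lattice of [P]. *)
Lemma hyperplane_series :
  has_comp_series (@OF OD M e) Hom (submod_gen (@OF OD M e) Xi) len.
Proof.
have f0 : inc (f 0 i0) != 0.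
  by rewrite inc_eq0; apply: contraTneq f_unit => ->; rewrite unitr0.
have XiHom : (Xi `<=` Hom)%classic by move=> phi [].
have YHom : (submod_gen (@OF OD M e) Xi `<=` Hom)%classic.
  by apply: smallest_sub => //; exact: HomOF_submod.
have prD : {morph pr : x y / x + y}.
  by move=> x y; have := comp_proj_linear iota_inj prE 1 x y; rewrite !scale1r.
have pr0 : pr 0 = 0 by apply: iota_inj; rewrite prE mul0r linear0.
have prM := comp_proj_mul E_cover F_comp iota_inj iotaM prE.
pose th (phi : N -> M^o) := omit i0 (coeffs phi).
have thD : {morph th : u v / u + v}.
  by move=> u v; apply/rowP => j; rewrite !mxE -prD.
have th0 : th 0 = 0 by apply/rowP => j; rewrite !mxE; exact: pr0.
have thZ a u : th (a *: u) = pr a *: th u.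
  by apply/rowP => j; rewrite !mxE -prM.
have th_inj u v : Hom u -> Hom v -> th u = th v -> u = v.
  move=> hu hv /(omit_inj (coeffs_kernel hu) (coeffs_kernel hv)).
  exact: coeffs_inj.
have [Hom_0 Hom_D Hom_Z] := HomOF_submod.
apply: (transport_series th0 thD thZ _ _ HomOF_submod th_inj _ _ YHom _ P_len).
- by move=> a /OF_iota[b Ob ->]; rewrite (comp_projK iota_inj iota1 iotaM prE).
- move=> b Ob; exists (iota b); first by apply/OF_iota; exists b.
  by rewrite (comp_projK iota_inj iota1 iotaM prE).
- by move=> phi hp j; rewrite mxE; exact: coeffs_int.
- move=> u Ou.
  (* The missing value is solved from the equation of the hyperplane; it is integral because f_i0 is
     a unit. *)
  pose y i := if unlift i0 i is Some j then u 0 j else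
    - (inc (f 0 i0))^-1 * \sum_j u 0 j * inc (f 0 (lift i0 j)).
  have yf : on_kernel y.
    rewrite /on_kernel (bigD1 i0) //= sum_lift /y unlift_none mulrC mulNr mulrN mulVKf //.
    under [X in _ + X]eq_bigr do rewrite liftK.
    by rewrite addNr.
  have Oy i : Oint (y i).
    rewrite /y; case: unliftP => [j _|_]; first exact: Ou.
    apply: OintM.
      apply: OintN; have [//] := ounit_inc L f_unit.
    by apply: Oint_sum => j _; apply: OintM; [exact: Ou | exact: Oint_inc].
  exists (hom_of_coeffs y); first exact: hom_of_coeffs_HomOF.
  by apply/rowP => j; rewrite mxE hom_of_coeffsK // /y liftK.
move=> phi hp; split.
  move=> Yphi; pose Z := [set psi | Hom psi /\ row_lattice P (th psi)]%classic.
  suff [//] : Z phi.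
  move: phi Yphi {hp}; apply: smallest_sub.
    have [R0 RD RZ] := row_lattice_submod P.
    split; first by split=> //; rewrite th0.
      by move=> u v [hu Ru] [hv Rv]; split; [exact: Hom_D | rewrite thD; exact: RD].
    move=> a u Aa [hu Ru]; split; first exact: Hom_Z.
    rewrite thZ; apply: RZ => //.
    by case/OF_iota: Aa => b Ob ->; rewrite (comp_projK iota_inj iota1 iotaM prE).
  move=> psi Xpsi; split; first exact: XiHom.
  by have [c [Oc cE]] := P_span (Xi_equivariant Xpsi); exists c => //; rewrite -cE.
case=> c Oc cE.
have /choice[y yP] := P_rows.
have yX i : Xi (hom_of_coeffs (y i)) by apply: equivariant_Xi; case: (yP i).
suff -> : phi = \sum_i (iota (c 0 i) : M) *: (hom_of_coeffs (y i) : N -> M^o).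
  move=> Z [[Z0 ZD ZZ] sZ]; apply: big_ind => // i _.
  by apply: ZZ; [apply/OF_iota; exists (c 0 i) | exact: sZ].
apply: th_inj => //.
  apply: big_ind => // i _; apply: Hom_Z; last exact: XiHom.
  by apply/OF_iota; exists (c 0 i).
rewrite -cE (big_morph th thD th0) mulmx_sum_row; apply: eq_bigr => i _.
rewrite thZ (comp_projK iota_inj iota1 iotaM prE); congr (_ *: _).
have [[_ _ yf] ->] := yP i; apply/rowP => j; rewrite [LHS]mxE [RHS]mxE.
by rewrite hom_of_coeffsK.
Qed.

End HyperplaneLength.

Lemma floor_natdiv (a b : nat) : (0 < b)%N ->
  Num.floor (a%:R / b%:R : rat) = (a %/ b)%:Z.
Proof.
move=> b0; have b0' : 0 < b%:R :> rat by rewrite ltr0n.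
apply: Num.Theory.floor_def; rewrite ler_pdivlMr // ltr_pdivrMr //.
rewrite -PoszD -!pmulrn -!natrM ler_nat ltr_nat addn1.
by rewrite leq_trunc_div ltn_ceil.
Qed.

Lemma bigmin_attained (l : nat) (F : 'I_l -> \bar rat) (a : \bar rat) :
  (forall j, (a <= F j)%E) -> (exists j, F j = a) -> \big[Order.min/+oo%E]_(j < l) F j = a.
Proof.
move=> aF [j Fj]; apply/eqP; rewrite eq_le; apply/andP; split.
  by rewrite -Fj; apply: bigmin_le_cond.
by apply: le_bigmin => [|i _]; rewrite ?leey.
Qed.

(** * From the determinant identity to the formula *)

Theorem corollary11p4
  (OD : idomainType) (OD_dvr : is_dvr OD) (OD_complete : m_adic_complete OD)
  (k : fieldType) (res : {rmorphism OD -> k})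
  (k_residue : is_residue_field res) (k_closed : GRing.closed_field_axiom k)
  (gT : finGroupType) (d : nat) (to : {action gT &-> 'I_d})
  (to_faithful : [faithful [set: gT], on [set: 'I_d] | to])
  (f : 'rV[OD]_d) (f_inv : forall g : gT, lform_act to f g = f)
  (f_unit : exists i : 'I_d, f 0 i \is a GRing.unit)
  (M : falgType {fraction OD}) (act : {action gT &-> M})
  (E_cover : is_Gcover act)
  (e : M) (F_comp : is_component e)
  (H : {group gT}) (H_stab : H = comp_stab act e :> {set gT})
  (l : nat) (le_l_d : (l <= d)%N) (O : 'I_l -> {set 'I_d})
  (O_inj : injective O)
  (O_orbits : [set O j | j : 'I_l]%SET = [set orbit to H i | i : 'I_d]%SET)
  (x_in_O : forall j : 'I_l, widen_ord le_l_d j \in O j) :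
  let x (j : 'I_l) : 'I_d := widen_ord le_l_d j in
  let C (j : 'I_l) : {vspace M} := KC act e 'C_H[x j | to]%g in
  let q (j : 'I_l) : rat :=
    (Num.floor ((disc_exp (C j))%:R / (\dim (C j))%:R : rat))%:~R in
  (vfun act (quot_line_act to (f := f)) e
     = ((2^-1 * \sum_(j < l) (disc_exp (C j))%:R)%R)%:E
       - \big[Order.min/+oo]_(j < l) (valD (f 0%R (x j)) + (q j)%:E))%E
  /\
  (f = \sum_(i < d) delta_mx 0 i ->
   (vfun act (quot_line_act to (f := f)) e
     = ((2^-1 * \sum_(j < l) (disc_exp (C j))%:R)%R)%:E
       - \big[Order.min/+oo]_(j < l) (q j)%:E)%E).
Proof.
move=> x C q.
have [pi piU] := dvr_uniformizer OD_dvr.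
have [i0 f0U] := f_unit.
have MC := cover_mulC E_cover.
(* The function field of F is the whole factor e M: the empty set imposes no invariance. *)
have [L [iota [iota_inj iota1 iotaM iotaW]]] : exists (L : fieldExtType {fraction OD})
    (i : {linear L -> M}), [/\ injective i, i 1 = e, {morph i : x y / x * y} &
    forall x, x \in KC act e finset.set0 <-> exists c, x = i c].
  by apply: KC_model => // h; rewrite inE.
have iotaP z : z * e = z <-> exists c, z = iota c.
  rewrite -iotaW; split=> [ze|/(mem_KC E_cover F_comp)[] //].
  by apply/(mem_KC E_cover F_comp); split=> // h; rewrite inE.
have /choice[pr prE] : forall z, exists c, iota c = z * e.
  move=> z; have [|c cE] := (iotaP (z * e)).1; last by exists c.
  by rewrite -mulrA (comp_idem F_comp).
have [p p0 [pN pmax]] := uniformizer_ext piU OD_complete k_residue k_closed L.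
have ipin : hasv p (inc L pi) #|H|.
  rewrite -(rho_dim E_cover F_comp iota_inj iota1 iotaM prE H_stab).
  by case: (hasv_pi_dim piU OD_complete k_residue k_closed p0 pN pmax).
have OE j : O j = orbit to H (x j).
  have : O j \in [set orbit to H i | i : 'I_d]%SET by rewrite -O_orbits imset_f.
  case/imsetP => i _ Oi; rewrite Oi; apply/esym/orbit_eqP.
  by rewrite -Oi; exact: x_in_O.
have O_cover i : exists j, i \in orbit to H (x j).
  have : orbit to H i \in [set O j | j : 'I_l]%SET by rewrite O_orbits imset_f.
  by case/imsetP => j _ ij; exists j; rewrite -OE -ij orbit_refl.
have O_uniq i j j' : i \in orbit to H (x j) -> i \in orbit to H (x j') -> j = j'.
  move=> /orbit_eqP ij /orbit_eqP ij'; apply: O_inj.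
  by rewrite !OE -ij -ij'.
have /choice[sg sgP] : forall j, exists s : 'I_d -> gT, forall o,
    o \in orbit to H (x j) -> s o \in H /\ to (x j) (s o) = o.
  move=> j; have /choice[s sP] : forall o, exists g, o \in orbit to H (x j) ->
      g \in H /\ to (x j) g = o.
    move=> o; have [/orbitP[g gH <-]|oO] := boolP (o \in orbit to H (x j)); first by exists g.
    by exists 1%g.
  by exists s.
have f_orb i g : f 0 (to i g) = f 0 i.
  have /rowP/(_ (to i g)) := f_inv g; rewrite /lform_act summxE => <-.
  rewrite (bigD1 i) //= big1 => [|j ji]; rewrite !mxE eqxx /=.
    by rewrite eqxx mulr1 addr0.
  by rewrite (inj_eq (act_inj to g)) eq_sym (negPf ji) mulr0.
have inv j := orbit_invariants E_cover F_comp iota_inj iota1 iotaM prE H_stab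
  piU OD_complete k_residue k_closed (sgP j).
have /choice[w wP] := fun j => (inv j).2.
pose dd j := disc_exp (C j); pose mm j := \dim (C j).
have rl h : h \in H -> _ := fun hH => rho_linear E_cover iota_inj iota1 iotaM prE (mem_stab H_stab hH).
have rm h : h \in H -> _ := fun hH => rho_morph E_cover iota_inj iota1 iotaM prE (mem_stab H_stab hH).
have r1 h : h \in H -> rho act iota pr 1 h = 1.
  move=> /(mem_stab H_stab) hH; apply: iota_inj.
  by rewrite (iota_rho E_cover iota1 iotaM prE) // iota1; apply/stabP.
have rint z h : h \in H -> Oint z -> Oint (rho act iota pr z h).
  by move=> hH; apply: (rho_int E_cover iota_inj iota1 iotaM prE H_stab hH).
have [a [P [N [[OP PN] Na [PB BP] amin [j0 [v0 [fv0 aE]]]]]]] :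
  exists a (P : 'M[L]_(d.-1)) N,
  [/\ (forall i j, Oint (P i j)) /\ hasv p (\det P) N,
      (N + #|H| * a).*2 = (#|H| * \sum_j dd j)%N,
      (forall i, exists y, equivariant H (rho act iota pr) to (f 0) y /\ row i P = omit i0 y) /\
      (forall y, equivariant H (rho act iota pr) to (f 0) y ->
         exists c, int_rows c /\ omit i0 y = c *m P),
      forall j v, has_val pi (f 0 (x j)) v -> (a <= v + dd j %/ mm j)%N &
      exists j v, has_val pi (f 0 (x j)) v /\ a = (v + dd j %/ mm j)%N].
  apply: (@equivariant_lattice _ pi piU OD_complete k res k_residue k_closed L p p0 pN pmax
    #|H| ipin gT H (rho act iota pr) rl rm r1 _ rint d to (f 0) f_orb l x O_cover O_uniq
    sg sgP mm dd w) => //.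
  - by move=> g h gH hH z; exact: (rho_comp E_cover iota_inj iota1 iotaM prE H_stab gH hH z).
  - by move=> j; case: (inv j).
  - by move=> j; case: (wP j).
  - by move=> j; case: (wP j).
  - by move=> j; case: (wP j).
  - by move=> j; case: (wP j).
  - by move=> j; case: (wP j) => _ _ _ _ [].
  - by move=> j; case: (wP j) => _ _ _ _ [].
have series := lattice_series p0 pN pmax OP PN.
have hs := hyperplane_series E_cover F_comp iota_inj iota1 iotaM iotaP prE H_stab
  f_inv f0U PB BP series.
(* As 2 (N + #|H| a) = #|H| sum_j d_j, the length [N] divided by #|H| is half of the sum minus
   [a]. *)
have vE : vfun act (quot_line_act to (f := f)) e
    = ((2^-1 * \sum_(j < l) (disc_exp (C j))%:R)%R - a%:R)%:E.
  rewrite /vfun (quot_lengthE _ hs); last first.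
    exists (- e).
      apply/(OF_iota iota_inj iota1 iotaM iotaP); exists (-1); first exact/OintN/Oint1.
      by rewrite linearN iota1.
    move=> phi [_ op]; apply/funext => u.
    rewrite -[(_ *: _) u]/(- e * phi u) mulNr MC.
    by case: (op u) => _ ->.
  rewrite -H_stab -EFinM; congr (_%:E).
  have n0 : #|H|%:R != 0 :> rat by rewrite pnatr_eq0 -lt0n cardG_gt0.
  apply: (mulfI n0); rewrite mulrA mulfV // mul1r.
  have := congr1 (fun n : nat => n%:R : rat) Na.
  rewrite -muln2 !natrM natrD natrM natr_sum => e2.
  have h2 : (2%:R : rat) != 0 by [].
  apply: (mulIf h2); rewrite mulrBr mulrBl mulrA.
  set S := \sum_(j < l) _ in e2 *.
  have -> : #|H|%:R * 2^-1 * S * 2 = #|H|%:R * S by field.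
  by rewrite -e2; ring.
have qE j : q j = (dd j %/ mm j)%:R.
  rewrite /q floor_natdiv // (inv j).1.
  by apply/card_gt0P; exists (x j); exact: orbit_refl.
have minE : \big[Order.min/+oo%E]_(j < l) (valD (f 0%R (x j)) + (q j)%:E)%E = (a%:R)%:E.
  apply: bigmin_attained => [j|].
    (* A zero coefficient has valuation +oo and does not affect the minimum. *)
    have [->|/(has_val_ex piU OD_complete)[v fv]] := eqVneq (f 0 (x j)) 0.
      by rewrite (valD0 piU) addye // leey.
    by rewrite (valDE piU fv) qE -EFinD lee_fin -natrD ler_nat; exact: amin.
  by exists j0; rewrite (valDE piU fv0) qE -EFinD -natrD aE.
have main : (vfun act (quot_line_act to (f := f)) e
     = ((2^-1 * \sum_(j < l) (disc_exp (C j))%:R)%R)%:E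
       - \big[Order.min/+oo]_(j < l) (valD (f 0%R (x j)) + (q j)%:E))%E.
  by rewrite minE vE EFinB.
split=> // f1; rewrite main; congr (_ - _)%E; apply: eq_bigr => j _.
have -> : f 0 (x j) = 1.
  rewrite f1 summxE (bigD1 (x j)) //= big1 => [|i ij]; rewrite !mxE eqxx /=.
    by rewrite eqxx addr0.
  by rewrite eq_sym (negPf ij).
by rewrite (valDE piU (has_val_unit pi (unitr1 _))) add0e.
Qed.
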